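(* Let $\Omega\subset\mathbb{R}^n$ be an open domain. Let $M:[0,\infty)\to[0,\infty)$ be an $N$-function of class $C^1((0,\infty))$ that satisfies the $\Delta_2$-condition and is such that $M'(\lambda)/\lambda$ is bounded for $\lambda$ near zero. Let $\mu(dx)=e^{-\varphi(x)}dx$ be a Radon measure on $\Omega$, where $\varphi:\Omega\to\mathbb{R}$ belongs to $W^{1,\infty}_{loc}(\Omega)$. Let $P,Q:[0,\infty)\to[0,\infty)$ be nondecreasing measurable functions with $P(0)=Q(0)=0$ such that for all $u,v,w>0$ $$\frac{M(u)}{u^2}\,vw\le M(u)+P(v)+Q(w).$$ Suppose that there are constants $K,A>0$ such that for every $u\in C_0^\infty(\Omega)$ $$\int_\Omega P(|\nabla\varphi|\,|u|)\,d\mu\le K\int_\Omega P(A|\nabla u|)\,d\mu .$$ Then: 1) There exist constants $L,B>0$ such that for every $\theta>0$ and every $u\in C_0^\infty(\Omega)$ $$\int_\Omega M(|\nabla u|)\,d\mu\le L\int_\Omega P(\theta|\nabla^{(2)}u|)\,d\mu+\int_\Omega Q\Big(\frac{B}{\theta}|u|\Big)\,d\mu .$$ 2) If additionally $P$ and $Q$ are $N$-functions, then for every $u\in C_0^\infty(\Omega)$ $$\|\nabla u\|_{L^M(\Omega,\mu)}\le \tilde L\sqrt{\|\nabla^{(2)}u\|_{L^P(\Omega,\mu)}\,\|u\|_{L^Q(\Omega,\mu)}},$$ where $\tilde L=2(L+2)\sqrt{B}$ and $L,B$ are the same constants as in 1).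
   Context: $C_0^\infty(\Omega)$ denotes the smooth real-valued functions compactly supported in $\Omega$; $\nabla^{(2)}u$ is the matrix of second-order partial derivatives of $u$ and $|\nabla^{(2)}u|$ its Euclidean (Hilbert–Schmidt) norm. An $N$-function is a continuous convex function $M:[0,\infty)\to[0,\infty)$ with $\lim_{\lambda\to0}M(\lambda)/\lambda=\lim_{\lambda\to\infty}\lambda/M(\lambda)=0$. $M$ satisfies the $\Delta_2$-condition if there is $c>0$ with $M(2\lambda)\le cM(\lambda)$ for all $\lambda>0$. For an $N$-function $R$ the Luxemburg norm is $\|f\|_{L^R(\Omega,\mu)}=\inf\{k>0:\int_\Omega R(|f(x)|/k)\,d\mu(x)\le1\}$; for vector- or matrix-valued $f$, $|f|$ denotes the Euclidean norm. *)

(* Defs.v *)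
From HB Require Import structures.
From mathcomp Require Import all_boot all_order all_algebra.
From mathcomp Require Import all_classical all_reals all_analysis.
Set Implicit Arguments.
Unset Strict Implicit.
Unset Printing Implicit Defensive.
Import Order.TTheory GRing.Theory Num.Theory.
Import numFieldNormedType.Exports.
Local Open Scope classical_set_scope.
Local Open Scope ring_scope.

(* R^n is 'rV[R]_n.  The library equips it with the norm topology but with no
   sigma-algebra or measure: below, the Borel sigma-algebra is attached to
   matrices, and n-dimensional Lebesgue measure is the iterated product. *)
Definition matrix_borel_display : measure_display.
Proof. exact. Qed.

HB.instance Definition _ (R : realType) (m n : nat) :=
  @isMeasurable.Build matrix_borel_display 'M[R]_(m, n) <<s @open 'M[R]_(m, n) >>
    (@sigma_algebra0 _ setT _) (@sigma_algebraC _ _)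
    (@sigma_algebra_bigcup _ setT _).

Section rV_measurability.
Context {R : realType}.

Lemma open_measurable_rV n (U : set 'rV[R]_n) : open U -> measurable U.
Proof. exact: sub_sigma_algebra. Qed.

Lemma measurable_coord_rV n (i : 'I_n) :
  measurable_fun [set: 'rV[R]_n]
    (fun v : 'rV[R]_n => v ord0 i).
Proof.
apply: (measurability _ (measurable_realfun.RGenOpens.measurableE R)).
move=> _ [_ [a [b ->] <-]]; rewrite setTI; apply: open_measurable_rV.
apply: open_comp; last exact: interval_open.
by move=> x _; exact: coord_continuous.
Qed.

Lemma measurable_fun_rV d (T : measurableType d) n (f : T -> 'rV[R]_n) :
  (forall i, measurable_fun [set: T]
     (fun t => f t ord0 i)) ->
  measurable_fun [set: T] f.
Proof.
move=> mf; apply: (@measurability _ _ _ _ _ _ (@open 'rV[R]_n)) => //.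
move=> _ [U oU <-]; rewrite setTI.
pose box (p : 'rV[rat]_n * nat) : set 'rV[R]_n :=
  [set x | forall i, `|ratr (p.1 ord0 i) - x ord0 i| < p.2.+1%:R^-1].
have -> : f @^-1` U =
    \bigcup_(p in [set p | box p `<=` U]) (f @^-1` box p).
  rewrite -preimage_bigcup; congr (_ @^-1` _).
  apply/seteqP; split=> [x Ux|x [p pU px]]; last exact: pU.
  have /nbhs_ballP[e /= e0 xeU] : nbhs x U by exact: open_nbhs_nbhs.
  have [k ke] : exists k : nat, k.+1%:R^-1 < e / 2.
    have e20 : 0 < e / 2 by rewrite divr_gt0.
    have [k _ /(_ k (leqnn k))] := near_infty_natSinv_lt (PosNum e20).
    by exists k.
  have /choice[q hq] i : exists q : rat, `|ratr q - x ord0 i| < k.+1%:R^-1.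
    have : x ord0 i - k.+1%:R^-1 < x ord0 i + k.+1%:R^-1.
      by rewrite ltrD2l gtrN// invr_gt0.
    move=> /rat_in_itvoo[q /[!in_itv]/= /andP[q1 q2]]; exists q.
    by rewrite ltr_distl q1.
  exists (\row_i q i, k) => /=; last by move=> i /=; rewrite mxE.
  move=> y /= yq; apply: xeU; split => // j i.
  rewrite /= (ord1 j) /ball/= (@le_lt_trans _ _ (`|x ord0 i - ratr (q i)| + `|ratr (q i) - y ord0 i|))//.
    by rewrite (le_trans _ (ler_normD _ _))// addrA subrK.
  rewrite (splitr e) ltrD//; first by rewrite distrC (lt_trans (hq i)).
  by have := yq i; rewrite mxE => /lt_trans; apply.
rewrite bigcup_mkcond; apply: countable_bigcupT_measurable => [//|p].
case: ifPn => // _; have -> : f @^-1` box p = \bigcap_(i in [set: 'I_n])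
    ((fun t => f t ord0 i) @^-1` ball (ratr (p.1 ord0 i) : R) p.2.+1%:R^-1).
  by apply/seteqP; split=> t /= h i; [move=> _; exact: h|exact: h].
apply: fin_bigcap_measurable => // i _; rewrite -[X in measurable X]setTI.
by apply: mf => //; exact: measurable_realfun.measurable_ball.
Qed.

End rV_measurability.

(* R^(n+1) = R x R^n *)
Definition rV_cons (R : realType) (n : nat)
    (p : R * 'rV[R]_n) : 'rV[R]_n.+1 :=
  row_mx (p.1%:M : 'rV[R]_1) p.2.

Section lebesgue_rV.
Context {R : realType}.

Lemma rV_consE0 n (p : R * 'rV[R]_n) :
  rV_cons p ord0 ord0 = p.1.
Proof.
transitivity (rV_cons p ord0 (lshift n (ord0 : 'I_1))).
  by congr (rV_cons p _ _); exact: val_inj.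
by rewrite [LHS]row_mxEl mxE eqxx mulr1n.
Qed.

Lemma rV_consES n (p : R * 'rV[R]_n) (i : 'I_n) :
  rV_cons p ord0 (lift ord0 i) = p.2 ord0 i.
Proof.
transitivity (rV_cons p ord0 (rshift 1 i)).
  by congr (rV_cons p _ _); exact: val_inj.
by rewrite [LHS]row_mxEr.
Qed.

Lemma measurable_rV_cons n : measurable_fun setT (@rV_cons R n).
Proof.
apply: measurable_fun_rV => i; case: (unliftP ord0 i) => [j|] ->.
- rewrite (_ : (fun _ => _) = (fun v : 'rV[R]_n => v ord0 j) \o snd); last first.
    by apply/funext => p /=; rewrite rV_consES.
  by apply: measurableT_comp => //; exact: measurable_coord_rV.
- rewrite (_ : (fun _ => _) = fst)//.
  by apply/funext => p; rewrite rV_consE0.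
Qed.

Section step.
Variables (n : nat) (nu : {sigma_finite_measure set 'rV[R]_n -> \bar R}).

Definition lebesgue_rV_step : set 'rV[R]_n.+1 -> \bar R :=
  pushforward (lebesgue_measure \x nu)%E (@rV_cons R n).

Let step0 : lebesgue_rV_step set0 = 0%E.
Proof. by rewrite /lebesgue_rV_step /pushforward preimage_set0 measure0. Qed.

Let step_ge0 A : (0 <= lebesgue_rV_step A)%E.
Proof. by rewrite /lebesgue_rV_step /pushforward measure_ge0. Qed.

Let step_sigma_additive : semi_sigma_additive lebesgue_rV_step.
Proof.
move=> F mF tF mUF; rewrite /lebesgue_rV_step /pushforward preimage_bigcup.
have mcons A : measurable A -> measurable (@rV_cons R n @^-1` A).
  by move=> mA; rewrite -[X in measurable X]setTI; exact: measurable_rV_cons.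
apply: measure_semi_sigma_additive => [k||]; first exact: mcons.
- apply/trivIsetP => /= i j _ _ ij; rewrite -preimage_setI.
  by move/trivIsetP : tF => /(_ _ _ _ _ ij) ->//; rewrite preimage_set0.
- by rewrite -preimage_bigcup; exact: mcons.
Qed.

HB.instance Definition _ := isMeasure.Build _ _ _ lebesgue_rV_step
  step0 step_ge0 step_sigma_additive.

Let step_sigma_finite : sigma_finite setT lebesgue_rV_step.
Proof.
have /sigma_finiteP[F [FT ndF Foo]] := sigma_finiteT (@lebesgue_measure R).
have /sigma_finiteP[G [GT ndG Goo]] := sigma_finiteT nu.
pose box k : set 'rV[R]_n.+1 := [set v | F k (v ord0 ord0)] `&`
  [set v | G k (\row_i v ord0 (lift ord0 i))].
exists box.
  apply/esym; rewrite -subTset => v _.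
  have [i _ Fi] : (\bigcup_i F i) (v ord0 ord0) by rewrite -FT.
  have [j _ Gj] : (\bigcup_j G j) (\row_i v ord0 (lift ord0 i)) by rewrite -GT.
  exists (maxn i j) => //; split => /=.
  - by move: Fi; apply/subsetPset/ndF/leq_maxl.
  - by move: Gj; apply/subsetPset/ndG/leq_maxr.
move=> k; have [mF Fk] := Foo k; have [mG Gk] := Goo k; split.
  apply: measurableI; rewrite -[X in measurable X]setTI.
  - exact: measurable_coord_rV.
  - suff mrow : measurable_fun setT
        (fun v : 'rV[R]_n.+1 => \row_i v ord0 (lift ord0 i)) by exact: mrow.
    apply: measurable_fun_rV => i; under eq_fun do rewrite mxE.
    exact: measurable_coord_rV.
rewrite /lebesgue_rV_step /pushforward.
rewrite (_ : _ @^-1` _ = F k `*` G k).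
  by rewrite product_measure1E// lte_mul_pinfty// ge0_fin_numE.
apply/seteqP; split=> -[x v] /=; rewrite /box /= rV_consE0;
  by rewrite (_ : \row_i _ = v)//; apply/rowP => i; rewrite mxE rV_consES.
Qed.

HB.instance Definition _ := Measure_isSigmaFinite.Build _ _ _ lebesgue_rV_step
  step_sigma_finite.

End step.

(* R^0 is a point, of mass 1. *)
Fixpoint lebesgue_rV n : {sigma_finite_measure set 'rV[R]_n -> \bar R} :=
  match n with
  | 0 => \d_ (0 : 'rV[R]_0)
  | m.+1 => lebesgue_rV_step (lebesgue_rV m)
  end.

End lebesgue_rV.

Lemma lebesgue_rV_box (R : realType) n (I : 'I_n -> interval R) :
  lebesgue_rV n [set v : 'rV[R]_n | forall i, v ord0 i \in I i] =
  (\prod_(i < n) lebesgue_measure ([set` I i] : set R))%E.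
Proof.
elim: n I => [I|n IHn I].
  by rewrite big_ord0 /= diracE mem_set// => -[].
rewrite big_ord_recl -IHn /= /lebesgue_rV_step /pushforward.
rewrite (_ : _ @^-1` _ = [set` I ord0] `*`
    [set v : 'rV[R]_n | forall i, v ord0 i \in I (lift ord0 i)]).
  rewrite product_measure1E//.
  rewrite (_ : [set _ | _] = \bigcap_(i in [set: 'I_n])
      ((fun v : 'rV[R]_n => v ord0 i) @^-1` [set` I (lift ord0 i)])).
    apply: fin_bigcap_measurable => // i _; rewrite -[X in measurable X]setTI.
    exact: measurable_coord_rV.
  by apply/seteqP; split=> v /= h i; [move=> _; exact: h|exact: h].
apply/seteqP; split=> -[x v] /=.
  move=> h; split=> [|i]; first by have := h ord0; rewrite rV_consE0.
  by have := h (lift ord0 i); rewrite rV_consES.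
by move=> [Ix Iv] i; case: (unliftP ord0 i) => [j|] ->;
  rewrite ?rV_consE0 ?rV_consES.
Qed.

Section calculus.
Context {R : realType} {n : nat}.
Implicit Types (Omega : set 'rV[R]_n) (u phi psi : 'rV[R]_n -> R).

Definition partial (i : 'I_n) u : 'rV[R]_n -> R :=
  'D_(delta_mx ord0 i) u.

Fixpoint of_class_C (k : nat) u : Prop :=
  match k with
  | 0 => continuous u
  | k'.+1 => continuous u /\ forall i : 'I_n,
      (forall x, derivable u x (delta_mx ord0 i)) /\ of_class_C k' (partial i u)
  end.

(* A function of C_0^oo(Omega) is identified with its extension by 0 to R^n. *)
Definition test_function Omega u : Prop :=
  [/\ forall k, of_class_C k u,
      compact (closure [set x | u x != 0]) &
      closure [set x | u x != 0] `<=` Omega].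

Definition grad u (x : 'rV[R]_n) : 'rV[R]_n := \row_i partial i u x.

Definition hessian u (x : 'rV[R]_n) : 'M[R]_n :=
  \matrix_(i, j) partial i (partial j u) x.

Definition open_domain Omega : Prop :=
  [/\ open Omega, connected Omega & Omega !=set0].

Definition Linfty_loc Omega phi : Prop :=
  measurable_fun Omega phi /\
  forall K, compact K -> K `<=` Omega ->
    exists C : R, {ae lebesgue_rV n, forall x, K x -> `|phi x| <= C}.

Definition weak_gradient Omega phi (g : 'rV[R]_n -> 'rV[R]_n) : Prop :=
  forall psi, test_function Omega psi -> forall i : 'I_n,
    (\int[lebesgue_rV n]_(x in Omega) (phi x * partial i psi x)%:E =
     - \int[lebesgue_rV n]_(x in Omega) (g x ord0 i * psi x)%:E)%E.

(* phi belongs to W^{1,oo}_loc(Omega), with weak gradient g.  The functions phi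
   and g are Borel representatives of their classes of a.e. equality. *)
Definition W1oo_loc Omega phi (g : 'rV[R]_n -> 'rV[R]_n) : Prop :=
  [/\ Linfty_loc Omega phi,
      forall i : 'I_n, Linfty_loc Omega (fun x => g x ord0 i) &
      weak_gradient Omega phi g].

Definition radon_on Omega (mu : set 'rV[R]_n -> \bar R) : Prop :=
  (forall K, compact K -> K `<=` Omega -> mu K < +oo)%E /\
  (forall A, measurable A -> A `<=` Omega ->
    mu A = ereal_sup [set mu K | K in [set K | compact K /\ K `<=` A]]).

End calculus.

(* The norm of 'M[R]_(m, n) in the library is the sup norm. *)
Definition enorm (R : realType) (m n : nat) (A : 'M[R]_(m, n)) : R :=
  Num.sqrt (\sum_(i < m) \sum_(j < n) A i j ^+ 2).

Section orlicz.
Context {R : realType}.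

(* M l > 0 for large l is part of the meaning of l / M l -> 0; it has to be
   explicit because division by 0 yields 0. *)
Definition N_function (M : R -> R) : Prop :=
  [/\ forall l : R, 0 <= l -> 0 <= M l,
      {within `[0, +oo[, continuous M},
      convex_function (`[0, +oo[%classic : set R) M,
      (M l / l) @[l --> 0^'+] --> (0 : R) &
      (\forall l \near +oo, 0 < M l) /\ (l / M l) @[l --> +oo] --> (0 : R)].

Definition Delta2 (M : R -> R) : Prop :=
  exists2 c : R, 0 < c & forall l : R, 0 < l -> M (2 * l) <= c * M l.

Definition C1_pos (M : R -> R) : Prop :=
  forall l : R, 0 < l -> derivable M l 1 /\ {for l, continuous (derive1 M)}.

(* Value +oo when no k is admissible. *)
Definition luxemburg d (T : measurableType d) (mu : set T -> \bar R)
    (Omega : set T) (F : R -> R) (f : T -> R) : \bar R :=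
  ereal_inf [set k%:E | k in [set k : R | 0 < k /\
    (\int[mu]_(x in Omega) (F (`|f x| / k))%:E <= 1)%E]].

End orlicz.

(* Main.v *)
(* Let F = M(s) / s^2 grad u with s = sqrt (|grad u|^2 + eps^2).  Integration by
   parts against exp(-phi) gives
     int F . grad u dmu = int u (F . grad phi - div F) dmu,
   and |div F| <= C M(s) / s^2 |hess u| because s M'(s) <= c M(s) by the
   Delta_2 condition.  The hypothesis on M, P, Q, used with
   v = |grad phi| |(theta / A) d_i u| and with v = theta |hess u|, bounds the
   right-hand side by half of int M(s) dmu plus P- and Q-terms; the Hardy
   inequality for (theta / A) d_i u turns the P-terms into P(theta |hess u|).
   Since M(s) |grad u|^2 / s^2 >= M(s) - C eps on the support of u, half of
   int M(s) dmu is absorbed, and eps -> 0 gives the modular inequality.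

   As phi is only locally Lipschitz in the weak sense, the integration by parts
   is obtained from difference quotients: testing the weak gradient with
   translates of bumps shows that phi(x) - phi(x - t e_i) is the integral of the
   i-th weak derivative along the segment for a.e. x near the support, and
   exp(-phi) is then expanded to first order along the translation.

   The multiplicative inequality is the modular one for u / s with
   s = sqrt (B a b) and theta = s / a, where a and b are admissible in the two
   Luxemburg norms. *)

Require Import Defs.
From mathcomp Require Import all_boot all_order all_algebra.
From mathcomp Require Import all_classical all_reals all_analysis.
From mathcomp Require Import measurable_realfun ring lra.
Set Implicit Arguments.
Unset Strict Implicit.
Unset Printing Implicit Defensive.
Import Order.TTheory GRing.Theory Num.Theory.
Import numFieldNormedType.Exports.
Local Open Scope classical_set_scope.
Local Open Scope ring_scope.

(** * Directional derivatives and functions of class C^k *)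

Section directional_derivatives.
Context {R : realType} {V : normedModType R}.
Implicit Types (u : V -> R) (x v : V).

(** Two obstacles shape the proof. [M] is of class C^1 away from 0 only and [grad u] vanishes
    somewhere, hence the regularization: with [s >= eps] each component [u * F_i] has a continuous
    classical derivative along its own axis. And [exp(-phi)] has no pointwise derivative at hand;
    but [h |-> int psi(x + h e_i) exp(-phi(x)) dx] is differentiable because [psi] is, so only the
    value of its derivative at 0 has to be found, and one-sided difference quotients determine it.
    Absorption requires [int M(s) dmu] to be finite. It is taken over the support of [u], which is
    compact, hence of finite measure, and on which [M(s)] is bounded. Constants: the inequality on
    [M], [P], [Q] is used [2n] times, each time divided by [4n], so that [M(s)] comes out with the
    factor 1/2 and [Q], after doubling, with the factor exactly 1. Everything else is pushed into
    the argument of [Q], whence [B = 4nA + 4n(1 + (c + 2)n)]; [L = (1 + K)/2] is twice 1/4 from the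
    divergence plus [K]/4 from the drift. *)

Lemma is_derive_lineP u x v (df : R) :
  is_derive x v u df <-> is_derive (0 : R) (1 : R) (fun h => u (h *: v + x)) df.
Proof.
have E : (fun h : R => h^-1 *: ((u \o shift x) (h *: v) - u x)) =
  (fun h : R => h^-1 *: (((fun h : R => u (h *: v + x)) \o shift (0 : R)) (h *: (1 : R)) -
     u ((0 : R) *: v + x))).
  by apply/funext => h /=; rewrite addr0 scale0r add0r [_%:A]mulr1.
split=> -[d0 d1]; apply: DeriveDef.
- by rewrite /derivable -E.
- by rewrite /derive -E.
- by rewrite /derivable E.
- by rewrite /derive E.
Qed.

Lemma is_derive_comp_real (g : R -> R) u x v (dg df : R) :
  is_derive (u x) 1 g dg -> is_derive x v u df ->
  is_derive x v (g \o u) (dg * df).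
Proof.
move=> dgx /is_derive_lineP du; apply/is_derive_lineP.
rewrite (_ : (fun h : R => _) = g \o (fun h : R => u (h *: v + x)))//.
by apply: is_derive1_comp; rewrite ?scale0r ?add0r.
Qed.

Lemma is_derive_along_line u x v (t df : R) :
  is_derive (x + t *: v) v u df ->
  is_derive t (1 : R) (fun h => u (x + h *: v)) df.
Proof.
move=> /is_derive_lineP du.
have E : (fun h => u (x + h *: v)) =
    (fun h : R => u (h *: v + (x + t *: v))) \o (fun s => s - t).
  by apply/funext => h /=; congr u; rewrite addrCA -scalerDl subrK.
rewrite E -[df]mulr1; apply: is_derive1_comp; first by rewrite subrr.
by rewrite -[X in is_derive _ _ _ X]subr0; apply: is_deriveB.
Qed.

End directional_derivatives.

Section class_C.
Context {R : realType} {n : nat}.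
Implicit Types (u v : 'rV[R]_n -> R).

Lemma of_class_C_cont k u : of_class_C k u -> continuous u.
Proof. by case: k => // k []. Qed.

Lemma of_class_CW k u : of_class_C k.+1 u -> of_class_C k u.
Proof.
elim: k u => [|k IHk] u [cu du] //; split => // i.
by have [du1 /IHk] := du i.
Qed.

Lemma of_class_C_cst k (c : R) : of_class_C k (fun _ : 'rV[R]_n => c).
Proof.
elim: k c => [|k IHk] c; first exact: cst_continuous.
split; first exact: cst_continuous.
move=> i; split=> [x|]; first exact: derivable_cst.
rewrite (_ : partial i _ = fun=> 0)//.
by apply/funext => x; rewrite /partial derive_cst.
Qed.

Lemma of_class_CD k u v :
  of_class_C k u -> of_class_C k v -> of_class_C k (fun x => u x + v x).
Proof.
elim: k u v => [|k IHk] u v; first by move=> /= cu cv x; exact: (continuousD (cu x) (cv x)).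
move=> [cu du] [cv dv]; split; first by move=> x; exact: (continuousD (cu x) (cv x)).
move=> i; have [du1 du2] := du i; have [dv1 dv2] := dv i.
split=> [x|]; first exact: derivableD.
rewrite (_ : partial i _ = fun x => partial i u x + partial i v x); last first.
  by apply/funext => x; rewrite /partial deriveD.
exact: IHk.
Qed.

Lemma of_class_CM k u v :
  of_class_C k u -> of_class_C k v -> of_class_C k (fun x => u x * v x).
Proof.
elim: k u v => [|k IHk] u v; first by move=> /= cu cv x; exact: (continuousM (cu x) (cv x)).
move=> Cu Cv; have [cu du] := Cu; have [cv dv] := Cv.
split; first by move=> x; exact: (continuousM (cu x) (cv x)).
move=> i; have [du1 du2] := du i; have [dv1 dv2] := dv i.
split=> [x|]; first exact: derivableM.
rewrite (_ : partial i _ =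
    fun x => u x * partial i v x + v x * partial i u x); last first.
  by apply/funext => x; rewrite /partial deriveM.
by apply: of_class_CD; apply: IHk => //; exact: of_class_CW.
Qed.

Lemma of_class_C_prod k (I : Type) (r : seq I) (F : I -> 'rV[R]_n -> R) :
  (forall i, of_class_C k (F i)) -> of_class_C k (fun x => \prod_(i <- r) F i x).
Proof.
move=> CF; elim: r => [|i r IHr].
  by under eq_fun do rewrite big_nil; exact: of_class_C_cst.
by under eq_fun do rewrite big_cons; exact: of_class_CM.
Qed.

End class_C.

(** * Smooth functions that vanish on a half-line *)

Section flat.
Context {R : realType}.
Implicit Types (p : {poly R}) (x : R).

(* This family is stable under derivation, so smoothness needs no induction on
   the order of the derivative. *)
Definition flat p x : R := if 0 < x then p.[x^-1] * expR (- x^-1) else 0.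

Lemma poly_growth p :
  exists C : R, exists N : nat, forall y, 1 <= y -> `|p.[y]| <= C * y ^+ N.
Proof.
elim/poly_ind: p => [|p c [C [N hC]]].
  by exists 0, 0%N => y _; rewrite horner0 normr0 mul0r.
exists (C + `|c|), N.+1 => y y1; rewrite hornerMXaddC.
have y0 : 0 <= y by rewrite (le_trans _ y1).
rewrite (le_trans (ler_normD _ _))// mulrDl lerD//.
  by rewrite normrM (ger0_norm y0) exprSr mulrA ler_wpM2r// hC.
by rewrite ler_peMr// exprn_ege1.
Qed.

(** The exponential beats every polynomial: with [y = 1/x], [exp(y) >= y^(N+2)/(N+2)!], and the two
    spare powers of [y] leave the factor [x^2]. This is what makes the difference quotient at 0 tend
    to 0. *)
Lemma flat_bound p :
  exists2 C : R, 0 <= C & forall x, x <= 1 -> `|flat p x| <= C * x ^+ 2.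
Proof.
have [C [N hC]] := poly_growth p.
have C0 : 0 <= C.
  by have := hC 1 (lexx _); rewrite expr1n mulr1; exact: le_trans.
exists (C * (N.+2)`!%:R) => [|x x1]; first by rewrite mulr_ge0.
rewrite /flat; case: ifPn => x0; last first.
  by rewrite normr0; apply: mulr_ge0; [exact: mulr_ge0|exact: sqr_ge0].
have y1 : 1 <= x^-1 by rewrite invf_ge1.
have y0 : 0 < x^-1 by rewrite invr_gt0.
rewrite normrM [X in _ * X]ger0_norm ?expR_ge0//.
rewrite expRN ler_pdivrMr ?expR_gt0//.
rewrite (le_trans (hC _ y1))// -!mulrA ler_wpM2l//.
have h : x^-1 ^+ N.+2 / (N.+2)`!%:R <= expR x^-1.
  by rewrite (le_trans _ (expR_ge1Dxn N.+1 (ltW y0)))// lerDr.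
have -> : x^-1 ^+ N = (N.+2)`!%:R * (x ^+ 2 * (x^-1 ^+ N.+2 / (N.+2)`!%:R)).
  rewrite -addn2 exprD; field.
  by rewrite pnatr_eq0 -lt0n fact_gt0 (gt_eqF x0).
by rewrite ler_wpM2l// [leRHS]mulrA -expr2 ler_wpM2l// sqr_ge0.
Qed.

(** For positive [x] this is the chain rule; the inner derivative [-1/x^2] accounts for the factor
    ['X^2]. At 0 the quadratic bound leaves a difference quotient of order [|h|]. *)
Lemma is_derive_flat p x :
  is_derive x (1 : R) (flat p) (flat ('X^2 * (p - p^`())) x).
Proof.
have [x0|x0|->] := ltgtP x 0.
- rewrite {2}/flat ltNge (ltW x0)/=.
  apply: (@near_eq_is_derive _ _ _ (cst 0)).
  near=> y; rewrite /flat ifF//; apply/negbTE; rewrite -leNgt ltW//.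
  by near: y; exact: lt_nbhsl.
- rewrite {2}/flat x0.
  apply: (@near_eq_is_derive _ _ _
      (fun x => (horner p \o (fun x : R => x^-1)) x *
        (expR \o (fun x : R => - x^-1)) x)).
    by near=> y; rewrite /flat ifT//; near: y; exact: lt_nbhsr.
  have dV : is_derive x (1 : R) (fun x : R => x^-1) (- x^-2).
    apply: DeriveDef; first by apply: derivableV => //; rewrite gt_eqF.
    by rewrite deriveV ?gt_eqF// derive_id [LHS]mulr1.
  have d1 : is_derive x (1 : R) (horner p \o (fun x : R => x^-1))
      (p^`().[x^-1] * - x^-2) by exact: is_derive1_comp.
  have d2 : is_derive x (1 : R) (expR \o (fun x : R => - x^-1))
      (expR (- x^-1) * - - x^-2) by apply: is_derive1_comp.
  apply: is_derive_eq; rewrite !hornerE /= /GRing.scale /=; field.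
  by rewrite gt_eqF.
- have [C C0 hC] := flat_bound p.
  rewrite {2}/flat ltxx.
  have f0 : flat p 0 = 0 by rewrite /flat ltxx.
  have lim : h^-1 *: (flat p (h *: (1 : R) + 0) - flat p 0) @[h --> 0^'] --> (0 : R).
    apply/cvgrPdist_lt => e e0; near=> h.
    rewrite sub0r normrN f0 subr0 addr0 [_%:A]mulr1 normrM normfV.
    have h0 : h != 0 by near: h; exact: nbhs_dnbhs_neq.
    rewrite ltr_pdivrMl ?normr_gt0// (le_lt_trans (hC _ _))//.
      rewrite (le_trans (ler_norm h))//; near: h; apply: dnbhs0_le; exact: ltr01.
    rewrite -real_normK ?num_real// expr2 mulrCA ltr_pM2l ?normr_gt0//.
    rewrite (@le_lt_trans _ _ ((C + 1) * `|h|))//.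
      by rewrite ler_wpM2r// lerDl.
    rewrite -ltr_pdivlMl ?ltr_wpDl//.
    by near: h; apply: dnbhs0_lt; rewrite mulr_gt0// invr_gt0 ltr_wpDl.
  apply: DeriveDef; first by apply/cvg_ex; exists 0.
  by apply: cvg_lim.
Unshelve. all: by end_near. Qed.
End flat.

(** * Boxes and Lebesgue measure *)

Section boxes.
Context {R : realType} {n : nat}.
Implicit Types (a b x v : 'rV[R]_n) (A : set 'rV[R]_n).

Lemma coord_le_norm x i : `|x ord0 i| <= `|x|.
Proof.
rewrite [leRHS]/Num.norm/= mx_normrE; apply/bigmax_geP; right.
by exists (ord0, i).
Qed.

Lemma norm_le_coord x (r : R) : 0 <= r -> (forall i, `|x ord0 i| <= r) -> `|x| <= r.
Proof.
move=> r0 xr; rewrite [leLHS]/Num.norm/= mx_normrE; apply/bigmax_leP; split=> //.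
by move=> [i j] _ /=; rewrite (ord1 i).
Qed.

Definition obox a b : set 'rV[R]_n :=
  [set x | forall i, x ord0 i \in `]a ord0 i, b ord0 i[].

Definition cbox a b : set 'rV[R]_n :=
  [set x | forall i, x ord0 i \in `[a ord0 i, b ord0 i]].

Lemma sub_obox_cbox a b : obox a b `<=` cbox a b.
Proof. by move=> x abx i; apply: subset_itv_oo_cc (abx i). Qed.

Lemma cbox_norm_le a b x : cbox a b x -> `|x| <= `|a| + `|b|.
Proof.
move=> xab; apply: norm_le_coord => [|i]; first by rewrite addr_ge0.
have := xab i; rewrite in_itv/= => /andP[ax xb].
have := coord_le_norm a i; have := coord_le_norm b i.
rewrite !ler_norml => /andP[? ?] /andP[? ?].
by have := normr_ge0 a; have := normr_ge0 b => ? ?; apply/andP; split; lra.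
Qed.

Lemma compact_cbox a b : compact (cbox a b).
Proof.
apply: (@rV_compact _ n (fun i => `[a ord0 i, b ord0 i]%classic)) => i.
exact: segment_compact.
Qed.

Lemma closed_cbox a b : closed (cbox a b).
Proof. by apply: compact_closed; last exact: compact_cbox. Qed.

Lemma open_obox a b : open (obox a b).
Proof.
rewrite openE => x abx; apply: (@filter_forall _ _ _ (nbhs x)) => i.
have C : (fun M : 'rV[R]_n => M ord0 i) @ x --> x ord0 i.
  exact: coord_continuous.
exact: (C _ (near_in_itvoo (abx i))).
Qed.

Lemma measurable_obox a b : measurable (obox a b).
Proof. by apply: open_measurable_rV; exact: open_obox. Qed.

Lemma measurable_cbox a b : measurable (cbox a b).
Proof.
rewrite -[cbox a b]setCK; apply: measurableC; apply: open_measurable_rV.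
by rewrite openC; exact: closed_cbox.
Qed.

Lemma closed_measurable_rV A : closed A -> measurable A.
Proof.
move=> cA; rewrite -[A]setCK; apply: measurableC; apply: open_measurable_rV.
by rewrite openC.
Qed.

Lemma compact_measurable_rV A : compact A -> measurable A.
Proof.
by move=> cA; apply: closed_measurable_rV; apply: compact_closed cA.
Qed.

Lemma continuous_measurable_rV (f : 'rV[R]_n -> R) :
  continuous f -> measurable_fun setT f.
Proof.
move=> cf; apply: (measurability _ (measurable_realfun.RGenOpens.measurableE R)).
move=> _ [_ [a [b ->] <-]]; rewrite setTI; apply: open_measurable_rV.
by apply: open_comp; [move=> x _; exact: cf|exact: interval_open].
Qed.

Lemma oboxI a b c d : obox a b `&` obox c d =
  obox (\row_i Num.max (a ord0 i) (c ord0 i)) (\row_i Num.min (b ord0 i) (d ord0 i)).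
Proof.
apply/seteqP; split=> x /=.
  move=> [abx cdx] i; rewrite !mxE in_itv/= gt_max lt_min.
  by have := abx i; have := cdx i; rewrite !in_itv/= => /andP[-> ->] /andP[-> ->].
by move=> h; split=> i; have := h i; rewrite !mxE !in_itv/= gt_max lt_min =>
  /andP[/andP[? ?] /andP[? ?]]; apply/andP.
Qed.

(** Cubes with rational centre and radius [1/(k+1)]: a countable family, so that almost everywhere
    statements proved on each of them can be combined. *)
Definition rat_obox (p : 'rV[rat]_n * nat) : set 'rV[R]_n :=
  obox (\row_i (ratr (p.1 ord0 i) - p.2.+1%:R^-1))
       (\row_i (ratr (p.1 ord0 i) + p.2.+1%:R^-1)).

Definition rat_cbox (p : 'rV[rat]_n * nat) : set 'rV[R]_n :=
  cbox (\row_i (ratr (p.1 ord0 i) - p.2.+1%:R^-1))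
       (\row_i (ratr (p.1 ord0 i) + p.2.+1%:R^-1)).

(** The union is of open cubes, but the index set asks for the closed ones to lie in [U]: a bump on
    such a cube is then supported in [U]. *)
Lemma open_bigcup_obox (U : set 'rV[R]_n) : open U ->
  U = \bigcup_(p in [set p | rat_cbox p `<=` U]) rat_obox p.
Proof.
move=> oU; apply/seteqP; split=> [x Ux|x [p pU px]]; last first.
  exact/pU/sub_obox_cbox.
have /nbhs_ballP[e /= e0 xeU] : nbhs x U by exact: open_nbhs_nbhs.
have [k ke] : exists k : nat, k.+1%:R^-1 < e / 2.
  have e20 : 0 < e / 2 by rewrite divr_gt0.
  have [k _ /(_ k (leqnn k))] := near_infty_natSinv_lt (PosNum e20).
  by exists k.
have k0 : 0 < (k.+1%:R^-1 : R) by rewrite invr_gt0.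
have /choice[q hq] i : exists q : rat, `|ratr q - x ord0 i| < k.+1%:R^-1.
  have : x ord0 i - k.+1%:R^-1 < x ord0 i + k.+1%:R^-1.
    by rewrite ltrD2l gtrN// invr_gt0.
  move=> /rat_in_itvoo[q /[!in_itv]/= /andP[q1 q2]]; exists q.
  by rewrite ltr_distl q1.
exists (\row_i q i, k) => /=.
  move=> y /= yq; apply: xeU; split => // j i; rewrite (ord1 j) /ball/=.
  have := yq i; have := hq i; rewrite !mxE in_itv/= ltr_distl => /andP[? ?] /andP[? ?].
  have tri (X Y Q D : R) : X - D < Q -> Q < X + D -> Q - D <= Y ->
      Y <= Q + D -> D < e / 2 -> `|X - Y| < e.
    by move=> ? ? ? ? ?; rewrite ltr_distl; apply/andP; split; lra.
  exact: (tri _ _ (ratr (q i)) k.+1%:R^-1).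
by move=> i; have := hq i; rewrite !mxE in_itv/= -ltr_distl distrC.
Qed.

Lemma measurable_rV_obox :
  measurable = <<s [set B | exists a b, B = obox a b] >> :> set (set 'rV[R]_n).
Proof.
apply/seteqP; split; last first.
  apply: smallest_sub; first exact: sigma_algebra_measurable.
  by move=> _ [a [b ->]]; exact: measurable_obox.
apply: smallest_sub; first exact: smallest_sigma_algebra.
move=> U oU; rewrite (open_bigcup_obox oU) bigcup_mkcond.
pose G := [set B : set 'rV[R]_n | exists a b, B = obox a b].
apply: (@countable_bigcupT_measurable _ (g_sigma_algebraType G)) => // p.
case: ifPn => _; last exact: measurable0.
by apply: sub_sigma_algebra; eexists; eexists.
Qed.

Lemma eq_measure_obox (m1 m2 : {measure set 'rV[R]_n -> \bar R}) :
  (forall a b, m1 (obox a b) = m2 (obox a b)) ->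
  (forall a b, m1 (obox a b) < +oo)%E ->
  forall A, measurable A -> m1 A = m2 A.
Proof.
move=> m12 m1oo A mA.
apply: (measure_unique [set B | exists a b, B = obox a b]
  (fun k => obox (const_mx (- k.+1%:R)) (const_mx k.+1%:R))) => //.
- exact: measurable_rV_obox.
- by move=> _ _ [a [b ->]] [c [d ->]]; rewrite oboxI; eexists; eexists.
- by move=> k; eexists; eexists.
- rewrite -subTset => x _; have [k xk] : exists k : nat, `|x| < k.+1%:R.
    have := @archi_boundP _ `|x| (normr_ge0 _) => h; exists (Num.bound `|x|).
    by rewrite (lt_trans h)// ltr_nat.
  exists k => // i; rewrite !mxE in_itv/= -ltr_norml (le_lt_trans _ xk)//.
  exact: coord_le_norm.
- by move=> _ [a [b ->]].
Qed.

End boxes.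

(** * Translation invariance of Lebesgue measure *)

Section translation.
Context {R : realType} {n : nat}.
Implicit Types (a b x v : 'rV[R]_n).
Local Notation lam := (lebesgue_rV n).

Lemma lebesgue_rV_obox a b : lebesgue_rV n (obox a b) =
  (\prod_(i < n) lebesgue_measure (`]a ord0 i, b ord0 i[%classic : set R))%E.
Proof. exact: (lebesgue_rV_box (fun i => `]a ord0 i, b ord0 i[)). Qed.

Lemma lebesgue_obox_lty a b : (lebesgue_rV n (obox a b) < +oo)%E.
Proof.
rewrite lebesgue_rV_obox ltey_eq prode_fin_num// => i _.
by rewrite lebesgue_measure_itv/=; case: ifPn.
Qed.

Lemma measurable_shift v : measurable_fun setT (fun x : 'rV[R]_n => x + v).
Proof.
apply: measurable_fun_rV => i; under eq_fun do rewrite mxE.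
by apply: measurable_funD => //; exact: measurable_coord_rV.
Qed.

Lemma lebesgue_shift v (A : set 'rV[R]_n) : measurable A ->
  pushforward (lebesgue_rV n) (fun x => x + v) A = lebesgue_rV n A.
Proof.
have E a b : (fun x => x + v) @^-1` obox a b = obox (a - v) (b - v).
  apply/seteqP; split=> x /= h i; have := h i;
    by rewrite !mxE !in_itv/= ltrBlDr ltrBrDr.
pose m1 := measure_function_pushforward__canonical__measure_function_Measure
  (lebesgue_rV n) (measurable_shift v).
apply: (@eq_measure_obox _ _ m1) => a b; last first.
  by rewrite /= /pushforward E lebesgue_obox_lty.
rewrite /= /pushforward E !lebesgue_rV_obox; apply: eq_bigr => i _.
rewrite !lebesgue_measure_itv/= !mxE !lte_fin ltrD2r; case: ifPn => // _.
by rewrite -!EFinB; congr (_%:E); ring.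
Qed.

Lemma ge0_integral_shift (f : 'rV[R]_n -> \bar R) v :
  measurable_fun setT f -> (forall x, 0 <= f x)%E ->
  (\int[lebesgue_rV n]_x f (x + v)%R = \int[lebesgue_rV n]_x f x)%E.
Proof.
move=> mf f0; have := @ge0_integral_pushforward _ _ _ _ _ _
  (measurable_shift v) (lebesgue_rV n) setT f measurableT mf.
rewrite preimage_setT => <-; last by move=> x _; exact: f0.
apply: (@eq_measure_integral _ _ _ _ (lebesgue_rV n)
  (measure_function_pushforward__canonical__measure_function_Measure
    (lebesgue_rV n) (measurable_shift v))) => A mA _.
exact: lebesgue_shift.
Qed.

Lemma integral_shift (f : 'rV[R]_n -> \bar R) v :
  measurable_fun setT f ->
  (\int[lebesgue_rV n]_x f (x + v)%R = \int[lebesgue_rV n]_x f x)%E.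
Proof.
move=> mf; rewrite integralE [RHS]integralE; congr (_ - _)%E.
- have mp : measurable_fun setT f^\+%E by exact: measurable_funepos.
  have h := ge0_integral_shift v mp (funepos_ge0 f).
  by rewrite -h; apply: eq_integral => x _; rewrite ?funeposE /funepos.
- have mp : measurable_fun setT f^\-%E by exact: measurable_funeneg.
  rewrite -(ge0_integral_shift v mp (funeneg_ge0 f)).
  by apply: eq_integral => x _; rewrite ?funenegE /funeneg.
Qed.

Lemma Rintegral_shift (f : 'rV[R]_n -> R) v : measurable_fun setT f ->
  \int[lebesgue_rV n]_x f (x + v) = \int[lebesgue_rV n]_x f x.
Proof.
move=> mf; rewrite /Rintegral (integral_shift v (f := EFin \o f))//.
exact/measurable_EFinP.
Qed.

End translation.

(** * Bounded Borel functions of bounded support *)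

Section bounded_measurable.
Context {R : realType} {n : nat}.
Implicit Types f g : 'rV[R]_n -> R.

(** The bound holds everywhere, not almost everywhere. Together with [bounded_supp] this gives a
    class of integrable functions stable under products and translations, which settles the
    integrability conditions of all the manipulations below. *)
Definition bounded_meas f :=
  measurable_fun setT f /\ exists C, forall x, `|f x| <= C.

Definition bounded_supp f := exists r, forall x, f x != 0 -> `|x| <= r.

Lemma bounded_measD f g : bounded_meas f -> bounded_meas g ->
  bounded_meas (fun x => f x + g x).
Proof.
move=> [mf [C hC]] [mg [D hD]]; split; first exact: measurable_funD.
by exists (C + D) => x; rewrite (le_trans (ler_normD _ _))// lerD.
Qed.

Lemma bounded_measB f g : bounded_meas f -> bounded_meas g ->
  bounded_meas (fun x => f x - g x).
Proof.
move=> [mf [C hC]] [mg [D hD]]; split; first exact: measurable_funB.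
by exists (C + D) => x; rewrite (le_trans (ler_normB _ _))// lerD.
Qed.

Lemma bounded_measM f g : bounded_meas f -> bounded_meas g ->
  bounded_meas (fun x => f x * g x).
Proof.
move=> [mf [C hC]] [mg [D hD]]; split; first exact: measurable_funM.
by exists (C * D) => x; rewrite normrM ler_pM.
Qed.

Lemma bounded_meas_cst (c : R) : bounded_meas (fun=> c).
Proof. by split; [exact: measurable_cst|exists `|c|]. Qed.

Lemma bounded_meas_shift f v : bounded_meas f ->
  bounded_meas (fun x => f (x + v)).
Proof.
move=> [mf [C hC]]; split; last by exists C.
by apply: (measurableT_comp mf); exact: measurable_shift.
Qed.

Lemma bounded_meas_norm f : bounded_meas f -> bounded_meas (fun x => `|f x|).
Proof.
move=> [mf [C hC]]; split; first exact: measurableT_comp.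
by exists C => x; rewrite normr_id.
Qed.

Lemma bounded_suppMl f g : bounded_supp f -> bounded_supp (fun x => f x * g x).
Proof.
by move=> [r hr]; exists r => x fg; apply: hr; apply: contra_neq fg => ->;
  rewrite mul0r.
Qed.

Lemma bounded_suppMr f g : bounded_supp g -> bounded_supp (fun x => f x * g x).
Proof.
by move=> [r hr]; exists r => x fg; apply: hr; apply: contra_neq fg => ->;
  rewrite mulr0.
Qed.

Lemma bounded_supp_norm f : bounded_supp f -> bounded_supp (fun x => `|f x|).
Proof. by move=> [r hr]; exists r => x; rewrite normr_eq0; exact: hr. Qed.

Lemma bounded_supp_shift f v : bounded_supp f ->
  bounded_supp (fun x => f (x + v)).
Proof.
move=> [r hr]; exists (r + `|v|) => x fx.
by rewrite -[x](addrK v) (le_trans (ler_normB _ _))// lerD2r hr.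
Qed.

Lemma lebesgue_bounded_lty (A : set 'rV[R]_n) r : measurable A ->
  (forall x, A x -> `|x| <= r) -> (lebesgue_rV n A < +oo)%E.
Proof.
move=> mA Ar; pose b : 'rV[R]_n := const_mx (r + 1).
apply: (@le_lt_trans _ _ (lebesgue_rV n (obox (- b) b))); last first.
  exact: lebesgue_obox_lty.
apply: le_measure; rewrite ?inE//; first exact: measurable_obox.
move=> x /Ar xr i; rewrite !mxE in_itv/= -ltr_norml.
by rewrite (le_lt_trans (coord_le_norm x i))// (le_lt_trans xr)// ltrDl.
Qed.

Lemma bounded_meas_integrable f : bounded_meas f -> bounded_supp f ->
  (lebesgue_rV n).-integrable setT (EFin \o f).
Proof.
move=> [mf [C hC]] [r hr].
pose A := f @^-1` ~` [set 0].
have mA : measurable A.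
  by rewrite -[A]setTI; apply: mf => //; apply: measurableC.
have -> : EFin \o f = (EFin \o f) \_ A.
  apply/funext => x; rewrite patchE; case: ifPn => //= /negP xA.
  have -> // : f x = 0 by apply: contra_notP xA => fx; rewrite inE.
apply: (proj1 (integrable_mkcond _ mA)); apply: measurable_bounded_integrable => //.
- by apply: (@lebesgue_bounded_lty _ r) => // x /= fx; apply: hr; exact/eqP.
- exact: measurable_funTS.
- exists C; split; first exact: num_real.
  by move=> D CD x _ /=; rewrite (le_trans (hC x))// ltW.
Qed.

Lemma continuous_bounded_meas f : continuous f -> bounded_supp f ->
  bounded_meas f.
Proof.
move=> cf [r hr]; split; first exact: continuous_measurable_rV.
pose b : 'rV[R]_n := const_mx `|r|.
have : compact (cbox (- b) b) := @compact_cbox R n (- b) b.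
have cf' : {within cbox (- b) b, continuous f} by exact: continuous_subspaceT.
move=> /(continuous_compact cf')/compact_bounded[M [_ hM]].
exists (Num.max 0 (M + 1)) => x; have [->|fx] := eqVneq (f x) 0.
  by rewrite normr0 le_max lexx.
rewrite le_max; apply/orP; right; apply: hM; first by rewrite ltrDl.
exists x => // i; rewrite !mxE in_itv/= -ler_norml.
by rewrite (le_trans (coord_le_norm x i))// (le_trans (hr _ fx))// ler_norm.
Qed.

End bounded_measurable.

Section dominated.
Context {R : realType} {n : nat}.
Implicit Types f g : 'rV[R]_n -> R.

Lemma bounded_dominating (C r : R) : exists g : 'rV[R]_n -> R,
  [/\ bounded_meas g, bounded_supp g, (forall x, 0 <= g x) &
      forall x, `|x| <= r -> g x = `|C|].
Proof.
pose A : set 'rV[R]_n := [set x | `|x| <= r].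
have mA : measurable A.
  have mN : measurable_fun setT (fun x : 'rV[R]_n => `|x|).
    by apply: continuous_measurable_rV; exact: norm_continuous.
  rewrite (_ : A = (fun x : 'rV[R]_n => `|x|) @^-1` `]-oo, r]).
    by rewrite -[X in measurable X]setTI; exact: mN.
  by apply/seteqP; split=> x; rewrite /A/= in_itv.
exists (fun x => `|C| * \1_A x); split.
- split; first by apply: measurable_funM => //; exact: measurable_indic.
  exists `|C| => x; rewrite indicE normrM normr_id.
  by case: (x \in A); rewrite ?normr1 ?normr0 ?mulr1 ?mulr0.
- exists r => x; rewrite indicE; case: (boolP (x \in A)); first by rewrite inE.
  by rewrite mulr0 eqxx.
- by move=> x; rewrite mulr_ge0// indicE.
- by move=> x xr; rewrite indicE mem_set//= mulr1.
Qed.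

Lemma cvg_Rintegral_bounded (f_ : nat -> 'rV[R]_n -> R) f (C r : R) :
  (forall k, measurable_fun setT (f_ k)) ->
  (forall k x, `|f_ k x| <= C) -> (forall k x, f_ k x != 0 -> `|x| <= r) ->
  (forall x, f_ k x @[k --> \oo] --> f x) ->
  \int[lebesgue_rV n]_x f_ k x @[k --> \oo] --> \int[lebesgue_rV n]_x f x.
Proof.
move=> mf_ fC fr fcvg.
have mf : measurable_fun setT f.
  by apply: (measurable_fun_cvg mf_) => x _; exact: fcvg.
have [g [bg sg g0 gE]] := bounded_dominating C r.
have ig := bounded_meas_integrable bg sg.
have fg k x : `|f_ k x| <= g x.
  have [f0|f0] := eqVneq (f_ k x) 0; first by rewrite f0 normr0.
  by rewrite gE ?(fr k)// (le_trans (fC _ _))// ler_norm.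
have cvgE : {ae lebesgue_rV n, forall x, setT x ->
    (f_ k x)%:E @[k --> \oo] --> (f x)%:E}.
  by apply: aeW => x _; apply: cvg_EFin; [exact: nearW|exact: fcvg].
have dom : {ae lebesgue_rV n, forall x (k : nat), setT x ->
    (`|(f_ k x)%:E| <= (g x)%:E)%E}.
  by apply: aeW => x k _; rewrite lee_fin.
have mE k : measurable_fun setT (fun x => (f_ k x)%:E).
  exact/measurable_EFinP.
have mfE : measurable_fun setT (EFin \o f) by exact/measurable_EFinP.
have [int_f _ lim] := dominated_convergence measurableT mE mfE cvgE ig dom.
apply: fine_cvg; rewrite fineK//.
exact: (integrable_fin_num measurableT int_f).
Qed.

End dominated.

(** * Bump functions and the fundamental lemma *)

Section flat_one.
Context {R : realType}.

Lemma flat1_ge0 (x : R) : 0 <= flat 1 x.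
Proof. by rewrite /flat; case: ifP => // _; rewrite hornerE mul1r expR_ge0. Qed.

Lemma flat1_le1 (x : R) : flat 1 x <= 1.
Proof.
rewrite /flat; case: ifP => // x0; rewrite hornerE mul1r expR_le1.
by rewrite oppr_le0 invr_ge0 ltW.
Qed.

Lemma flat1_neq0 (x : R) : flat 1 x != 0 -> 0 < x.
Proof. by rewrite /flat; case: ifP => //; rewrite eqxx. Qed.

Lemma flat1_cvg (y : R) : 0 < y -> flat 1 (k.+1%:R * y) @[k --> \oo] --> (1 : R).
Proof.
move=> y0; rewrite [X in X @ _ --> _](_ : _ =
    (fun k => expR (- (k.+1%:R^-1 * y^-1)))); last first.
  by apply/funext => k; rewrite /flat mulr_gt0// hornerE mul1r invfM.
have h : - (k.+1%:R^-1 * y^-1) @[k --> \oo] --> (0 : R).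
  rewrite -[X in _ --> X]oppr0 -[X in - X](mul0r y^-1); apply: cvgN.
  by apply: cvgMl; exact: cvg_harmonic.
rewrite -[X in _ --> X](@expR0 R).
exact: (cvg_comp _ _ h (@continuous_expR R 0)).
Qed.

End flat_one.

Section bump.
Context {R : realType} {n : nat}.
Implicit Types (a b x v : 'rV[R]_n) (k : R).

Lemma is_derive_affine_coord (c d : R) (i j : 'I_n) x :
  is_derive x (delta_mx ord0 i) (fun x : 'rV[R]_n => c * x ord0 j + d)
    (c * (j == i)%:R).
Proof.
apply/is_derive_lineP.
rewrite (_ : (fun h : R => _) =
  (fun h : R => h * (c * (j == i)%:R) + (c * x ord0 j + d))); last first.
  by apply/funext => h; rewrite !mxE/=; ring.
by apply: is_derive_eq; rewrite /GRing.scale/=; ring.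
Qed.

Lemma of_class_C_flat m (p : {poly R}) (c d : R) (j : 'I_n) :
  of_class_C m (fun x : 'rV[R]_n => flat p (c * x ord0 j + d)).
Proof.
have D p' i x : is_derive x (delta_mx ord0 i)
    (fun x : 'rV[R]_n => flat p' (c * x ord0 j + d))
    (flat ('X^2 * (p' - p'^`())) (c * x ord0 j + d) * (c * (j == i)%:R)).
  apply: (@is_derive_comp_real _ _ (flat p') (fun x => c * x ord0 j + d)).
    exact: is_derive_flat.
  exact: is_derive_affine_coord.
have cD p' : continuous (fun x : 'rV[R]_n => flat p' (c * x ord0 j + d)).
  have cf : continuous (flat p' : R -> R).
    move=> y; apply/differentiable_continuous/derivable1_diffP.
    by have [] := is_derive_flat p' y.
  move=> x; apply: (@continuous_comp _ _ _ (fun x => c * x ord0 j + d)); last exact: cf.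
  apply: (@continuousD _ _ _ (fun x : 'rV[R]_n => c * x ord0 j) (cst d)).
    apply: (@continuousM _ _ (cst c) (fun x : 'rV[R]_n => x ord0 j)).
      exact: cst_continuous.
    exact: coord_continuous.
  exact: cst_continuous.
elim: m p => [|m IHm] p; first exact: cD.
split; first exact: cD.
move=> i; split=> [x|]; first by have [] := D p i x.
rewrite (_ : partial i _ = fun x =>
  flat ('X^2 * (p - p^`())) (c * x ord0 j + d) * (c * (j == i)%:R)).
  by apply: of_class_CM => //; exact: of_class_C_cst.
by apply/funext => x; have [_ <-] := D p i x.
Qed.

(** Smooth, and nonzero only inside the box. Increasing [k] sharpens the edges, and the limit is the
    indicator of the open box. *)
Definition bump a b k x : R := \prod_(j < n)
  (flat 1 (k * (x ord0 j - a ord0 j)) * flat 1 (k * (b ord0 j - x ord0 j))).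

Lemma bump_ge0 a b k x : 0 <= bump a b k x.
Proof. by apply: prodr_ge0 => j _; rewrite mulr_ge0// flat1_ge0. Qed.

Lemma bump_le1 a b k x : bump a b k x <= 1.
Proof.
apply: prodr_ile1 => j; rewrite mulr_ge0 ?flat1_ge0//=.
by rewrite mulr_ile1// ?flat1_ge0 ?flat1_le1.
Qed.

Lemma bump_neq0 a b k x : 0 < k -> bump a b k x != 0 -> obox a b x.
Proof.
move=> k0 /prodf_neq0 h j; have := h j isT; rewrite mulf_eq0 negb_or.
move=> /andP[/flat1_neq0 + /flat1_neq0].
by rewrite !pmulr_rgt0// !subr_gt0 in_itv/= => -> ->.
Qed.

Lemma bump_shift a b k x v : bump a b k (x + v) = bump (a - v) (b - v) k x.
Proof.
apply: eq_bigr => j _; rewrite !mxE; congr (flat 1 (_ * _) * flat 1 (_ * _)).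
  by ring.
by ring.
Qed.

Lemma of_class_C_bump m a b k : of_class_C m (bump a b k).
Proof.
apply: of_class_C_prod => j; apply: of_class_CM.
- under eq_fun do rewrite mulrBr; exact: of_class_C_flat.
- under eq_fun do rewrite mulrBr addrC -mulNr; exact: of_class_C_flat.
Qed.

Lemma closure_bump a b k : 0 < k ->
  closure [set x | bump a b k x != 0] `<=` cbox a b.
Proof.
move=> k0; rewrite (closure_id (cbox a b)).1; last exact: closed_cbox.
by apply: closureS => x /= /(bump_neq0 k0) /sub_obox_cbox.
Qed.

Lemma test_function_bump (Omega : set 'rV[R]_n) a b k : 0 < k ->
  cbox a b `<=` Omega -> test_function Omega (bump a b k).
Proof.
move=> k0 abO; split; first by move=> m; exact: of_class_C_bump.
- apply: (@subclosed_compact _ _ (cbox a b)); first exact: closed_closure.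
    exact: compact_cbox.
  exact: closure_bump.
- by apply: subset_trans abO; exact: closure_bump.
Qed.

Lemma bump_cvg a b x :
  bump a b k.+1%:R x @[k --> \oo] --> (\1_(obox a b) x : R).
Proof.
rewrite indicE; have [xab|xab] := boolP (x \in obox a b).
  rewrite inE in xab.
  have h : forall r : seq 'I_n, \prod_(j <- r) (flat 1 (k.+1%:R * (x ord0 j - a ord0 j)) *
      flat 1 (k.+1%:R * (b ord0 j - x ord0 j))) @[k --> \oo] --> (1 : R).
    elim=> [|j r IHr]; first by under eq_fun do rewrite big_nil; exact: cvg_cst.
    under eq_fun do rewrite big_cons.
    have := xab j; rewrite in_itv/= -[a ord0 j < _]subr_gt0 -[_ < b ord0 j]subr_gt0.
    move=> /andP[/flat1_cvg ha /flat1_cvg hb].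
    have H := cvgM (cvgM ha hb) IHr; rewrite !mulr1 in H; exact: H.
  exact: h.
rewrite [X in X @ _ --> _](_ : _ = fun=> 0); first exact: cvg_cst.
apply/funext => k; apply/eqP; apply: contraNT xab => /bump_neq0.
by rewrite inE; apply.
Qed.

End bump.

Section fundamental_lemma.
Context {R : realType} {n : nat}.
Implicit Types (a b x : 'rV[R]_n) (f : 'rV[R]_n -> R).
Local Open Scope ereal_scope.

(** Dynkin's argument: open boxes are stable under intersection and generate the Borel sets, and the
    vanishing of the integral passes to complements, thanks to the zero total integral, and to
    countable disjoint unions. *)
Lemma integral_obox_eq0 f :
  (lebesgue_rV n).-integrable setT (EFin \o f) ->
  \int[lebesgue_rV n]_x (f x)%:E = 0 ->
  (forall a b, \int[lebesgue_rV n]_(x in obox a b) (f x)%:E = 0) ->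
  forall E, measurable E -> \int[lebesgue_rV n]_(x in E) (f x)%:E = 0.
Proof.
move=> intf intf0 intf_box E; rewrite measurable_rV_obox.
have intS S : measurable S -> (lebesgue_rV n).-integrable S (EFin \o f).
  by move=> mS; apply: (integrableS measurableT).
apply: (@dynkin_induction _ _ [set B | exists a b, B = obox a b]
  (fun E => \int[lebesgue_rV n]_(x in E) (f x)%:E = 0)) => //.
- exact: measurable_rV_obox.
- by move=> _ _ [a [b ->]] [c [d ->]]; rewrite oboxI; eexists; eexists.
- by move=> _ [a [b ->]].
- move=> S mS S0; have := @integral_setU _ _ _ (lebesgue_rV n) S (~` S)
    (EFin \o f) mS (measurableC mS).
  rewrite setUv => /(_ (measurable_int _ intf)).
  have dS : [disjoint S & ~` S] by apply/disj_setPCl.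
  by move=> /(_ dS) /=; rewrite intf0 S0 add0e => <-.
- move=> F mF tF F0; rewrite (integral_bigcup tF mF).
    by rewrite eseries0.
  by apply: intS; exact: bigcupT_measurable.
Qed.

(** Fundamental lemma of the calculus of variations, tested on bumps only. Dominated convergence
    passes from bumps to boxes, Dynkin's argument from the boxes inside one box to its Borel
    subsets, and [V] is a countable union of such boxes. *)
Lemma bump_ae0 f (V : set 'rV[R]_n) : bounded_meas f -> open V ->
  (forall a b (k : R), (0 < k)%R -> cbox a b `<=` V ->
    (\int[lebesgue_rV n]_x (bump a b k x * f x))%R = 0%R) ->
  {ae lebesgue_rV n, forall x, V x -> f x = 0%R}.
Proof.
move=> bf oV fV.
have [mf [C fC]] := bf.
have box0 a b : cbox a b `<=` V ->
    (\int[lebesgue_rV n]_x (\1_(obox a b) x * f x))%R = 0%R.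
  move=> abV.
  have bb x : obox a b x -> (`|x| <= `|a| + `|b|)%R.
    by move=> /sub_obox_cbox/cbox_norm_le.
  have : (\int[lebesgue_rV n]_x (bump a b k.+1%:R x * f x))%R @[k --> \oo] -->
      (\int[lebesgue_rV n]_x (\1_(obox a b) x * f x))%R.
    apply: (@cvg_Rintegral_bounded _ _ _ _ C (`|a| + `|b|)) => [k|k x|k x|x].
    - apply: measurable_funM => //; apply: continuous_measurable_rV.
      exact: (of_class_C_cont (of_class_C_bump 0 _ _ _)).
    - rewrite normrM ger0_norm ?bump_ge0// -[leRHS]mul1r.
      by rewrite ler_pM ?bump_ge0 ?bump_le1.
    - rewrite mulf_eq0 negb_or => /andP[/bump_neq0 + _]; move=> /(_ _)/bb; exact.
    - by apply: cvgM; [exact: bump_cvg|exact: cvg_cst].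
  under eq_fun do rewrite fV//.
  by move=> /cvg_lim <- //; rewrite lim_cst.
have ae_box a b : cbox a b `<=` V ->
    {ae lebesgue_rV n, forall x, obox a b x -> f x = 0%R}.
  move=> abV; pose g x : R := (\1_(obox a b) x * f x)%R.
  have bg : bounded_meas g.
    rewrite /g; apply: bounded_measM => //; split.
      by apply: measurable_indic; exact: measurable_obox.
    exists 1%R => x; rewrite indicE.
    by case: (_ \in _); rewrite ?normr1 ?normr0.
  have ig : (lebesgue_rV n).-integrable setT (EFin \o g).
    apply: bounded_meas_integrable => //; apply: bounded_suppMl.
    exists (`|a| + `|b|)%R => x; rewrite indicE; have [|] := boolP (x \in obox a b).
      by rewrite inE => /sub_obox_cbox/cbox_norm_le.
    by rewrite eqxx.
  have Rint0 (h : 'rV[R]_n -> R) : (lebesgue_rV n).-integrable setT (EFin \o h) ->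
      (\int[lebesgue_rV n]_x h x = 0)%R -> \int[lebesgue_rV n]_x (h x)%:E = 0.
    move=> ih; rewrite /Rintegral => h0.
    by rewrite -[LHS]fineK ?h0//; exact: (integrable_fin_num measurableT ih).
  have g0 E : measurable E -> \int[lebesgue_rV n]_(x in E) (g x)%:E = 0.
    apply: integral_obox_eq0 => //; first by apply: Rint0 => //; exact: box0.
    move=> c d; rewrite integral_mkcond.
    (* [u] and [v] are the corners of the intersection of the two boxes, so [box0] applies to the
       integral over it. *)
    pose u := (\row_i Num.max (a ord0 i) (c ord0 i))%R : 'rV[R]_n.
    pose v := (\row_i Num.min (b ord0 i) (d ord0 i))%R : 'rV[R]_n.
    have gE : (EFin \o g) \_ (obox c d) =
        EFin \o (fun x => \1_(obox u v) x * f x)%R.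
      apply/funext => x; rewrite patchE /= -oboxI indicE in_setI /g indicE.
      by case: (x \in obox c d); case: (x \in obox a b); rewrite ?mul0r.
    rewrite gE; apply: Rint0.
      rewrite -gE; apply: (proj1 (integrable_mkcond _ (measurable_obox c d))).
      by apply: (integrableS measurableT _ _ ig) => //; exact: measurable_obox.
    apply: box0 => x xuv; apply: abV => i; have := xuv i.
    by rewrite !mxE !in_itv/= ge_max le_min => /andP[/andP[-> _] /andP[-> _]].
  have : ae_eq (lebesgue_rV n) setT (EFin \o g) (cst 0).
    apply: integral_ae_eq => // E _ mE; rewrite g0//.
    by rewrite integral0.
  apply: filterS => x /(_ Logic.I) /= [] + abx.
  by rewrite /g indicE mem_set//= mul1r.
(* Rational cubes are enumerated by [unpickle], so that countably many null sets are collected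
   through a quantifier over [nat]. *)
pose Pr m x := match @unpickle ('rV[rat]_n * nat)%type m with
  | Some p => rat_cbox p `<=` V -> rat_obox p x -> f x = 0%R
  | None => True end.
have : {ae lebesgue_rV n, forall x m, Pr m x}.
  apply/ae_foralln => m; rewrite /Pr; case: unpickle => [p|]; last exact: aeW.
  have [pV|pV] := pselect (rat_cbox p `<=` V); last by apply: aeW => x /pV.
  by have := ae_box _ _ pV; apply: filterS => x h _.
apply: filterS => x h; rewrite [X in X x](open_bigcup_obox oV) => -[p pV px].
by have := h (pickle p); rewrite /Pr pickleK; exact.
Qed.

End fundamental_lemma.

(** * Integration by parts for a weakly differentiable weight *)

Section translation_derivative.
Context {R : realType} {n : nat}.
Variable i : 'I_n.
Local Notation e := (delta_mx ord0 i : 'rV[R]_n).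
Implicit Types (u theta : 'rV[R]_n -> R) (t : R).

(** Only the direction [e] enters: in a divergence, the [i]-th component is differentiated along its
    own axis. *)
Definition C1_along u :=
  [/\ continuous u, forall x, derivable u x e & continuous (partial i u)].

Lemma partial_eq0 u x : (\forall y \near x, u y = 0) -> partial i u x = 0.
Proof.
move=> u0; rewrite /partial (@near_eq_derive _ _ _ u (cst 0)) ?derive_cst//.
Qed.

Lemma bounded_supp_partial u : bounded_supp u -> bounded_supp (partial i u).
Proof.
move=> [r hr]; exists r => x; apply: contra_neqT; rewrite -ltNge => rx.
apply: partial_eq0; near=> y.
apply/eqP; apply: contraT => /hr; rewrite leNgt => /negP[].
near: y; exact: (@norm_continuous _ _ x _ (lt_nbhsr rx)).
Unshelve. all: by end_near. Qed.

Lemma C1_along_line u x t : C1_along u ->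
  is_derive t (1 : R) (fun h => u (x + h *: e)) (partial i u (x + t *: e)).
Proof.
move=> [_ du _]; apply: is_derive_along_line.
by apply: DeriveDef => //; exact: du.
Qed.

Lemma C1_along_lip u : C1_along u -> bounded_supp u ->
  exists2 C, 0 <= C & forall x t, `|u (x + t *: e) - u x| <= C * `|t|.
Proof.
move=> C1u su; have [_ _ cu'] := C1u.
have [_ [C hC]] := continuous_bounded_meas cu' (bounded_supp_partial su).
have C0 : 0 <= C by rewrite (le_trans _ (hC 0)).
exists C => // x t.
have lem a b : a < b -> `|u (x + b *: e) - u (x + a *: e)| <= C * (b - a).
  move=> ab; have [c _ ->] := @MVT _ (fun h => u (x + h *: e))
    (fun h => partial i u (x + h *: e)) a b ab
    (fun h _ => C1_along_line x h C1u)
    (continuous_subspaceT (fun h => differentiable_continuous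
      ((derivable1_diffP _ _).1 (@ex_derive _ _ _ _ _ _ _ (C1_along_line x h C1u))))).
  by rewrite normrM ler_pM// gtr0_norm// subr_gt0.
have [t0|t0|->] := ltgtP t 0.
- have := lem _ _ t0; rewrite scale0r addr0 sub0r distrC => h.
  by rewrite (ltr0_norm t0); exact: h.
- have := lem _ _ t0; rewrite scale0r addr0 subr0 => h.
  by rewrite (gtr0_norm t0); exact: h.
- by rewrite scale0r addr0 subrr !normr0 mulr0.
Qed.

Lemma norm_delta : `|e| <= 1.
Proof.
apply: norm_le_coord => // j; rewrite mxE eqxx/=.
by case: (_ == _); rewrite ?normr1 ?normr0.
Qed.

(** The derivative falls on [u], so [theta] may be any bounded Borel function. Since [u] has bounded
    support, one integrable majorant serves all translations [h] with [|h - t| < 1]. *)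
Lemma is_derive_translation u theta t :
  C1_along u -> bounded_supp u -> bounded_meas theta ->
  is_derive t (1 : R)
    (fun h => \int[lebesgue_rV n]_x (u (x + h *: e) * theta x))
    (\int[lebesgue_rV n]_x (partial i u (x + t *: e) * theta x)).
Proof.
move=> C1u su bt; have [cu du cu'] := C1u.
have bu := continuous_bounded_meas cu su.
have [_ [C hC]] := continuous_bounded_meas cu' (bounded_supp_partial su).
have [_ [D hD]] := bt.
have [r hr] := bounded_supp_partial su.
pose f h x := u (x + h *: e) * theta x.
have df h x : is_derive h (1 : R) (f ^~ x) (partial i u (x + h *: e) * theta x).
  have := C1_along_line x h C1u => d1.
  rewrite [X in is_derive _ _ _ X](_ : _ =
    u (x + h *: e) *: (0 : R) + theta x *: partial i u (x + h *: e)); last first.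
    by rewrite scaler0 add0r mulrC.
  exact: is_deriveM.
have [G [bG sG G0 GE]] := @bounded_dominating R n (C * D) (r + (`|t| + 1)).
have Gub h x : `]t - 1, t + 1[%classic h -> setT x ->
    `|partial1of2 f h x| <= G x.
  move=> /=; rewrite in_itv/= => /andP[ht1 ht2] _.
  rewrite partial1of2E (@derive_val _ _ _ _ _ _ _ (df h x)).
  have [->|p0] := eqVneq (partial i u (x + h *: e)) 0.
    by rewrite mul0r normr0.
  rewrite GE; first by rewrite (le_trans _ (ler_norm _))// normrM ler_pM.
  rewrite -[x](addrK (h *: e)) (le_trans (ler_normB _ _))// lerD ?hr//.
  rewrite normrZ (@le_trans _ _ `|h|) ?ler_piMr ?norm_delta//.
  have := lexx `|t|; rewrite !ler_norml => /andP[? ?]; apply/andP; split; lra.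
have intf h : `]t - 1, t + 1[%classic h ->
    (lebesgue_rV n).-integrable setT (EFin \o f h).
  move=> _; apply: bounded_meas_integrable.
    by apply: bounded_measM => //; exact: bounded_meas_shift.
  by apply: bounded_suppMl; exact: bounded_supp_shift.
have tI : `]t - 1, t + 1[%classic t.
  by rewrite /= in_itv/= ltrBlDr !ltrDl ltr01.
have der h x : `]t - 1, t + 1[%classic h -> setT x -> derivable (f ^~ x) h 1.
  by move=> _ _; have [] := df h x.
have iG := bounded_meas_integrable bG sG.
apply: DeriveDef.
  exact: (derivable_under_integral measurableT tI intf der G0 iG Gub).
rewrite -derive1E (differentiation_under_integral measurableT tI intf der G0 iG Gub).
apply: eq_Rintegral => x _.
by rewrite partial1of2E (@derive_val _ _ _ _ _ _ _ (df t x)).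
Qed.

End translation_derivative.

(** * Integrals along segments parallel to an axis *)

Section translation_average.
Context {R : realType} {n : nat}.
Variable i : 'I_n.
Local Notation e := (delta_mx ord0 i : 'rV[R]_n).
Local Notation leb := (@lebesgue_measure R).
Implicit Types (g zeta : 'rV[R]_n -> R) (t : R).

(** Not divided by [t]: when [g] is the derivative of [phi] along [e], this is the increment
    [phi x - phi (x - t *: e)]. *)
Definition avg t g (x : 'rV[R]_n) : R := \int[leb]_(s in `[0, t]) g (x - s *: e).

Lemma norm_cbox (x : 'rV[R]_n) (r : R) : `|x| <= r ->
  cbox (const_mx (- r)) (const_mx r) x.
Proof.
move=> xr j; rewrite !mxE in_itv/= -ler_norml.
exact: le_trans (coord_le_norm x j) xr.
Qed.

Lemma lebesgue_cbox_lty (a b : 'rV[R]_n) : (lebesgue_rV n (cbox a b) < +oo)%E.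
Proof.
apply: lebesgue_bounded_lty; first exact: measurable_cbox.
by move=> x; exact: cbox_norm_le.
Qed.

Lemma lebesgue_itv_lty t : (leb (`[0%R, t]%classic : set R) < +oo)%E.
Proof. by rewrite lebesgue_measure_itv/=; case: ifPn => _; rewrite -?EFinB ltry. Qed.

Lemma fine_lebesgue_itv t : 0 <= t -> fine (leb `[0, t]%classic) = t.
Proof.
move=> t0; rewrite lebesgue_measure_itv/= lte_fin.
case: ltP => [_|t0']; first by rewrite /= oppr0 addr0.
by apply/eqP; rewrite eq_le t0 t0'.
Qed.

Lemma measurable_fun_translate g : measurable_fun setT g ->
  measurable_fun setT (fun p : R * 'rV[R]_n => g (p.2 - p.1 *: e)).
Proof.
move=> mg; apply: (measurableT_comp mg); apply: measurable_fun_rV => j.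
rewrite (_ : (fun _ => _) = (fun p : R * 'rV[R]_n => p.2 ord0 j - p.1 * e ord0 j)).
  apply: measurable_funB.
    by apply: (@measurableT_comp _ _ _ _ _ _ (fun x : 'rV[R]_n => x ord0 j));
      [exact: measurable_coord_rV|exact: measurable_snd].
  by apply: measurable_funM => //; exact: measurable_fst.
by apply/funext => p; rewrite !mxE.
Qed.

Lemma integrable_translate_itv g t x : bounded_meas g ->
  leb.-integrable `[0, t] (EFin \o (fun s => g (x - s *: e))).
Proof.
move=> [mg [C hC]]; apply: measurable_bounded_integrable => //.
- exact: lebesgue_itv_lty.
- apply: measurable_funTS.
  apply: (@measurableT_comp _ _ _ _ _ _ (fun p : R * 'rV[R]_n => g (p.2 - p.1 *: e))
    _ (fun s => (s, x))); first exact: measurable_fun_translate.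
  exact: measurable_pair2.
- exists C; split; first exact: num_real.
  by move=> D CD s _ /=; rewrite (le_trans (hC _))// ltW.
Qed.

Lemma avg_bound g C t x : 0 <= t -> bounded_meas g -> (forall y, `|g y| <= C) ->
  `|avg t g x| <= C * t.
Proof.
move=> t0 bg hC; have ig := integrable_translate_itv t x bg.
rewrite (le_trans (le_normr_Rintegral _ ig))//.
have -> : C * t = \int[leb]_(s in `[0, t]) C.
  by rewrite Rintegral_cst// fine_lebesgue_itv.
apply: le_Rintegral => //.
- exact: integrable_norm.
- by apply: continuous_compact_integrable; [exact: segment_compact|
    apply: continuous_subspaceT; exact: cst_continuous].
Qed.

Section fubini.
Variables (zeta g : 'rV[R]_n -> R) (t : R).
Hypotheses (bz : bounded_meas zeta) (bg : bounded_meas g)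
  (sg : bounded_supp g).

Let f (p : R * 'rV[R]_n) : R := \1_`[0, t] p.1 * (zeta p.2 * g (p.2 - p.1 *: e)).

Let int_f : (leb \x lebesgue_rV n)%E.-integrable setT (EFin \o f).
Proof.
have [mz [C hC]] := bz; have [mg [D hD]] := bg; have [r hr] := sg.
have mf : measurable_fun setT f.
  apply: measurable_funM.
    by apply: (measurableT_comp (measurable_indic _)) => //; exact: measurable_fst.
  apply: measurable_funM; last exact: measurable_fun_translate.
  by apply: measurableT_comp => //; exact: measurable_snd.
pose b : 'rV[R]_n := const_mx (r + t).
pose It := `[0, t]%classic : set R; pose cb := cbox (const_mx (- (r + t))) b.
pose S := It `*` cb.
have mIt : measurable It by exact: measurable_itv.
have mcb : measurable cb by exact: measurable_cbox.
have mS : measurable S by exact: measurableX.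
have -> : EFin \o f = (EFin \o f) \_ S.
  apply/funext => p; rewrite patchE; case: ifPn => //= /negP pS.
  have -> // : f p = 0.
  apply: contra_notP pS => /eqP; rewrite /f !mulf_eq0 !negb_or indicE.
  move=> /and3P[p1 _ /hr p2].
  have {}p1 : p.1 \in `[0, t].
    by move: p1; case: (boolP (p.1 \in _)); rewrite ?inE// eqxx.
  rewrite inE; split=> //=; apply: norm_cbox.
  rewrite -[p.2](subrK (p.1 *: e)) (le_trans (ler_normD _ _))// lerD//.
  move: p1; rewrite in_itv/= => /andP[p10 p1t].
  rewrite normrZ (ger0_norm p10) (le_trans _ p1t)// ler_piMr//.
  exact: norm_delta.
apply: (proj1 (@integrable_mkcond _ _ _ (leb \x lebesgue_rV n)%E S
  (EFin \o f) mS)).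
apply: measurable_bounded_integrable => //.
- have ES : (leb \x lebesgue_rV n)%E S = (leb It * lebesgue_rV n cb)%E.
    exact: product_measure1E.
  apply: (@le_lt_trans _ _ ((leb \x lebesgue_rV n)%E S)); first exact: lexx.
  rewrite ES; apply: lte_mul_pinfty => //; last exact: lebesgue_cbox_lty.
  by rewrite ge0_fin_numE//; exact: lebesgue_itv_lty.
- exact: measurable_funTS.
- exists (C * D); split; first exact: num_real.
  move=> M CM p _ /=; rewrite (le_trans _ (ltW CM))//.
  rewrite /f indicE; case: (_ \in _); rewrite ?mul0r ?normr0 ?mul1r.
    by rewrite normrM ler_pM.
  by apply: mulr_ge0; [exact: le_trans (hC 0)|exact: le_trans (hD 0)].
Qed.

Let int_x s : (lebesgue_rV n).-integrable setT
  (EFin \o (fun x => zeta x * g (x - s *: e))).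
Proof.
apply: bounded_meas_integrable.
  by apply: bounded_measM => //; exact: bounded_meas_shift.
by apply: bounded_suppMr; exact: bounded_supp_shift.
Qed.

Let slice_s x : (\int[leb]_s (f (s, x))%:E = (zeta x * avg t g x)%:E)%E.
Proof.
rewrite /avg -RintegralZl//; last exact: integrable_translate_itv.
rewrite /Rintegral fineK; last first.
  apply: (integrable_fin_num _) => //.
  apply: (integrableZl _ (zeta x) (integrable_translate_itv t x bg)).
  exact: measurable_itv.
rewrite [RHS]integral_mkcond; apply: eq_integral => s _.
rewrite patchE /f /= indicE; case: ifPn => _; first by rewrite mul1r.
by rewrite mul0r.
Qed.

Let c s := \int[lebesgue_rV n]_x (zeta x * g (x - s *: e)).

Let slice_x s : (\int[lebesgue_rV n]_x (f (s, x))%:E = ((c \_ `[0, t]) s)%:E)%E.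
Proof.
rewrite patchE /f /= indicE; case: ifPn => _.
  rewrite /c /Rintegral fineK; last exact: (integrable_fin_num measurableT (int_x s)).
  by apply: eq_integral => x _; rewrite mul1r.
by apply: integral0_eq => x _; rewrite mul0r.
Qed.

(** Once the integral in [x] is the inner one, a change of variables can move the translation from
    [g] onto [zeta]. *)
Lemma translate_Fubini :
  \int[lebesgue_rV n]_x (zeta x * avg t g x) =
  \int[leb]_(s in `[0, t]) \int[lebesgue_rV n]_x (zeta x * g (x - s *: e)).
Proof.
rewrite [RHS]Rintegral_mkcond; congr fine.
under eq_integral do rewrite -slice_s.
under [RHS]eq_integral do rewrite -slice_x.
by rewrite (Fubini int_f).
Qed.

Lemma integrable_translate_corr : leb.-integrable `[0, t]
  (EFin \o (fun s => \int[lebesgue_rV n]_x (zeta x * g (x - s *: e)))).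
Proof.
apply: (proj2 (integrable_mkcond _ _)) => //.
have := integrable_fubini_F int_f; apply: eq_integrable => // s _.
by rewrite /fubini_F /= slice_x !patchE; case: ifP.
Qed.

Lemma measurable_mul_avg : measurable_fun setT (fun x => zeta x * avg t g x).
Proof.
have := measurable_fubini_G int_f.
rewrite (_ : fubini_G _ _ = EFin \o (fun x => zeta x * avg t g x)).
  by move/measurable_EFinP.
by apply/funext => x; rewrite /fubini_G /= slice_s.
Qed.

End fubini.

Lemma bounded_meas_avg g t : 0 <= t -> bounded_meas g -> bounded_supp g ->
  bounded_meas (avg t g).
Proof.
move=> t0 bg sg; split.
  have := measurable_mul_avg t (bounded_meas_cst 1) bg sg.
  by under eq_fun do rewrite mul1r.
by have [_ [C hC]] := bg; exists (C * t) => x; exact: avg_bound.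
Qed.

End translation_average.

Section tools.
Context {R : realType}.

(** From below [exp(-d) >= 1 - d]; from above [exp(-d) <= 1/(1 + d)]. The latter is at most
    [1 - d + 2 d^2] because [(1 + d)(1 - d + 2 d^2) - 1 = d^2 (1 + 2 d)], which is nonnegative
    exactly when [d = 0] or [d >= -1/2]: hence the threshold. *)
Lemma expR_quadratic (d : R) : `|d| <= 1 / 2 -> `|expR (- d) - 1 + d| <= 2 * d ^+ 2.
Proof.
rewrite ler_norml => /andP[d1 d2]; have d0 : 0 < 1 + d by lra.
have h1 := expR_ge1Dx (- d); have h2 := expR_ge1Dx d.
have h3 : expR (- d) <= (1 + d)^-1.
  by rewrite expRN lef_pV2// posrE ?expR_gt0.
have h4 : (1 + d)^-1 <= 1 - d + 2 * d ^+ 2.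
  rewrite -[leLHS]mul1r ler_pdivrMr//.
  rewrite -subr_ge0 (_ : _ - _ = d ^+ 2 * (1 + 2 * d)); last by ring.
  by rewrite mulr_ge0 ?sqr_ge0//; lra.
by rewrite ler_norml; have := sqr_ge0 d => h5; apply/andP; split; lra.
Qed.

Lemma integrableB_real d (T : measurableType d) (mu : {measure set T -> \bar R})
    (D : set T) (f g : T -> R) : measurable D ->
  mu.-integrable D (EFin \o f) -> mu.-integrable D (EFin \o g) ->
  mu.-integrable D (EFin \o (fun x => f x - g x)).
Proof.
move=> mD intf intg; have := integrableB mD intf intg.
by apply: eq_integrable => // x _; rewrite /= EFinB.
Qed.

Lemma ae_normr_Rintegral_le d (T : measurableType d)
    (mu : {measure set T -> \bar R}) (f h : T -> R) :
  mu.-integrable setT (EFin \o f) -> mu.-integrable setT (EFin \o h) ->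
  (forall x, 0 <= h x) -> {ae mu, forall x, `|f x| <= h x} ->
  `|\int[mu]_x f x| <= \int[mu]_x h x.
Proof.
move=> intf inth h0 fh.
have mf := measurable_int _ intf; have mh := measurable_int _ inth.
rewrite -lee_fin EFin_normr_Rintegral// (le_trans (le_abse_integral _ _ _))//.
rewrite /Rintegral fineK; last exact: (integrable_fin_num measurableT inth).
apply: ae_ge0_le_integral => //.
- exact: measurableT_comp.
- by move=> x _ /=; rewrite lee_fin.
- by move: fh; apply: filterS => x fh _ /=; rewrite lee_fin.
Qed.

(** Since the derivative is known to exist, its value can be read off on the right of 0, the only
    side on which the expansion of [exp(-phi)] is available. *)
Lemma derive_eq_of_quadratic (F : R -> R) (D c C r : R) : 0 < r ->
  is_derive (0 : R) (1 : R) F D ->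
  (forall t, 0 < t -> t <= r -> `|F t - F 0 - t * c| <= C * t ^+ 2) -> D = c.
Proof.
move=> r0 [dF <-] hF; apply/eqP; rewrite -subr_eq0 -normr_le0; apply/ler_addgt0Pl => eps eps0.
rewrite addr0; have C1 : 0 < `|C| + 1 by rewrite ltr_wpDl.
have /cvgrPdist_lt/(_ (eps / 2)) := dF; rewrite divr_gt0// => /(_ isT).
rewrite /derive; set L := lim _ => cvgL.
have : \forall t \near (0:R)^'+, `|L - t^-1 *: (F (t *: (1:R) + 0) - F 0)| < eps / 2.
  move: cvgL; rewrite !near_withinE; apply: filterS => t Pt t0.
  by apply: Pt; rewrite gt_eqF.
move=> near1.
near (0:R)^'+ => t.
have t0 : 0 < t by near: t; exact: nbhs_right_gt.
have tr : t <= r by near: t; exact: nbhs_right_le.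
have teps : t <= eps / (2 * (`|C| + 1)).
  by near: t; apply: nbhs_right_le; rewrite divr_gt0// mulr_gt0.
have h1 : `|L - t^-1 *: (F (t *: (1:R) + 0) - F 0)| < eps / 2 by near: t; exact: near1.
rewrite addr0 [_%:A]mulr1 in h1.
have h2 := hF t t0 tr.
have h3 : `|t^-1 *: (F t - F 0) - c| <= eps / 2.
  rewrite (_ : _ - c = t^-1 * (F t - F 0 - t * c)); last first.
    by rewrite -[t^-1 *: _]/(t^-1 * _); field; rewrite gt_eqF.
  rewrite normrM gtr0_norm ?invr_gt0// ler_pdivrMl// (le_trans h2)//.
  rewrite expr2 mulrCA ler_pM2l// (@le_trans _ _ ((`|C| + 1) * t))//.
    by rewrite ler_pM2r// (le_trans (ler_norm C))// lerDl.
  rewrite -ler_pdivlMl// (le_trans teps)// le_eqVlt; apply/orP; left; apply/eqP.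
  by field; rewrite gt_eqF.
rewrite (_ : L - c = (L - t^-1 *: (F t - F 0)) + (t^-1 *: (F t - F 0) - c)); last by ring.
by rewrite (le_trans (ler_normD _ _))// [leRHS](splitr eps) lerD// ltW.
Unshelve. all: by end_near. Qed.

End tools.

(** * From the weak gradient to difference quotients *)

Section weak_gradient_translation.
Context {R : realType} {n : nat}.
Variable i : 'I_n.
Local Notation e := (delta_mx ord0 i : 'rV[R]_n).
Local Notation lam := (lebesgue_rV n).
Local Notation leb := (@lebesgue_measure R).
Implicit Types t : R.

Lemma bump_C1_along (a b : 'rV[R]_n) k : C1_along i (bump a b k).
Proof.
have [c /(_ i)[d c']] := of_class_C_bump 1 a b k; split=> //.
Qed.

Lemma bump_bounded_supp (a b : 'rV[R]_n) k : 0 < k -> bounded_supp (bump a b k).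
Proof.
move=> k0; exists (`|a| + `|b|) => x /(bump_neq0 k0)/sub_obox_cbox.
exact: cbox_norm_le.
Qed.

(** Used to obtain regularity in [s] from [u] when [g] is merely bounded. *)
Lemma Rintegral_translate_corr (u g : 'rV[R]_n -> R) (s : R) :
  measurable_fun setT u -> measurable_fun setT g ->
  \int[lam]_x (u x * g (x - s *: e)) = \int[lam]_x (u (x + s *: e) * g x).
Proof.
move=> mu mg; rewrite -[RHS](Rintegral_shift (- (s *: e))).
  by apply: eq_Rintegral => x _; rewrite subrK.
by apply: measurable_funM => //; apply: (measurableT_comp mu); exact: measurable_shift.
Qed.

Variables (phi g : 'rV[R]_n -> R) (V : set 'rV[R]_n) (delta : R).
Hypotheses (bphi : bounded_meas phi) (sphi : bounded_supp phi).
Hypotheses (bg : bounded_meas g) (sg : bounded_supp g).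
Hypotheses (oV : open V) (delta0 : 0 < delta).
(** The weak gradient tested on a translated bump. The bound [delta] on the translation keeps that
    bump supported in the original domain, although the integrals here run over the whole space. *)
Hypothesis weak : forall (a b : 'rV[R]_n) k t, 0 < k -> 0 <= t <= delta ->
  cbox a b `<=` V ->
  \int[lam]_x (partial i (bump a b k) (x + t *: e) * phi x) =
  - \int[lam]_x (bump a b k (x + t *: e) * g x).

(** With the translation moved onto a bump [eta], the function [Af h = int eta(x + h e) phi(x) dx]
    has derivative [- c h] by [weak]. The fundamental theorem of calculus in [h], then Fubini, show
    that the left-hand side is orthogonal to every bump in [V]. The null set depends on [t], which
    is harmless because [t] is fixed before each integration in [x]. *)
Lemma weak_translation t : 0 < t <= delta ->
  {ae lam, forall x, V x -> phi (x - t *: e) - phi x + avg i t g x = 0}.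
Proof.
move=> /andP[t0 td].
have bav := bounded_meas_avg i (ltW t0) bg sg.
have bsh : bounded_meas (fun x => phi (x - t *: e)) by exact: bounded_meas_shift.
apply: (@bump_ae0 _ _ (fun x => phi (x - t *: e) - phi x + avg i t g x)) => //.
  by apply: bounded_measD => //; exact: bounded_measB.
move=> a b k k0 abV; set eta := bump a b k.
have C1e := bump_C1_along a b k; have se := bump_bounded_supp a b k0.
have [ce _ _] := C1e; have be := continuous_bounded_meas ce se.
pose Af h := \int[lam]_x (eta (x + h *: e) * phi x).
pose c h := \int[lam]_x (eta (x + h *: e) * g x).
have dA h : is_derive h (1 : R) Af
    (\int[lam]_x (partial i eta (x + h *: e) * phi x)).
  exact: is_derive_translation.
have dc h : is_derive h (1 : R) c
    (\int[lam]_x (partial i eta (x + h *: e) * g x)).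
  exact: is_derive_translation.
have cA : continuous Af.
  by move=> h; apply/differentiable_continuous/derivable1_diffP; have [] := dA h.
have cc : continuous c.
  by move=> h; apply/differentiable_continuous/derivable1_diffP; have [] := dc h.
have ftc : \int[leb]_(s in `[0, t]) c s = Af 0 - Af t.
  rewrite /Rintegral (@continuous_FTC2 _ c (fun h => - Af h) 0 t t0).
  - by rewrite -EFinB /= opprK addrC.
  - exact: continuous_subspaceT.
  - split.
    + by move=> h _; apply: derivableN; have [] := dA h.
    + by apply: cvgN; apply: cvg_at_right_filter; exact: cA.
    + by apply: cvgN; apply: cvg_at_left_filter; exact: cA.
  - move=> h; rewrite in_itv/= => /andP[h0 ht].
    have [dh1 dh2] := dA h.
    rewrite derive1E deriveN// dh2 weak ?opprK//.
    by rewrite (ltW h0) (le_trans (ltW ht)).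
have E1 : \int[lam]_x (eta x * phi (x - t *: e)) = Af t.
  by apply: Rintegral_translate_corr; [case: be|case: bphi].
have E2 : \int[lam]_x (eta x * phi x) = Af 0.
  by apply: eq_Rintegral => x _; rewrite scale0r addr0.
have E3 : \int[lam]_x (eta x * avg i t g x) = Af 0 - Af t.
  rewrite translate_Fubini// -ftc; apply: eq_Rintegral => s _.
  by apply: Rintegral_translate_corr; [case: be|case: bg].
have I1 : lam.-integrable setT (EFin \o (fun x => eta x * phi (x - t *: e))).
  by apply: bounded_meas_integrable; [exact: bounded_measM|exact: bounded_suppMl].
have I2 : lam.-integrable setT (EFin \o (fun x => eta x * phi x)).
  by apply: bounded_meas_integrable; [exact: bounded_measM|exact: bounded_suppMl].
have I3 : lam.-integrable setT (EFin \o (fun x => eta x * avg i t g x)).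
  by apply: bounded_meas_integrable; [exact: bounded_measM|exact: bounded_suppMl].
under eq_Rintegral do rewrite mulrDr mulrBr.
rewrite RintegralD//; last first.
  by rewrite /comp; under eq_fun do rewrite EFinB; exact: integrableB.
rewrite RintegralB// E1 E2 E3; move: (Af t) (Af 0) => X Y.
by rewrite addrC subrKA subrr.
Qed.

Variable psi : 'rV[R]_n -> R.
Hypotheses (C1psi : C1_along i psi) (spsi : bounded_supp psi).
Hypothesis psiV : forall x, psi x != 0 -> V x.

(** The derivative at 0 of [F h = int psi(x + h e) w(x) dx], with [w = exp(-phi)], is computed
    twice: under the integral sign it is the left-hand side; with the translation moved onto [w],
    the expansion of [w] yields [F t - F 0 = t * c 0 + O(t^2)], and [c 0] is the right-hand side. *)
Lemma ibp_exp_translation :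
  \int[lam]_x (partial i psi x * expR (- phi x)) =
  \int[lam]_x (psi x * (expR (- phi x) * g x)).
Proof.
pose w x := expR (- phi x).
have [mphi [Cphi hphi]] := bphi; have [mg [Cg hg]] := bg.
have Cg0 : 0 <= Cg by exact: le_trans (hg 0).
pose W := expR Cphi; have W0 : 0 <= W by exact: expR_ge0.
have hw x : `|w x| <= W.
  rewrite /w ger0_norm ?expR_ge0// ler_expR (le_trans (ler_norm _))//.
  by rewrite normrN.
have bw : bounded_meas w.
  split; last by exists W.
  by apply: measurableT_comp => //; apply: measurableT_comp.
have [cpsi _ _] := C1psi; have bpsi := continuous_bounded_meas cpsi spsi.
have [L L0 hL] := C1_along_lip C1psi spsi.
(* The second bound ensures [Cg * t <= 1/2], the range of [expR_quadratic]; the [+ 1] covers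
   [Cg = 0]. *)
pose r := Num.min delta (1 / (2 * (Cg + 1))).
have Cg1 : 0 < Cg + 1 by rewrite ltr_wpDl.
have r0 : 0 < r by rewrite lt_min delta0 divr_gt0// mulr_gt0.
have intM (u v : 'rV[R]_n -> R) : bounded_meas u -> bounded_supp u ->
    bounded_meas v -> lam.-integrable setT (EFin \o (fun x => u x * v x)).
  by move=> *; apply: bounded_meas_integrable; [exact: bounded_measM|exact: bounded_suppMl].
have bapsi := bounded_meas_norm bpsi; have sapsi := bounded_supp_norm spsi.
have bag := bounded_meas_norm bg; have sag := bounded_supp_norm sg.
pose N1 := \int[lam]_x `|psi x|; pose N2 := \int[lam]_x `|g x|.
have N10 : 0 <= N1 by exact: Rintegral_ge0.
have N20 : 0 <= N2 by exact: Rintegral_ge0.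
have scaleN (C : R) (u : 'rV[R]_n -> R) : bounded_meas u -> bounded_supp u ->
    \int[lam]_x (u x * C) = (\int[lam]_x u x) * C.
  by move=> bu su; rewrite RintegralZr//; exact: bounded_meas_integrable.
(* First-order expansion of exp(-phi) along the translation. *)
have key t : 0 < t -> t <= r -> {ae lam, forall x, V x ->
    `|w (x - t *: e) - w x - w x * avg i t g x| <= 2 * W * (Cg * t) ^+ 2 /\
    `|w (x - t *: e) - w x| <= 2 * W * (Cg * t)}.
  move=> t0; rewrite le_min => /andP[td tr].
  have := @weak_translation t; rewrite t0 td => /(_ isT).
  apply: filterS => x h Vx; have {}h := h Vx.
  have hav := avg_bound i x (ltW t0) bg hg.
  have small : Cg * t <= 1 / 2.
    rewrite (@le_trans _ _ ((Cg + 1) * t))//; first by rewrite ler_pM2r// lerDl.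
    rewrite -ler_pdivlMl// (le_trans tr)// le_eqVlt; apply/orP; left; apply/eqP.
    by field; rewrite gt_eqF.
  set d := phi (x - t *: e) - phi x in h.
  have dE : avg i t g x = - d by apply/eqP; rewrite -addr_eq0 addrC h.
  have dn : `|d| <= Cg * t by rewrite -normrN -dE.
  have q := expR_quadratic (le_trans dn small).
  have wE : w (x - t *: e) = w x * expR (- d).
    by rewrite /w -expRD; congr expR; rewrite /d; ring.
  have d2 : d ^+ 2 <= (Cg * t) ^+ 2.
    by rewrite -[d ^+ 2]real_normK ?num_real// ler_pXn2r ?nnegrE// mulr_ge0// ltW.
  rewrite dE wE; split.
    rewrite (_ : _ - _ = w x * (expR (- d) - 1 + d)); last by ring.
    rewrite normrM -mulrA mulrCA ler_pM// (le_trans q)//.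
    by rewrite ler_pM2l.
  rewrite (_ : _ - _ = w x * (expR (- d) - 1)); last by ring.
  rewrite normrM -mulrA mulrCA ler_pM//.
  rewrite (_ : _ - 1 = (expR (- d) - 1 + d) - d); last by ring.
  rewrite (le_trans (ler_normB _ _))// (@le_trans _ _ (2 * d ^+ 2 + `|d|))// ?lerD//.
  rewrite -[d ^+ 2]real_normK ?num_real//.
  have := normr_ge0 d; nra.
pose c s := \int[lam]_x (psi x * w x * g (x - s *: e)).
have bpw : bounded_meas (fun x => psi x * w x) by exact: bounded_measM.
have spw : bounded_supp (fun x => psi x * w x) by exact: bounded_suppMl.
have c0E : c 0 = \int[lam]_x (psi x * (w x * g x)).
  by apply: eq_Rintegral => x _; rewrite scale0r subr0 mulrA.
pose K2 := N1 * (2 * W * Cg * Cg) + N2 * (W * L).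
(* [g] has no continuity, so the regularity of [c] must come from [psi] and [w]. [T1] replaces [w x]
   by its translate, at a cost of order [s] by [key]; in [T2] the product [w * g] is then translated
   as a whole, and a change of variables leaves only the increment of [psi], which is Lipschitz
   along [e]. The two summands of [K2] are these two costs. *)
have clip s : 0 < s -> s <= r -> `|c s - c 0| <= K2 * s.
  move=> s0 sr.
  pose T1 x := psi x * ((w x - w (x - s *: e)) * g (x - s *: e)).
  pose T2 x := psi x * (w (x - s *: e) * g (x - s *: e)).
  pose T3 x := g x * (w x * (psi (x + s *: e) - psi x)).
  have bws : bounded_meas (fun x => w (x - s *: e)) by exact: bounded_meas_shift.
  have bgs : bounded_meas (fun x => g (x - s *: e)) by exact: bounded_meas_shift.
  have bps : bounded_meas (fun x => psi (x + s *: e)) by exact: bounded_meas_shift.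
  have i1 : lam.-integrable setT (EFin \o T1).
    by apply: intM => //; apply: bounded_measM => //; exact: bounded_measB.
  have i2 : lam.-integrable setT (EFin \o T2).
    by apply: intM => //; exact: bounded_measM.
  have i3 : lam.-integrable setT (EFin \o T3).
    by apply: intM => //; apply: bounded_measM => //; exact: bounded_measB.
  have i4 : lam.-integrable setT (EFin \o (fun x => psi x * (w x * g x))).
    by apply: intM => //; exact: bounded_measM.
  have cE : c s = \int[lam]_x T1 x + \int[lam]_x T2 x.
    rewrite -RintegralD//; apply: eq_Rintegral => x _; rewrite /T1 /T2; ring.
  have T2E : \int[lam]_x T2 x = \int[lam]_x T3 x + c 0.
    rewrite c0E -RintegralD//.
    rewrite [LHS](@Rintegral_translate_corr psi (fun x => w x * g x) s).
    - by apply: eq_Rintegral => x _; rewrite /T3; ring.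
    - by case: bpsi.
    - by have [] := bounded_measM bw bg.
  have n1 : `|\int[lam]_x T1 x| <= N1 * (2 * W * Cg * Cg) * s.
    rewrite -mulrA -scaleN//; apply: ae_normr_Rintegral_le => //.
    - by apply: intM => //; exact: bounded_meas_cst.
    - by move=> x; rewrite !mulr_ge0// ltW.
    - have := key s s0 sr; apply: filterS => x h; rewrite /T1.
      have [->|px] := eqVneq (psi x) 0; first by rewrite !mul0r normr0 mul0r.
      have [_ {}h] := h (psiV px).
      rewrite normrM ler_pM2l ?normr_gt0// normrM distrC.
      apply: (@le_trans _ _ (2 * W * (Cg * s) * Cg)); first exact: ler_pM.
      by rewrite le_eqVlt; apply/orP; left; apply/eqP; ring.
  have n3 : `|\int[lam]_x T3 x| <= N2 * (W * L) * s.
    rewrite -mulrA -scaleN//; apply: ae_normr_Rintegral_le => //.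
    - by apply: intM => //; exact: bounded_meas_cst.
    - by move=> x; rewrite !mulr_ge0// ltW.
    - apply: aeW => x; rewrite /T3 normrM ler_wpM2l// normrM -mulrA ler_pM//.
      by rewrite (le_trans (hL _ _))// gtr0_norm.
  rewrite cE T2E addrA addrK (le_trans (ler_normD _ _))//.
  by rewrite /K2 mulrDl lerD.
pose F h := \int[lam]_x (psi (x + h *: e) * w x).
have dF : is_derive (0 : R) (1 : R) F (\int[lam]_x (partial i psi x * w x)).
  have E0 : \int[lam]_x (partial i psi (x + 0 *: e) * w x) =
      \int[lam]_x (partial i psi x * w x).
    by apply: eq_Rintegral => x _; rewrite scale0r addr0.
  by rewrite -E0; exact: is_derive_translation.
rewrite -c0E; apply: (@derive_eq_of_quadratic _ F _ _ (N1 * (2 * W * Cg ^+ 2) + K2) r) => //.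
move=> t t0 tr.
have bwt : bounded_meas (fun x => w (x - t *: e)) by exact: bounded_meas_shift.
have bav := bounded_meas_avg i (ltW t0) bg sg.
(* [U1] is the quadratic remainder of the expansion. [U2] is its linear term, whose integral is that
   of [c] over [[0, t]] and hence [t * c 0] up to order [t^2] by [clip]. *)
pose U1 x := psi x * (w (x - t *: e) - w x - w x * avg i t g x).
pose U2 x := psi x * w x * avg i t g x.
have j0 : lam.-integrable setT (EFin \o (fun x => psi x * w (x - t *: e))) by exact: intM.
have j00 : lam.-integrable setT (EFin \o (fun x => psi x * w x)) by exact: intM.
have j1 : lam.-integrable setT (EFin \o U1).
  apply: intM => //; apply: bounded_measB; first exact: bounded_measB.
  exact: bounded_measM.
have j2 : lam.-integrable setT (EFin \o U2) by exact: intM.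
have FE : F t - F 0 = \int[lam]_x U1 x + \int[lam]_x U2 x.
  have -> : F t = \int[lam]_x (psi x * w (x - t *: e)).
    by rewrite Rintegral_translate_corr//; [case: bpsi|case: bw].
  have -> : F 0 = \int[lam]_x (psi x * w x).
    by apply: eq_Rintegral => x _; rewrite scale0r addr0.
  rewrite -RintegralB// -RintegralD//; apply: eq_Rintegral => x _.
  by rewrite /U1 /U2; ring.
have U1n : `|\int[lam]_x U1 x| <= N1 * (2 * W * Cg ^+ 2) * t ^+ 2.
  rewrite -mulrA -scaleN//; apply: ae_normr_Rintegral_le => //.
  - by apply: intM => //; exact: bounded_meas_cst.
  - by move=> x; rewrite !mulr_ge0// ltW.
  - have := key t t0 tr; apply: filterS => x h; rewrite /U1.
    have [->|px] := eqVneq (psi x) 0; first by rewrite !mul0r normr0 mul0r.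
    have [{}h _] := h (psiV px).
    move: h; rewrite exprMn [X in _ <= X]mulrA => h.
    by rewrite normrM ler_pM2l ?normr_gt0.
have ic : leb.-integrable `[0, t] (EFin \o c) by exact: integrable_translate_corr.
have icst (C : R) : leb.-integrable `[0, t] (EFin \o (fun=> C)).
  by apply: continuous_compact_integrable; [exact: segment_compact|
    apply: continuous_subspaceT; exact: cst_continuous].
have U2n : `|\int[lam]_x U2 x - t * c 0| <= K2 * t ^+ 2.
  rewrite /U2 translate_Fubini// -/c.
  have -> : t * c 0 = \int[leb]_(s in `[0, t]) (c 0).
    by rewrite Rintegral_cst// fine_lebesgue_itv ?ltW// mulrC.
  rewrite -RintegralB//.
  have ib : leb.-integrable `[0, t] (EFin \o (fun s => c s - c 0)).
    by apply: integrableB_real.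
  rewrite (le_trans (le_normr_Rintegral _ ib))//.
  have -> : K2 * t ^+ 2 = \int[leb]_(s in `[0, t]) (K2 * t).
    by rewrite Rintegral_cst// fine_lebesgue_itv ?ltW// expr2 mulrA.
  have K20 : 0 <= K2 by rewrite addr_ge0// !mulr_ge0.
  apply: le_Rintegral => //; first exact: integrable_norm.
  move=> s; rewrite /= in_itv/= => /andP[s0 st].
  move: s0; rewrite le_eqVlt => /predU1P[<-|s0].
    by rewrite subrr normr0 mulr_ge0// ltW.
  rewrite (le_trans (clip s s0 (le_trans st tr)))//.
  by rewrite ler_wpM2l.
by rewrite FE -addrA (le_trans (ler_normD _ _))// mulrDl lerD.
Qed.

End weak_gradient_translation.

(** * Localization to a neighbourhood of a compact support *)

Section localization.
Context {R : realType} {n : nat}.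
Implicit Types (Omega K S : set 'rV[R]_n) (f g h q : 'rV[R]_n -> R).
Local Notation lam := (lebesgue_rV n).

(** Compactness of [S] gives a uniform [d]; [K] is the sum of [S] and the closed cube of radius [d],
    a continuous image of a compact product. *)
Lemma compact_thickening S Omega : compact S -> open Omega -> S `<=` Omega ->
  exists2 d : R, 0 < d & exists K, [/\ compact K, K `<=` Omega &
    forall x y, S y -> `|x - y| <= d -> K x].
Proof.
move=> cS oO SO.
have nearS : \forall d \near (0:R)^'+,
    S `<=` (fun d x => forall y, `|y - x| <= d -> Omega y) d.
  have := (compact_near_coveringP S).1 cS R (0:R)^'+
    (fun d x => forall y, `|y - x| <= d -> Omega y) _; apply=> x Sx.
  have /nbhs_ballP[r /= r0 xr] : nbhs x Omega by apply: open_nbhs_nbhs; split => //; exact: SO.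
  have r2 : 0 < r / 2 by rewrite divr_gt0.
  exists (ball x (r / 2), [set d : R | d <= r / 2]).
    split=> /=; first exact: nbhsx_ballx.
    exact: nbhs_right_le.
  move=> [x' d] /= [xx' dr] y yx'; apply: xr.
  rewrite -ball_normE /= [r]splitr -(subrKA x') (le_lt_trans (ler_normD _ _))//.
  rewrite ltr_leD//; last by rewrite distrC (le_trans yx').
  by move: xx'; rewrite -ball_normE.
have [d [d0 dS]] : exists d : R, 0 < d /\ forall x, S x -> forall y, `|y - x| <= d -> Omega y.
  near (0:R)^'+ => d; exists d; split; first by near: d; exact: nbhs_right_gt.
  by near: d; exact: nearS.
exists d => //; pose b : 'rV[R]_n := const_mx d.
exists ((fun p : 'rV[R]_n * 'rV[R]_n => p.1 + p.2) @` (S `*` cbox (const_mx (- d)) b)); split.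
- apply: continuous_compact; last by apply: compact_setX => //; exact: compact_cbox.
  by apply: continuous_subspaceT => p; exact: add_continuous.
- move=> _ [[x v] [/= Sx vd] <-]; apply: (dS x Sx).
  rewrite addrAC subrr add0r; apply: norm_le_coord; first exact: ltW.
  by move=> j; have := vd j; rewrite !mxE in_itv/= -ler_norml.
- move=> x y Sy xy; exists (y, x - y) => /=; last by rewrite addrC subrK.
  by split=> //=; exact: norm_cbox.
Unshelve. all: by end_near. Qed.

(** Restriction to [K] followed by clamping at the essential bound. Against factors supported in
    [K], an integral over [Omega] thus becomes one over the whole space with an everywhere bounded
    integrand, on which translations act freely. *)
Lemma bounded_representative Omega K f : open Omega -> Linfty_loc Omega f ->
  compact K -> K `<=` Omega ->
  exists ft, [/\ bounded_meas ft, bounded_supp ft &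
    {ae lam, forall x, K x -> ft x = f x}].
Proof.
move=> oO [mf fb] cK KO; have [C hC] := fb K cK KO.
have mK := compact_measurable_rV cK.
pose f1 := f \_ K.
have mf1 : measurable_fun setT f1.
  by apply/(measurable_restrictT _ mK); apply: measurable_funS mf => //; exact: open_measurable_rV.
pose clamp (y : R) := Num.max (- `|C|) (Num.min `|C| y).
have clampE y : `|y| <= `|C| -> clamp y = y.
  rewrite /clamp ler_norml => /andP[y1 y2].
  by rewrite min_r// max_r.
exists (fun x => clamp (f1 x)); split.
- split; first by apply: measurable_maxr => //; apply: measurable_minr.
  exists `|C| => x; rewrite ler_norml le_max lexx/= ge_max ge_min lexx/= andbT.
  by rewrite lerNl (le_trans _ (normr_ge0 C))// oppr_le0.
- have [M [_ hM]] := compact_bounded cK; exists (M + 1) => x.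
  rewrite /f1 patchE; case: ifPn => [xK _|_].
    by apply: hM; [rewrite ltrDl|rewrite inE in xK].
  by rewrite clampE ?eqxx// normr0.
- apply: filterS hC => x h Kx; rewrite /f1 patchE mem_set// clampE//.
  by rewrite (le_trans (h Kx))// ler_norm.
Qed.

Lemma local_integral Omega K h ht q : open Omega -> K `<=` Omega ->
  measurable_fun Omega h -> bounded_meas ht -> bounded_meas q ->
  bounded_supp q -> (forall x, q x != 0 -> K x) ->
  {ae lam, forall x, K x -> ht x = h x} ->
  lam.-integrable Omega (EFin \o (fun x => q x * h x)) /\
  \int[lam]_(x in Omega) (q x * h x) = \int[lam]_x (q x * ht x).
Proof.
move=> oO KO mh bht bq sq qK aeh.
have mO := open_measurable_rV oO.
have int2 : lam.-integrable setT (EFin \o (fun x => q x * ht x)).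
  by apply: bounded_meas_integrable; [exact: bounded_measM|exact: bounded_suppMl].
have m1 : measurable_fun Omega (EFin \o (fun x => q x * h x)).
  apply/measurable_EFinP; apply: measurable_funM => //.
  by have [mq _] := bq; exact: measurable_funTS.
have m2 : measurable_fun Omega (EFin \o (fun x => q x * ht x)).
  by apply: measurable_funTS; exact: measurable_int int2.
have ae12 : ae_eq lam Omega (EFin \o (fun x => q x * h x)) (EFin \o (fun x => q x * ht x)).
  apply: filterS aeh => x hx _ /=; have [->|/qK/hx ->//] := eqVneq (q x) 0.
  by rewrite !mul0r.
have int2O : lam.-integrable Omega (EFin \o (fun x => q x * ht x)).
  exact: (integrableS measurableT _ _ int2).
split.
  apply/integrableP; split => //.
  have [_ int2lty] := (integrableP _ _ _ int2O).
  apply: le_lt_trans int2lty; rewrite le_eqVlt; apply/orP; left; apply/eqP.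
  apply: ae_eq_integral => //.
  - exact: measurableT_comp.
  - exact: measurableT_comp.
  - by apply: filterS ae12 => x hx Ox; exact: (congr1 abse (hx Ox)).
rewrite /Rintegral; congr fine.
transitivity (\int[lam]_(x in Omega) (q x * ht x)%:E)%E.
  exact: ae_eq_integral.
rewrite [LHS]integral_mkcond; apply: eq_integral => x _; rewrite patchE.
case: ifPn => //= xO; congr (_%:E); apply/esym/eqP; rewrite mulf_eq0.
apply/orP; left; apply: contraNT xO => /qK/KO; rewrite inE; exact.
Qed.

Lemma partial_shift (i : 'I_n) f v x :
  partial i (fun y => f (y + v)) x = partial i f (x + v).
Proof.
rewrite /partial /derive (_ : (fun h : R => _) = (fun h : R => h^-1 *:
  ((f \o shift (x + v)) (h *: (delta_mx ord0 i : 'rV[R]_n)) - f (x + v))))//.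
by apply/funext => h /=; rewrite addrA.
Qed.

Lemma partial_supp_closure (i : 'I_n) f x :
  partial i f x != 0 -> closure [set y | f y != 0] x.
Proof.
apply: contra_neqP => ncl; apply: partial_eq0.
have /open_nbhs_nbhs : open_nbhs x (~` closure [set y | f y != 0]).
  by split=> //; rewrite openC; exact: closed_closure.
by apply: filterS => y ny; apply: contra_notP ny => /eqP fy; exact: subset_closure.
Qed.

Lemma ibp_weight Omega phi (gphi : 'rV[R]_n -> 'rV[R]_n) (i : 'I_n) psi :
  open Omega -> W1oo_loc Omega phi gphi -> C1_along i psi ->
  compact (closure [set x | psi x != 0]) ->
  closure [set x | psi x != 0] `<=` Omega ->
  [/\ lam.-integrable Omega (EFin \o (fun x => partial i psi x * expR (- phi x))),
      lam.-integrable Omega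
        (EFin \o (fun x => psi x * (expR (- phi x) * gphi x ord0 i))) &
      \int[lam]_(x in Omega) (partial i psi x * expR (- phi x)) =
      \int[lam]_(x in Omega) (psi x * (expR (- phi x) * gphi x ord0 i))].
Proof.
move=> oO [Lphi Lg wg] C1psi; set S := closure _ => cS SO.
have [d d0 [K [cK KO SK]]] := compact_thickening cS oO SO.
have SsubK : S `<=` K by move=> x Sx; apply: (SK x x) => //; rewrite subrr normr0 ltW.
have d20 : 0 < d / 2 by rewrite divr_gt0.
(* Half of [d] is spent on [V] and the other half on translations: a box in [V] moved by at most
   [d / 2] stays in [K], so the translated bump is a test function on [Omega]. *)
pose V := \bigcup_(y in S) ball y (d / 2).
have oV : open V by apply: bigcup_open => y _; exact: ball_open.
have [phit [bphi sphi aephi]] := bounded_representative oO Lphi cK KO.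
have [g [bg sg aeg]] := bounded_representative oO (Lg i) cK KO.
have [cpsi dpsi cpsi'] := C1psi.
have psiS x : psi x != 0 -> S x by move=> px; exact: subset_closure.
have psi'S x : partial i psi x != 0 -> S x by exact: partial_supp_closure.
have spsi : bounded_supp psi.
  have [M [_ hM]] := compact_bounded cS.
  by exists (M + 1) => x /psiS; apply: hM; rewrite ltrDl.
have spsi' := bounded_supp_partial i spsi.
have bpsi := continuous_bounded_meas cpsi spsi.
have bpsi' := continuous_bounded_meas cpsi' spsi'.
have [mphi _] := Lphi; have [mg _] := Lg i.
pose e : 'rV[R]_n := delta_mx ord0 i.
have weak (a b : 'rV[R]_n) k t : 0 < k -> 0 <= t <= d / 2 -> cbox a b `<=` V ->
    \int[lam]_x (partial i (bump a b k) (x + t *: e) * phit x) =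
    - \int[lam]_x (bump a b k (x + t *: e) * g x).
  move=> k0 /andP[t0 td] abV.
  set v := t *: e; pose eta := bump (a - v) (b - v) k.
  have etaE x : bump a b k (x + v) = eta x by exact: bump_shift.
  have eta'E x : partial i (bump a b k) (x + v) = partial i eta x.
    have E : (fun y => bump a b k (y + v)) = eta by apply/funext => y; exact: etaE.
    by rewrite -partial_shift E.
  have avK : cbox (a - v) (b - v) `<=` K.
    move=> x xab; have [|y Sy] := abV (x + v).
      by move=> j; have := xab j; rewrite !mxE !in_itv/= lerBlDr lerBrDr.
    rewrite -ball_normE /= distrC => yxv; apply: (SK x y Sy).
    rewrite -(addrK v (x - y)) [x - y + v]addrAC (le_trans (ler_normB _ _))//.
    have nv : `|v| <= d / 2.
      rewrite normrZ ger0_norm//; apply: le_trans td.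
      by rewrite ler_piMr// norm_delta.
    by have := lerD (ltW yxv) nv; rewrite -splitr.
  have tf : test_function Omega eta.
    by apply: test_function_bump => // x /avK/KO.
  have := wg eta tf i.
  have C1eta : C1_along i eta by exact: bump_C1_along.
  have seta : bounded_supp eta by exact: bump_bounded_supp.
  have [ceta _ ceta'] := C1eta.
  have beta := continuous_bounded_meas ceta seta.
  have seta' := bounded_supp_partial i seta.
  have beta' := continuous_bounded_meas ceta' seta'.
  have etaK x : eta x != 0 -> K x.
    by move=> /(bump_neq0 k0)/sub_obox_cbox/avK.
  have eta'K x : partial i eta x != 0 -> K x.
    by move=> /partial_supp_closure /(closure_bump k0)/avK.
  have [I1 E1] := local_integral oO KO mphi bphi beta' seta' eta'K aephi.
  have [I2 E2] := local_integral oO KO mg bg beta seta etaK aeg.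
  have mO := open_measurable_rV oO.
  move=> W; have {W} : \int[lam]_(x in Omega) (partial i eta x * phi x) =
      - \int[lam]_(x in Omega) (eta x * gphi x ord0 i).
    rewrite /Rintegral -fineN.
    under eq_integral do rewrite mulrC.
    by rewrite W; congr (fine (- _)%E); apply: eq_integral => x _; rewrite mulrC.
  rewrite E1 E2 => W; under eq_Rintegral do rewrite eta'E.
  by rewrite W; congr (- _); apply: eq_Rintegral => x _; rewrite etaE.
have psiV x : psi x != 0 -> V x.
  by move=> /psiS Sx; exists x => //; exact: ballxx.
have main : \int[lam]_x (partial i psi x * expR (- phit x)) =
    \int[lam]_x (psi x * (expR (- phit x) * g x)).
  exact: (@ibp_exp_translation _ _ i phit g V (d / 2)).
have mexp : measurable_fun Omega (fun x => expR (- phi x)).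
  apply: measurableT_comp => //; exact: measurableT_comp.
have bexp : bounded_meas (fun x => expR (- phit x)).
  have [mphit [C hC]] := bphi; split.
    by apply: measurableT_comp => //; exact: measurableT_comp.
  exists (expR C) => x; rewrite ger0_norm ?expR_ge0// ler_expR.
  by rewrite (le_trans (ler_norm _))// normrN.
have aeexp : {ae lam, forall x, K x -> expR (- phit x) = expR (- phi x)}.
  by apply: filterS aephi => x h Kx; rewrite h.
have aeexpg : {ae lam, forall x, K x ->
    expR (- phit x) * g x = expR (- phi x) * gphi x ord0 i}.
  by apply: filterS2 aephi aeg => x h1 h2 Kx; rewrite h1// h2.
have psiK x : psi x != 0 -> K x by move=> /psiS/SsubK.
have psi'K x : partial i psi x != 0 -> K x by move=> /psi'S/SsubK.
have [I1 E1] := local_integral oO KO mexp bexp bpsi' spsi' psi'K aeexp.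
have [I2 E2] := local_integral oO KO (measurable_funM mexp mg)
  (bounded_measM bexp bg) bpsi spsi psiK aeexpg.
by split=> //; rewrite E1 E2.
Qed.

End localization.

(** * N-functions and the Euclidean norm *)

Lemma cvg_dnbhs0_right (R : realType) (f : R -> R) (l : R) :
  f @ (0 : R)^' --> l -> f @ (0 : R)^'+ --> l.
Proof.
move=> fl P lP; have : \forall x \near (0 : R)^', P (f x) := fl P lP.
suff : (\forall x \near (0 : R)^', P (f x)) ->
  (\forall x \near (0 : R)^'+, P (f x)) by move=> h /h.
rewrite !near_withinE; apply: filterS => x Px x0.
by apply: Px; rewrite gt_eqF.
Qed.

Section N_functions.
Context {R : realType}.
Variable M : R -> R.
Hypothesis M_N : N_function M.

Let M_ge0 l : 0 <= l -> 0 <= M l. Proof. by case: M_N => + _ _ _ _; exact. Qed.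

Lemma N_function_convex (k x y : R) : 0 <= k <= 1 -> 0 <= x -> 0 <= y ->
  M (k * x + (1 - k) * y) <= k * M x + (1 - k) * M y.
Proof.
move=> /andP[k0 k1] x0 y0; have [_ _ cM _ _] := M_N.
have xin : x \in (`[0, +oo[%classic : set R) by rewrite inE /= in_itv/= x0.
have yin : y \in (`[0, +oo[%classic : set R) by rewrite inE /= in_itv/= y0.
exact: (cM (Itv01 k0 k1) x y xin yin).
Qed.

(** [M l = l * (M l / l)] tends to 0 with [l], and [M] is continuous at 0. *)
Lemma N_function0 : M 0 = 0.
Proof.
have [_ + _ M0 _] := M_N => /continuous_within_itvcyP[_ cM].
have h : M l @[l --> 0^'+] --> (0 : R).
  have h2 : l * (M l / l) @[l --> (0:R)^'+] --> (0 * 0 : R).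
    by apply: cvgM => //; apply: cvg_at_right_filter; exact: cvg_id.
  rewrite mul0r in h2; apply: cvg_trans h2; apply: near_eq_cvg.
  near=> l; rewrite mulrC divfK//.
exact: (cvg_unique _ cM h).
Unshelve. all: by end_near. Qed.

(** Convexity between [x] and 0, where [M] vanishes. The monotonicity of [M] and of [M x / x] both
    follow. *)
Lemma N_function_star k x : 0 <= k <= 1 -> 0 <= x -> M (k * x) <= k * M x.
Proof.
move=> k01 x0; have := N_function_convex k01 x0 (lexx 0).
by rewrite N_function0 !mulr0 !addr0.
Qed.

Lemma N_function_nondecreasing x y : 0 <= x -> x <= y -> M x <= M y.
Proof.
rewrite le_eqVlt => /predU1P[<-|x0 xy]; first by rewrite N_function0 => /M_ge0.
have y0 : 0 < y by exact: lt_le_trans xy.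
have k01 : 0 <= x / y <= 1 by rewrite divr_ge0 ?(ltW x0) ?(ltW y0)//= ler_pdivrMr ?mul1r.
have := N_function_star k01 (ltW y0); rewrite divfK ?gt_eqF// => /le_trans; apply.
by rewrite ler_piMl ?M_ge0 ?(ltW y0)//; case/andP: k01.
Qed.

Lemma N_function_slope x y : 0 < x -> x <= y -> M x / x <= M y / y.
Proof.
move=> x0 xy; have y0 : 0 < y by exact: lt_le_trans xy.
have k01 : 0 <= x / y <= 1 by rewrite divr_ge0 ?(ltW x0) ?(ltW y0)//= ler_pdivrMr ?mul1r.
have := N_function_star k01 (ltW y0); rewrite divfK ?gt_eqF// => h.
rewrite ler_pdivrMr// (le_trans h)// le_eqVlt; apply/orP; left; apply/eqP.
by ring.
Qed.

Lemma N_function_measurable : measurable_fun (`[0, +oo[%classic : set R) M.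
Proof.
have [_ cM _ _ _] := M_N.
exact: subspace_continuous_measurable_fun.
Qed.

Hypothesis M_C1 : C1_pos M.

(** For [0 < h <= x], the point [x + h] divides the segment from [x] to [2 * x] with weights
    [1 - h/x] and [h/x]. By convexity the right difference quotient is at most [(M(2x) - M(x))/x],
    hence at most [c M(x)/x]. *)
Lemma N_function_derive_bound c x : (forall l, 0 < l -> M (2 * l) <= c * M l) ->
  0 < x -> 0 <= derive1 M x /\ x * derive1 M x <= c * M x.
Proof.
move=> D2 x0; have [dM _] := M_C1 x0.
have cvgD : h^-1 *: (M (h *: (1 : R) + x) - M x) @[h --> (0:R)^'+] --> derive1 M x.
  by rewrite derive1E; exact: cvg_dnbhs0_right.
split.
  apply: cvgr_to_ge cvgD _; near=> h.
  have h0 : 0 < h by near: h; exact: nbhs_right_gt.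
  rewrite mulr_ge0// ?invr_ge0 ?(ltW h0)// subr_ge0 [_%:A]mulr1.
  by apply: N_function_nondecreasing; rewrite ?(ltW x0)// lerDr ltW.
rewrite -ler_pdivlMl//; apply: cvgr_to_le cvgD _; near=> h.
have h0 : 0 < h by near: h; exact: nbhs_right_gt.
have hx : h <= x by near: h; exact: nbhs_right_le.
rewrite [_%:A]mulr1 -[_ *: _]/(_ * _) ler_pdivrMl//.
have k01 : 0 <= 1 - h / x <= 1.
  by rewrite subr_ge0 ler_pdivrMr// mul1r hx gerBl divr_ge0// ltW.
have := N_function_convex k01 (ltW x0) (mulr_ge0 (ler0n R 2) (ltW x0)).
rewrite (_ : _ + _ * (2 * x) = h + x); last by field; rewrite gt_eqF.
rewrite opprB addrCA subrr addr0 => cv.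
have k0 : 0 <= h / x by rewrite divr_ge0// ltW.
have := ler_wpM2l k0 (D2 x x0) => D2x.
rewrite lerBlDr (le_trans cv)//.
have -> : h * (x^-1 * (c * M x)) = h / x * (c * M x) by ring.
have := mulr_ge0 k0 (M_ge0 (ltW x0)); lra.
Unshelve. all: by end_near. Qed.

End N_functions.

Section enorm.
Context {R : realType} {m n : nat}.
Implicit Type A : 'M[R]_(m, n).

Lemma enorm_ge0 A : 0 <= enorm A. Proof. exact: sqrtr_ge0. Qed.

Lemma enorm_coord A i j : `|A i j| <= enorm A.
Proof.
rewrite -sqrtr_sqr ler_sqrt; last first.
  by apply: sumr_ge0 => k _; apply: sumr_ge0 => l _; exact: sqr_ge0.
rewrite (bigD1 i)//= (bigD1 j)//= -addrA lerDl addr_ge0//.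
  by apply: sumr_ge0 => l _; exact: sqr_ge0.
by apply: sumr_ge0 => k _; apply: sumr_ge0 => l _; exact: sqr_ge0.
Qed.

Lemma enorm0 : enorm (0 : 'M[R]_(m, n)) = 0.
Proof.
rewrite /enorm big1 ?sqrtr0// => i _; rewrite big1// => j _.
by rewrite mxE expr0n.
Qed.

Lemma enormZ (c : R) A : enorm (c *: A) = `|c| * enorm A.
Proof.
rewrite /enorm -sqrtr_sqr -sqrtrM ?sqr_ge0//; congr Num.sqrt.
rewrite mulr_sumr; apply: eq_bigr => i _; rewrite mulr_sumr.
by apply: eq_bigr => j _; rewrite mxE exprMn.
Qed.

End enorm.

(** * The regularized field *)

Section regularization.
Context {R : realType} {n : nat}.
Variables (M : R -> R) (u : 'rV[R]_n -> R) (eps : R).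
Hypotheses (M_C1 : C1_pos M) (C2u : of_class_C 2 u) (eps0 : 0 < eps).

Definition sqr_grad (x : 'rV[R]_n) : R := \sum_(k < n) partial k u x ^+ 2.

Definition reg (x : 'rV[R]_n) : R := Num.sqrt (sqr_grad x + eps ^+ 2).

Definition reg_field (i : 'I_n) (x : 'rV[R]_n) : R :=
  M (reg x) / reg x ^+ 2 * partial i u x.

(** Product rule; the second coefficient is the derivative of
    [r |-> M(sqrt(r + eps^2)) / (r + eps^2)] at [r = |grad u|^2], multiplied by the [i]-th
    derivative of [|grad u|^2]. *)
Definition reg_field_deriv (i : 'I_n) (x : 'rV[R]_n) : R :=
  M (reg x) / reg x ^+ 2 * partial i (partial i u) x +
  (derive1 M (reg x) * reg x / 2 - M (reg x)) / reg x ^+ 4 *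
    (\sum_(k < n) 2 * partial k u x * partial i (partial k u) x) * partial i u x.

Let contD (f g : 'rV[R]_n -> R) : continuous f -> continuous g ->
  continuous (fun x => f x + g x).
Proof. exact: (@of_class_CD _ _ 0). Qed.

Let contM (f g : 'rV[R]_n -> R) : continuous f -> continuous g ->
  continuous (fun x => f x * g x).
Proof. exact: (@of_class_CM _ _ 0). Qed.

Let cont_cst (c : R) : continuous (fun _ : 'rV[R]_n => c).
Proof. exact: (@of_class_C_cst _ _ 0). Qed.

Let contX (f : 'rV[R]_n -> R) (m : nat) : continuous f ->
  continuous (fun x => f x ^+ m).
Proof.
move=> cf; elim: m => [|m IHm]; first exact: cont_cst.
have -> : (fun x => f x ^+ m.+1) = (fun x => f x * f x ^+ m).
  by apply/funext => x; rewrite exprS.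
exact: contM.
Qed.

Lemma sqr_grad_ge0 x : 0 <= sqr_grad x.
Proof. by apply: sumr_ge0 => k _; exact: sqr_ge0. Qed.

Lemma enorm_grad x : enorm (grad u x) = Num.sqrt (sqr_grad x).
Proof.
rewrite /enorm big_ord1; congr Num.sqrt.
by apply: eq_bigr => j _; rewrite mxE.
Qed.

Lemma sqr_reg x : reg x ^+ 2 = sqr_grad x + eps ^+ 2.
Proof. by rewrite sqr_sqrtr// addr_ge0 ?sqr_ge0// sqr_grad_ge0. Qed.

Lemma reg_ge_eps x : eps <= reg x.
Proof.
rewrite -[leLHS]gtr0_norm// -sqrtr_sqr ler_sqrt ?addr_ge0 ?sqr_ge0 ?sqr_grad_ge0//.
by rewrite lerDr sqr_grad_ge0.
Qed.

Lemma reg_gt0 x : 0 < reg x.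
Proof. exact: lt_le_trans (reg_ge_eps x). Qed.

Lemma enorm_grad_le_reg x : enorm (grad u x) <= reg x.
Proof.
rewrite enorm_grad ler_sqrt ?lerDl ?sqr_ge0// addr_ge0 ?sqr_ge0//.
exact: sqr_grad_ge0.
Qed.

Lemma norm_partial_le (i : 'I_n) x : `|partial i u x| <= enorm (grad u x).
Proof. by have := enorm_coord (grad u x) ord0 i; rewrite mxE. Qed.

Let cu : continuous u. Proof. by case: C2u. Qed.
Let du i x : is_derive x (delta_mx ord0 i) u (partial i u x).
Proof. by apply: DeriveDef => //; case: C2u => _ /(_ i)[]. Qed.
Let cu1 i : continuous (partial i u).
Proof. by case: C2u => _ /(_ i)[_ []]. Qed.
Let du1 i k x : is_derive x (delta_mx ord0 i) (partial k u) (partial i (partial k u) x).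
Proof. by apply: DeriveDef => //; case: C2u => _ /(_ k)[_ [_ /(_ i)[]]]. Qed.
Let cu2 i k : continuous (partial i (partial k u)).
Proof. by case: C2u => _ /(_ k)[_ [_ /(_ i)[]]]. Qed.

Lemma continuous_sum_rV (I : Type) (r : seq I) (f : I -> 'rV[R]_n -> R) :
  (forall i, continuous (f i)) -> continuous (fun x => \sum_(i <- r) f i x).
Proof.
move=> cf; elim: r => [|i r IHr].
  by under eq_fun do rewrite big_nil; exact: cst_continuous.
by under eq_fun do rewrite big_cons; exact: contD.
Qed.

Lemma continuous_sqr_grad : continuous sqr_grad.
Proof. by apply: continuous_sum_rV => k; exact: contX. Qed.

Lemma continuous_reg : continuous reg.
Proof.
move=> x; apply: (@continuous_comp _ _ _ (fun x => sqr_grad x + eps ^+ 2) Num.sqrt).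
  exact: (contD continuous_sqr_grad (@cont_cst (eps ^+ 2))).
exact: sqrt_continuous.
Qed.

Lemma continuous_M_reg : continuous (fun x => M (reg x)).
Proof.
move=> x; apply: (@continuous_comp _ _ _ reg M); first exact: continuous_reg.
apply/differentiable_continuous/derivable1_diffP.
by have [dM _] := M_C1 (reg_gt0 x); exact: dM.
Qed.

Lemma continuous_M'_reg : continuous (fun x => derive1 M (reg x)).
Proof.
move=> x; apply: (@continuous_comp _ _ _ reg (derive1 M)); first exact: continuous_reg.
by have [_ cM'] := M_C1 (reg_gt0 x); exact: cM'.
Qed.

Lemma continuous_inv_reg (m : nat) : continuous (fun x => (reg x ^+ m)^-1).
Proof.
move=> x; apply: (@continuousV _ _ (fun x => reg x ^+ m)).
  by rewrite expf_eq0 gt_eqF ?reg_gt0// andbF.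
exact: (@contX _ m (@continuous_reg) x).
Qed.

Lemma continuous_reg_field i : continuous (reg_field i).
Proof.
by apply: contM => //; apply: contM; [exact: continuous_M_reg|exact: continuous_inv_reg].
Qed.

Lemma continuous_reg_field_deriv i : continuous (reg_field_deriv i).
Proof.
have cs : continuous (fun x => \sum_(k < n) 2 * partial k u x * partial i (partial k u) x).
  apply: continuous_sum_rV => k; apply: contM => //.
  by apply: (contM (@cont_cst 2)).
have c1 : continuous (fun x => derive1 M (reg x) * reg x / 2 - M (reg x)).
  have -> : (fun x => derive1 M (reg x) * reg x / 2 - M (reg x)) =
      (fun x => derive1 M (reg x) * reg x * 2^-1 + -1 * M (reg x)).
    by apply/funext => x; rewrite mulN1r.
  apply: contD; last exact: (contM (@cont_cst (-1)) continuous_M_reg).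
  apply: contM (@cont_cst 2^-1).
  exact: contM continuous_M'_reg continuous_reg.
apply: contD.
  apply: contM => //.
  by apply: contM; [exact: continuous_M_reg|exact: continuous_inv_reg].
apply: contM => //; apply: contM => //.
by apply: contM => //; exact: continuous_inv_reg.
Qed.

Lemma is_derive_sqr_grad i x : is_derive x (delta_mx ord0 i) sqr_grad
  (\sum_(k < n) 2 * partial k u x * partial i (partial k u) x).
Proof.
have D k : is_derive x (delta_mx ord0 i) (fun x => partial k u x ^+ 2)
    (2 * partial k u x * partial i (partial k u) x).
  have d1 := du1 i k x.
  rewrite [X in is_derive _ _ _ X](_ : _ = partial k u x *: partial i (partial k u) x +
    partial k u x *: partial i (partial k u) x); last by rewrite /GRing.scale/=; ring.
  exact: is_deriveM.
have := is_derive_sum D; congr is_derive.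
by apply/funext => y; rewrite fct_sumE.
Qed.

Lemma is_derive_M_over_sqr (r : R) : 0 <= r ->
  is_derive r (1 : R) (fun r => M (Num.sqrt (r + eps ^+ 2)) / (r + eps ^+ 2))
    ((derive1 M (Num.sqrt (r + eps ^+ 2)) * Num.sqrt (r + eps ^+ 2) / 2 -
      M (Num.sqrt (r + eps ^+ 2))) / Num.sqrt (r + eps ^+ 2) ^+ 4).
Proof.
move=> r0; set q := r + eps ^+ 2; set s := Num.sqrt q.
have q0 : 0 < q by rewrite ltr_wpDl// exprn_gt0.
have s0 : 0 < s by rewrite sqrtr_gt0.
have sq : s ^+ 2 = q by rewrite sqr_sqrtr// ltW.
have d1 : is_derive r (1 : R) (fun r : R => r + eps ^+ 2) (1 : R).
  by rewrite -[X in is_derive _ _ _ X]addr0; apply: is_deriveD.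
have d2 : is_derive r (1 : R) (Num.sqrt \o (fun r : R => r + eps ^+ 2)) ((2 * s)^-1 * 1).
  by apply: is_derive1_comp; exact: is_derive1_sqrt.
have d3 : is_derive r (1 : R) (M \o (Num.sqrt \o (fun r : R => r + eps ^+ 2)))
    (derive1 M s * ((2 * s)^-1 * 1)).
  apply: is_derive1_comp => /=; rewrite derive1E; apply: DeriveDef => //.
  by have [dM _] := M_C1 s0; exact: dM.
have d4 : is_derive r (1 : R) (fun r : R => (r + eps ^+ 2)^-1) (- q ^- 2).
  have [dd1 dd2] := d1.
  apply: DeriveDef; first by apply: derivableV => //; rewrite gt_eqF.
  by rewrite deriveV ?gt_eqF// dd2 [LHS]mulr1.
have := is_deriveM d3 d4; congr is_derive.
rewrite /= -/q -/s /GRing.scale/= -sq; field.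
by rewrite gt_eqF.
Qed.

Lemma is_derive_reg_field i x :
  is_derive x (delta_mx ord0 i) (reg_field i) (reg_field_deriv i x).
Proof.
have d1 : is_derive x (delta_mx ord0 i) (fun x => M (reg x) / reg x ^+ 2)
    ((derive1 M (reg x) * reg x / 2 - M (reg x)) / reg x ^+ 4 *
    (\sum_(k < n) 2 * partial k u x * partial i (partial k u) x)).
  have := is_derive_comp_real (is_derive_M_over_sqr (sqr_grad_ge0 x))
    (is_derive_sqr_grad i x).
  by congr is_derive; apply/funext => y; rewrite /= sqr_reg.
have := is_deriveM d1 (du1 i i x); congr is_derive.
by rewrite /reg_field_deriv /GRing.scale/=; congr (_ + _); rewrite mulrC.
Qed.

Lemma C1_along_reg i : C1_along i (fun x => u x * reg_field i x).
Proof.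
have D x : is_derive x (delta_mx ord0 i) (fun x => u x * reg_field i x)
    (u x *: reg_field_deriv i x + reg_field i x *: partial i u x).
  exact: is_deriveM (du i x) (is_derive_reg_field i x).
split.
- by apply: contM => //; exact: continuous_reg_field.
- by move=> x; have [] := D x.
- rewrite (_ : partial i _ = fun x => u x * reg_field_deriv i x +
    reg_field i x * partial i u x); last first.
    by apply/funext => x; have [_ <-] := D x.
  apply: contD; apply: contM => //.
    exact: continuous_reg_field_deriv.
  exact: continuous_reg_field.
Qed.

Lemma partial_reg i x : partial i (fun x => u x * reg_field i x) x =
  u x * reg_field_deriv i x + reg_field i x * partial i u x.
Proof.
have D : is_derive x (delta_mx ord0 i) (fun x => u x * reg_field i x)
    (u x *: reg_field_deriv i x + reg_field i x *: partial i u x).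
  exact: is_deriveM (du i x) (is_derive_reg_field i x).
by have [_ <-] := D.
Qed.

(** The 1 is the term containing the second derivative alone. In the other one,
    [|M'(s) s / 2 - M(s)| <= (c/2 + 1) M(s)], the sum is at most [2 n s |hess u|] and
    [|d_i u| <= s]; the product [(c/2 + 1) * 2 n] is the remaining part of the constant. *)
Lemma reg_field_deriv_bound c i x : (forall s, 0 < s -> 0 <= M s) ->
  (forall s, 0 < s -> 0 <= derive1 M s /\ s * derive1 M s <= c * M s) -> 0 <= c ->
  `|reg_field_deriv i x| <= (1 + (c + 2) * n%:R) *
     (M (reg x) / reg x ^+ 2 * enorm (hessian u x)).
Proof.
move=> M0 M' c0; set s := reg x; set E := enorm _; set h := M s / s ^+ 2.
have s0 : 0 < s := reg_gt0 x.
have Ms := M0 s s0; have [M's1 M's2] := M' s s0.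
have E0 : 0 <= E by exact: enorm_ge0.
have uE j k : `|partial j (partial k u) x| <= E.
  by have := enorm_coord (hessian u x) j k; rewrite mxE.
have us k : `|partial k u x| <= s.
  exact: le_trans (norm_partial_le k x) (enorm_grad_le_reg x).
have h0 : 0 <= h by rewrite divr_ge0// sqr_ge0.
have sumb : `|\sum_(k < n) 2 * partial k u x * partial i (partial k u) x| <= n%:R * (2 * s * E).
  rewrite (le_trans (ler_norm_sum _ _ _))//.
  rewrite (@le_trans _ _ (\sum_(k < n) 2 * s * E))//.
    apply: ler_sum => k _; rewrite !normrM (ger0_norm (ler0n R 2)).
    by rewrite ler_pM// ler_wpM2l.
  by rewrite sumr_const card_ord -[X in X <= _]mulr_natl.
have coefb : `|(derive1 M s * s / 2 - M s) / s ^+ 4| <= (c / 2 + 1) * M s / s ^+ 4.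
  rewrite normrM [X in _ * X]ger0_norm ?invr_ge0 ?exprn_ge0 ?(ltW s0)//.
  rewrite ler_pM2r ?invr_gt0 ?exprn_gt0//.
  rewrite mulrC in M's2; have := mulr_ge0 M's1 (ltW s0) => p0.
  have := mulr_ge0 c0 Ms => p1.
  by rewrite ler_norml; apply/andP; split; lra.
rewrite /reg_field_deriv -/s -/h (le_trans (ler_normD _ _))// [leRHS]mulrDl mul1r lerD//.
  by rewrite normrM (ger0_norm h0) ler_wpM2l.
rewrite !normrM.
rewrite (@le_trans _ _ ((c / 2 + 1) * M s / s ^+ 4 * (n%:R * (2 * s * E)) * s))//.
  by rewrite ler_pM ?mulr_ge0// ler_pM// -normrM.
rewrite le_eqVlt; apply/orP; left; apply/eqP; rewrite /h; field.
by rewrite gt_eqF.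
Qed.

End regularization.

(** * Measures with a density and test functions *)

Section density.
Context d (T : measurableType d) (R : realType).
Variables (mu nu : {measure set T -> \bar R}) (D : set T) (w : T -> R).
Hypotheses (mD : measurable D) (mw : measurable_fun D w).
Hypothesis w0 : forall x, 0 <= w x.
Hypothesis mu_w : forall A, measurable A -> A `<=` D ->
  (mu A = \int[nu]_(x in A) (w x)%:E)%E.
Local Open Scope ereal_scope.

Import HBNNSimple.

Let density_nnsfun (f : {nnsfun T >-> R}) :
  \int[mu]_(x in D) (f x)%:E = \int[nu]_(x in D) (f x * w x)%:E.
Proof.
transitivity (\sum_(k \in range f)
    \int[mu]_(x in D) (k * \1_(f @^-1` [set k]) x)%:E).
  under eq_integral do rewrite fimfunE -fsumEFin//.
  rewrite ge0_integral_fsum//.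
  - by move=> y; apply/measurable_EFinP/measurable_funM => //; exact: measurable_funTS.
  - by move=> y x _; rewrite nnfun_muleindic_ge0.
transitivity (\sum_(k \in range f)
    \int[nu]_(x in D) (k * \1_(f @^-1` [set k]) x * w x)%:E); last first.
  rewrite -ge0_integral_fsum//.
  - apply: eq_integral => x _; rewrite [in RHS]fimfunE EFinM -fsumEFin//.
    rewrite ge0_mule_fsuml; last by move=> y; exact: nnfun_muleindic_ge0.
    by apply: eq_fsbigr => y _; rewrite !EFinM.
  - move=> y; apply/measurable_EFinP; apply: measurable_funM => //.
    by apply: measurable_funM => //; exact: measurable_funTS.
  - by move=> y x _; rewrite EFinM mule_ge0 ?nnfun_muleindic_ge0// lee_fin.
apply: eq_fsbigr => r _.
have mr : measurable (f @^-1` [set r]) by exact: measurable_sfunP.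
rewrite integralZl_indic_nnsfun// integral_indic//.
rewrite mu_w//; last exact: measurableI.
have [r0|r0] := leP 0%R r; last first.
  rewrite (preimage_nnfun0 f r0) set0I integral_set0 mule0.
  by rewrite integral0_eq// => x _; rewrite indic0 mulr0 mul0r.
have mI : measurable_fun D (fun x => (\1_(f @^-1` [set r]) x * w x)%:E).
  apply/measurable_EFinP; apply: measurable_funM => //; exact: measurable_funTS.
under [RHS]eq_integral do rewrite -mulrA EFinM.
rewrite ge0_integralZl//; last by move=> x _; rewrite lee_fin mulr_ge0.
rewrite setIC integral_mkcondr; congr (_ * _); apply: eq_integral => x _.
by rewrite patchE indicE; case: ifPn => _; rewrite ?mul1r ?mul0r.
Qed.

(** Simple functions, then monotone convergence. As [mu] is prescribed on subsets of [D] only, level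
    sets are always intersected with [D]. *)
Lemma ge0_integral_density (f : T -> R) : measurable_fun D f ->
  (forall x, D x -> (0 <= f x)%R) ->
  \int[mu]_(x in D) (f x)%:E = \int[nu]_(x in D) (f x * w x)%:E.
Proof.
move=> mf f0; have mfE : measurable_fun D (EFin \o f) by exact/measurable_EFinP.
pose f_ := nnsfun_approx mD mfE.
have fcvg x : D x -> (f_ k x)%:E @[k --> \oo] --> (f x)%:E.
  by move=> Dx; apply: (cvg_nnsfun_approx mD mfE) => // y Dy; rewrite lee_fin f0.
have fnd x : {homo (fun k => f_ k x) : m k / (m <= k)%N >-> (m <= k)%R}.
  by move=> m k mk; exact/lefP/nd_nnsfun_approx.
transitivity (limn (fun k => \int[mu]_(x in D) (f_ k x)%:E)).
  rewrite -monotone_convergence//.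
  - by apply: eq_integral => x /[!inE] Dx; apply/esym/cvg_lim => //; exact: fcvg.
  - by move=> k; apply/measurable_EFinP/measurable_funTS.
  - by move=> k x _; rewrite lee_fin.
  - by move=> x _ m k mk; rewrite lee_fin fnd.
under eq_fun do rewrite density_nnsfun.
rewrite -monotone_convergence//.
- apply: eq_integral => x /[!inE] Dx; apply/cvg_lim => //.
  under eq_fun do rewrite EFinM; rewrite EFinM.
  apply: cvgeM; first by rewrite mule_def_fin.
    exact: fcvg.
  exact: cvg_cst.
- move=> k; apply/measurable_EFinP/measurable_funM => //; exact: measurable_funTS.
- by move=> k x _; rewrite lee_fin mulr_ge0.
- by move=> x _ m k mk; rewrite lee_fin ler_wpM2r// fnd.
Qed.

End density.

Section test_functions.
Context {R : realType} {n : nat}.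
Implicit Types (Omega : set 'rV[R]_n) (u : 'rV[R]_n -> R).

Lemma of_class_C_partial k (i : 'I_n) u : of_class_C k.+1 u -> of_class_C k (partial i u).
Proof. by case=> _ /(_ i)[]. Qed.

Lemma test_function_supp Omega u (v : 'rV[R]_n -> R) : test_function Omega u ->
  (forall x, v x != 0 -> closure [set x | u x != 0] x) ->
  compact (closure [set x | v x != 0]) /\ closure [set x | v x != 0] `<=` Omega.
Proof.
move=> [_ cS SO] vS.
have sub : closure [set x | v x != 0] `<=` closure [set x | u x != 0].
  rewrite [X in _ `<=` X](closure_id _).1; last exact: closed_closure.
  exact: closureS.
split; last exact: subset_trans SO.
by apply: (subclosed_compact _ cS) => //; exact: closed_closure.
Qed.

Lemma test_functionZ Omega u (c : R) : test_function Omega u ->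
  test_function Omega (fun x => c * u x).
Proof.
move=> tu; have [Cu _ _] := tu.
have vS x : c * u x != 0 -> closure [set x | u x != 0] x.
  by move=> cu; apply: subset_closure => /=; apply: contra_neq cu => ->; rewrite mulr0.
have [cS SO] := test_function_supp tu vS.
by split=> // k; apply: of_class_CM => //; exact: of_class_C_cst.
Qed.

Lemma test_function_partial Omega u (i : 'I_n) : test_function Omega u ->
  test_function Omega (partial i u).
Proof.
move=> tu; have [Cu _ _] := tu.
have [cS SO] := test_function_supp tu (@partial_supp_closure _ _ i u).
by split=> // k; have := Cu k.+1; exact: of_class_C_partial.
Qed.

Lemma partialZ (c : R) u (i : 'I_n) x : derivable u x (delta_mx ord0 i) ->
  partial i (fun x => c * u x) x = c * partial i u x.
Proof. by move=> du; rewrite /partial -[RHS]deriveZ. Qed.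

Lemma gradZ (c : R) Omega u x : test_function Omega u ->
  grad (fun x => c * u x) x = c *: grad u x.
Proof.
move=> [Cu _ _]; apply/rowP => i; rewrite !mxE partialZ//.
by have [_ /(_ i)[]] := Cu 1%N.
Qed.

Lemma hessianZ (c : R) Omega u x : test_function Omega u ->
  hessian (fun x => c * u x) x = c *: hessian u x.
Proof.
move=> [Cu _ _]; apply/matrixP => i j; rewrite !mxE.
have [_ /(_ j)[d1 [_ /(_ i)[d2 _]]]] := Cu 2%N.
have -> : partial j (fun x => c * u x) = fun x => c * partial j u x.
  by apply/funext => y; exact: partialZ.
exact: partialZ.
Qed.

(** The gradient of [partial i u] is the [i]-th column of the Hessian, so no symmetry of second
    derivatives is involved. *)
Lemma enorm_grad_partial u (i : 'I_n) x :
  enorm (grad (partial i u) x) <= enorm (hessian u x).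
Proof.
rewrite /enorm big_ord1 ler_sqrt; last first.
  by apply: sumr_ge0 => k _; apply: sumr_ge0 => l _; exact: sqr_ge0.
apply: ler_sum => j _; rewrite (bigD1 i)//= !mxE lerDl.
by apply: sumr_ge0 => l _; exact: sqr_ge0.
Qed.

Lemma measurable_enorm (m p : nat) (D : set 'rV[R]_n) (f : 'rV[R]_n -> 'M[R]_(m, p)) :
  (forall i j, measurable_fun D (fun x => f x i j)) ->
  measurable_fun D (fun x => enorm (f x)).
Proof.
move=> mf; apply: (@measurableT_comp _ _ _ _ _ _ (@Num.sqrt R)).
  exact: continuous_measurable_fun (@sqrt_continuous R).
apply: measurable_sum => i; apply: measurable_sum => j.
by apply: measurable_funX.
Qed.

Lemma integrable_exp_weight Omega phi (q : 'rV[R]_n -> R) : open Omega ->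
  Linfty_loc Omega phi -> continuous q ->
  compact (closure [set x | q x != 0]) -> closure [set x | q x != 0] `<=` Omega ->
  (lebesgue_rV n).-integrable Omega (EFin \o (fun x => q x * expR (- phi x))).
Proof.
move=> oO Lphi cq; set S := closure _ => cS SO.
have [phit [[mphit [C hC]] sphi aephi]] := bounded_representative oO Lphi cS SO.
have sq : bounded_supp q.
  have [N [_ hN]] := compact_bounded cS.
  by exists (N + 1) => x qx; apply: hN; [rewrite ltrDl|exact: subset_closure].
have [mphi _] := Lphi.
have [] // := @local_integral _ _ Omega S (fun x => expR (- phi x))
  (fun x => expR (- phit x)) q oO SO.
- by apply: measurableT_comp => //; exact: measurableT_comp.
- split; first by apply: measurableT_comp => //; exact: measurableT_comp.
  exists (expR C) => x; rewrite ger0_norm ?expR_ge0// ler_expR.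
  by rewrite (le_trans (ler_norm _))// normrN.
- exact: continuous_bounded_meas.
- by move=> x qx; exact: subset_closure.
- by apply: filterS aephi => x h Kx; rewrite h.
Qed.

End test_functions.

Section Rintegral_sum.
Context d (T : measurableType d) (R : realType) (mu : {measure set T -> \bar R}).

Lemma Rintegral_sum (D : set T) (I : Type) (r : seq I) (f : I -> T -> R) :
  measurable D -> (forall i, mu.-integrable D (EFin \o f i)) ->
  mu.-integrable D (EFin \o (fun x => \sum_(i <- r) f i x)) /\
  \int[mu]_(x in D) (\sum_(i <- r) f i x) = \sum_(i <- r) \int[mu]_(x in D) f i x.
Proof.
move=> mD intf; elim: r => [|i r [IH1 IH2]].
  split; last by rewrite big_nil /Rintegral; under eq_integral do rewrite big_nil;
    rewrite integral0.
  by apply: (eq_integrable mD (cst 0%E)); [move=> x _; rewrite /= big_nil|exact: integrable0].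
split.
  apply: (eq_integrable mD ((EFin \o f i) \+ (EFin \o (fun x => \sum_(i <- r) f i x)))).
    by move=> x _; rewrite /= big_cons EFinD.
  exact: integrableD.
rewrite big_cons -IH2 -RintegralD//; apply: eq_Rintegral => x _.
by rewrite big_cons.
Qed.

End Rintegral_sum.

Lemma measurable_comp_nonneg d (T : measurableType d) (R : realType) (D : set T)
    (P : R -> R) (g : T -> R) : measurable D ->
  measurable_fun (`[0, +oo[%classic : set R) P -> measurable_fun D g ->
  (forall x, D x -> 0 <= g x) -> measurable_fun D (P \o g).
Proof.
move=> mD mP mg g0; apply: (measurable_comp _ _ mP mg) => //.
by move=> _ [x Dx <-]; rewrite /= in_itv/= g0.
Qed.

(** * The modular inequality *)

(* The first term pays for the drift grad phi, the second for the divergence of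
   the regularized field. *)
Definition interpolation_cst (R : realType) (n : nat) (c A : R) : R :=
  4 * n%:R * A + 4 * (n%:R * (1 + (c + 2) * n%:R)).

Lemma interpolation_cst_gt0 (R : realType) (n : nat) (c A : R) :
  (0 < n)%N -> 0 < c -> 0 < A -> 0 < interpolation_cst n c A.
Proof.
move=> n_gt0 c_gt0 A_gt0; rewrite ltr_wpDr//; last by rewrite !mulr_gt0// ltr0n.
by rewrite !mulr_ge0// addr_ge0// mulr_ge0// addr_ge0// ltW.
Qed.

Section pointwise.
Context {R : realType} {n : nat}.
Variables (M P Q : R -> R) (u : 'rV[R]_n -> R) (eps c : R).
Hypotheses (n_gt0 : (0 < n)%N) (M_N : N_function M) (M_C1 : C1_pos M).
Hypotheses (c_gt0 : 0 < c) (M_double : forall l, 0 < l -> M (2 * l) <= c * M l).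
Hypotheses (P_ge0 : forall t : R, 0 <= t -> 0 <= P t)
  (Q_ge0 : forall t : R, 0 <= t -> 0 <= Q t)
  (Q_nondecreasing : forall s t : R, 0 <= s -> s <= t -> Q s <= Q t)
  (MPQ : forall u v w : R, 0 < u -> 0 < v -> 0 < w ->
    M u / u ^+ 2 * (v * w) <= M u + P v + Q w).
Hypotheses (eps_gt0 : 0 < eps).

Let M_ge0 l : 0 <= l -> 0 <= M l. Proof. by case: M_N => + _ _ _ _; exact. Qed.

(** [MPQ] speaks of positive arguments; if [v] or [w] is 0, the left-hand side vanishes. *)
Let MPQ_ge0 s v w : 0 < s -> 0 <= v -> 0 <= w ->
  M s / s ^+ 2 * (v * w) <= M s + P v + Q w.
Proof.
move=> s0; have Ms := M_ge0 (ltW s0).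
rewrite le_eqVlt => /predU1P[<- w0|v0].
  by rewrite mul0r mulr0 !addr_ge0// ?P_ge0// Q_ge0.
rewrite le_eqVlt => /predU1P[<-|w0]; last exact: MPQ.
by rewrite !mulr0 !addr_ge0// ?P_ge0 ?Q_ge0// ltW.
Qed.

(* [MPQ] is used with [(v, w)] equal to [(|g| |theta / A * d_i u|, 4 n A |u| / theta)]
   and to [(theta |hess u|, 4 n C0 |u| / theta)]. *)
Lemma drift_le (g : 'rV[R]_n) (A theta : R) x : 0 < A -> 0 < theta ->
  \sum_(i < n) (u x * reg_field M u eps i x * g ord0 i -
     u x * reg_field_deriv M u eps i x) <=
  2^-1 * M (reg u eps x) + 4^-1 * P (theta * enorm (hessian u x)) +
  \sum_(i < n) (4 * n%:R)^-1 * P (enorm g * `|theta / A * partial i u x|) +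
  2^-1 * Q (interpolation_cst n c A / theta * `|u x|).
Proof.
move=> A0 th0; rewrite /interpolation_cst; set s := reg u eps x.
set C0 := 1 + (c + 2) * n%:R; set B := 4 * n%:R * A + 4 * (n%:R * C0).
have s0 : 0 < s by exact: reg_gt0.
have Ms := M_ge0 (ltW s0).
have nR : 0 < n%:R :> R by rewrite ltr0n.
have C0_ge0 : 0 <= C0 by rewrite addr_ge0// mulr_ge0// addr_ge0// ltW.
have h0 : 0 <= M s / s ^+ 2 by rewrite divr_ge0// sqr_ge0.
have QB w : 0 <= w <= B / theta * `|u x| -> Q w <= Q (B / theta * `|u x|).
  by case/andP; exact: Q_nondecreasing.
(* Each of the [2 n] bounds is [MPQ] divided by [4 * n]: the terms [M s] add up to half of [M s],
   and the factor [4 * n] inside [w] cancels the division. Both values of [w] are finally enlarged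
   to [B / theta * |u x|], since [B] is the sum of their constants. *)
have bound1 i : u x * reg_field M u eps i x * g ord0 i <=
    (4 * n%:R)^-1 * (M s + P (enorm g * `|theta / A * partial i u x|) +
      Q (B / theta * `|u x|)).
  have w0 : 0 <= 4 * n%:R * A / theta * `|u x|.
    by rewrite mulr_ge0// divr_ge0 ?(ltW th0)// !mulr_ge0// ltW.
  have v0 : 0 <= enorm g * `|theta / A * partial i u x|.
    by rewrite mulr_ge0// enorm_ge0.
  have wB : 4 * n%:R * A / theta * `|u x| <= B / theta * `|u x|.
    rewrite ler_wpM2r// ler_wpM2r ?invr_ge0 ?(ltW th0)// lerDl.
    by rewrite !mulr_ge0.
  rewrite (@le_trans _ _ ((4 * n%:R)^-1 * (M s + P (enorm g * `|theta / A * partial i u x|) +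
      Q (4 * n%:R * A / theta * `|u x|))))//; last first.
    by rewrite ler_pM2l ?invr_gt0 ?mulr_gt0// lerD2l QB// w0.
  rewrite (@le_trans _ _ ((4 * n%:R)^-1 * (M s / s ^+ 2 *
      (enorm g * `|theta / A * partial i u x| * (4 * n%:R * A / theta * `|u x|)))))//; last first.
    by rewrite ler_pM2l ?invr_gt0 ?mulr_gt0//; exact: MPQ_ge0.
  rewrite [X in _ <= X](_ : _ = M s / s ^+ 2 * `|partial i u x| * `|u x| * enorm g); last first.
    rewrite normrM ger0_norm ?divr_ge0 ?ltW//; field.
    by rewrite !gt_eqF.
  rewrite (le_trans (ler_norm _))// normrM ler_pM//; last exact: enorm_coord.
  by rewrite normrM mulrC /reg_field -/s (normrM (M s / s ^+ 2)) (ger0_norm h0).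
have bound2 i : - (u x * reg_field_deriv M u eps i x) <=
    (4 * n%:R)^-1 * (M s + P (theta * enorm (hessian u x)) + Q (B / theta * `|u x|)).
  have w0 : 0 <= 4 * (n%:R * C0) / theta * `|u x|.
    by rewrite mulr_ge0// divr_ge0 ?(ltW th0)// !mulr_ge0// ltW.
  have v0 : 0 <= theta * enorm (hessian u x) by rewrite mulr_ge0 ?enorm_ge0 ?ltW.
  have wB : 4 * (n%:R * C0) / theta * `|u x| <= B / theta * `|u x|.
    rewrite ler_wpM2r// ler_wpM2r ?invr_ge0 ?(ltW th0)// lerDr.
    by rewrite !mulr_ge0// ltW.
  rewrite (@le_trans _ _ ((4 * n%:R)^-1 * (M s + P (theta * enorm (hessian u x)) +
      Q (4 * (n%:R * C0) / theta * `|u x|))))//; last first.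
    by rewrite ler_pM2l ?invr_gt0 ?mulr_gt0// lerD2l QB// w0.
  rewrite (@le_trans _ _ ((4 * n%:R)^-1 * (M s / s ^+ 2 *
      (theta * enorm (hessian u x) * (4 * (n%:R * C0) / theta * `|u x|)))))//; last first.
    by rewrite ler_pM2l ?invr_gt0 ?mulr_gt0//; exact: MPQ_ge0.
  rewrite [X in _ <= X](_ : _ = `|u x| * (C0 * (M s / s ^+ 2 * enorm (hessian u x)))); last first.
    by field; rewrite !gt_eqF.
  rewrite (le_trans (ler_norm _))// normrN normrM ler_wpM2l//.
  apply: reg_field_deriv_bound => //; last exact: ltW.
  - by move=> l l0; exact: M_ge0 (ltW l0).
  - by move=> l l0; exact: N_function_derive_bound.
rewrite sumrB -sumrN.
rewrite (@le_trans _ _ (\sum_(i < n) (4 * n%:R)^-1 * (M s + P (enorm g * `|theta / A * partial i u x|) +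
      Q (B / theta * `|u x|)) + \sum_(i < n) (4 * n%:R)^-1 * (M s + P (theta * enorm (hessian u x)) + Q (B / theta * `|u x|))))//.
  by rewrite lerD// ler_sum.
under eq_bigr do rewrite addrAC mulrDr.
rewrite big_split/= !sumr_const !card_ord.
rewrite le_eqVlt; apply/orP; left; apply/eqP.
move: (\sum_(i < n) _) (M s) (P _) (Q _) => a b d e.
rewrite -[X in X + a + _]mulr_natl -[X in _ + X = _]mulr_natl.
have key (N a' b' d' e' : R) : N != 0 ->
    N * ((4 * N)^-1 * (b' + e')) + a' + N * ((4 * N)^-1 * (b' + d' + e')) =
    2^-1 * b' + 4^-1 * d' + a' + 2^-1 * e' by move=> N0; field.
by apply: key; rewrite gt_eqF.
Qed.

Lemma reg_energy x : \sum_(i < n) reg_field M u eps i x * partial i u x =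
  M (reg u eps x) / reg u eps x ^+ 2 * sqr_grad u x.
Proof.
rewrite /sqr_grad mulr_sumr; apply: eq_bigr => i _.
by rewrite /reg_field -mulrA expr2.
Qed.

(** As [|grad u|^2 = s^2 - eps^2], the defect is [M(s)/s] times [eps^2/s]. The first factor is at
    most [M(T)/T] because the slope of [M] is monotone, and the second is at most [eps] because
    [eps <= s]. *)
Lemma reg_energy_ge x (T : R) : reg u eps x <= T ->
  M (reg u eps x) <=
  \sum_(i < n) reg_field M u eps i x * partial i u x + M T / T * eps.
Proof.
move=> sT; rewrite reg_energy; set s := reg u eps x in sT *.
have s0 : 0 < s by exact: reg_gt0.
have se : eps <= s by exact: reg_ge_eps.
have -> : sqr_grad u x = s ^+ 2 - eps ^+ 2 by rewrite sqr_reg addrK.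
have -> : M s / s ^+ 2 * (s ^+ 2 - eps ^+ 2) = M s - M s / s * (eps / s * eps).
  by field; rewrite gt_eqF.
rewrite -addrA lerDl addrC subr_ge0 ler_pM//.
- by rewrite divr_ge0 ?M_ge0 ?ltW.
- by rewrite mulr_ge0 ?divr_ge0 ?ltW.
- exact: N_function_slope.
- by rewrite ler_piMl ?(ltW eps_gt0)// ler_pdivrMr// mul1r.
Qed.

End pointwise.

(** Integration by parts equates real integrals of functions without a sign, whereas the majorant
    [h] may fail to be integrable; in that case the right-hand side is [+oo]. *)
Lemma ge0_integral_le_of_Rintegral d (T : measurableType d) (R : realType)
    (nu : {measure set T -> \bar R}) (D : set T) (f g h : T -> R) :
  measurable D -> nu.-integrable D (EFin \o f) -> nu.-integrable D (EFin \o g) ->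
  \int[nu]_(x in D) f x = \int[nu]_(x in D) g x ->
  measurable_fun D h -> (forall x, D x -> 0 <= h x) ->
  (forall x, D x -> g x <= h x) ->
  (\int[nu]_(x in D) (f x)%:E <= \int[nu]_(x in D) (h x)%:E)%E.
Proof.
move=> mD intf intg fg mh h0 gh.
have [->|hoo] := eqVneq (\int[nu]_(x in D) (h x)%:E)%E +oo%E; first by rewrite leey.
have inth : nu.-integrable D (EFin \o h).
  apply/integrableP; split; first exact/measurable_EFinP.
  rewrite (_ : (\int[nu]_(x in D) _ = \int[nu]_(x in D) (h x)%:E)%E) ?ltey//.
  by apply: eq_integral => x /[!inE] Dx; rewrite /= ger0_norm// h0.
have Ef : (\int[nu]_(x in D) (f x)%:E = \int[nu]_(x in D) (g x)%:E)%E.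
  rewrite -[LHS]fineK; last exact: integrable_fin_num intf.
  rewrite -[RHS]fineK; last exact: integrable_fin_num intg.
  by congr EFin; exact: fg.
rewrite Ef; apply: le_integral => // x /[!inE] Dx.
by rewrite lee_fin gh.
Qed.

Section energy.
Context {R : realType} {n : nat}.
Variables (Omega : set 'rV[R]_n) (M : R -> R) (phi : 'rV[R]_n -> R)
  (gphi : 'rV[R]_n -> 'rV[R]_n) (u : 'rV[R]_n -> R) (eps : R).
Hypotheses (Omega_open : open Omega) (M_C1 : C1_pos M)
  (phi_W1oo : W1oo_loc Omega phi gphi) (tu : test_function Omega u)
  (eps_gt0 : 0 < eps).

Let lam := lebesgue_rV n : {measure set 'rV[R]_n -> \bar R}.
Let C2u : of_class_C 2 u. Proof. by case: tu. Qed.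

Let supp_mul (q : 'rV[R]_n -> R) :
  compact (closure [set x | u x * q x != 0]) /\
  closure [set x | u x * q x != 0] `<=` Omega.
Proof.
apply: (test_function_supp tu) => x uq; apply: subset_closure => /=.
by apply: contra_neq uq => ->; rewrite mul0r.
Qed.

(** [ibp_weight] for [u * F_i], with the term [u * d_i F_i] of the product rule moved to the right.
    The weight is kept explicit because [ge0_integral_density] requires a nonnegative integrand and
    the right-hand side has no sign. *)
Lemma energy_identity :
  [/\ lam.-integrable Omega (EFin \o (fun x =>
        \sum_(i < n) reg_field M u eps i x * partial i u x * expR (- phi x))),
      lam.-integrable Omega (EFin \o (fun x =>
        \sum_(i < n) (u x * reg_field M u eps i x * gphi x ord0 i -
           u x * reg_field_deriv M u eps i x) * expR (- phi x))) &
      \int[lam]_(x in Omega)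
        (\sum_(i < n) reg_field M u eps i x * partial i u x * expR (- phi x)) =
      \int[lam]_(x in Omega)
        (\sum_(i < n) (u x * reg_field M u eps i x * gphi x ord0 i -
           u x * reg_field_deriv M u eps i x) * expR (- phi x))].
Proof.
have mO : measurable Omega := open_measurable_rV Omega_open.
have [Lphi _ _] := phi_W1oo.
pose w x := expR (- phi x).
pose f i x := reg_field M u eps i x * partial i u x * w x.
pose g i x := (u x * reg_field M u eps i x * gphi x ord0 i -
           u x * reg_field_deriv M u eps i x) * w x.
have key i : [/\ lam.-integrable Omega (EFin \o f i),
    lam.-integrable Omega (EFin \o g i) &
    \int[lam]_(x in Omega) f i x = \int[lam]_(x in Omega) g i x].
  have [cS SO] := supp_mul (reg_field M u eps i).
  have [I1 I2 E12] := ibp_weight Omega_open phi_W1oo (C1_along_reg M_C1 C2u eps_gt0 i) cS SO.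
  have [cS' SO'] := supp_mul (reg_field_deriv M u eps i).
  have cq : continuous (fun x => u x * reg_field_deriv M u eps i x).
    apply: (@of_class_CM _ _ 0); first by case: C2u.
    exact: continuous_reg_field_deriv.
  have I3 := integrable_exp_weight Omega_open Lphi cq cS' SO'.
  have -> : f i = fun x => partial i (fun x => u x * reg_field M u eps i x) x * expR (- phi x)
      - u x * reg_field_deriv M u eps i x * expR (- phi x).
    by apply/funext => x; rewrite partial_reg// /f /w -mulrBl addrC addKr.
  have -> : g i = fun x => u x * reg_field M u eps i x * (expR (- phi x) * gphi x ord0 i)
      - u x * reg_field_deriv M u eps i x * expR (- phi x).
    by apply/funext => x; rewrite /g /w mulrBl -[in RHS]mulrA [in RHS]mulrA; congr (_ - _); rewrite mulrAC mulrA.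
  split.
  - exact: integrableB_real.
  - exact: integrableB_real.
  - by rewrite !RintegralB// E12.
have If i : lam.-integrable Omega (EFin \o f i) by have [] := key i.
have Ig i : lam.-integrable Omega (EFin \o g i) by have [] := key i.
have [sf1 sf2] := Rintegral_sum (index_enum 'I_n) mO If.
have [sg1 sg2] := Rintegral_sum (index_enum 'I_n) mO Ig.
split => //; rewrite [LHS]sf2 [RHS]sg2; apply: eq_bigr => i _.
by have [] := key i.
Qed.

End energy.

Lemma continuous_bounded_on_compact (R : realType) n (f : 'rV[R]_n -> R) (S : set 'rV[R]_n) :
  compact S -> continuous f -> exists C, forall x, S x -> `|f x| <= C.
Proof.
move=> cS cf; have cf' : {within S, continuous f} by exact: continuous_subspaceT.
have /compact_bounded[N [_ hN]] := continuous_compact cf' cS.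
exists (N + 1) => x Sx.
by apply: (hN (N + 1)); [rewrite ltrDl|exists x].
Qed.

Section interpolation.
Context {R : realType} {n : nat}.
Variables (Omega : set 'rV[R]_n) (M P Q : R -> R) (phi : 'rV[R]_n -> R)
  (gphi : 'rV[R]_n -> 'rV[R]_n) (mu : {measure set 'rV[R]_n -> \bar R}) (c A : R).
Hypotheses (n_gt0 : (0 < n)%N) (Omega_open : open Omega)
  (M_N : N_function M) (M_C1 : C1_pos M)
  (c_gt0 : 0 < c) (M_double : forall l, 0 < l -> M (2 * l) <= c * M l)
  (phi_W1oo : W1oo_loc Omega phi gphi)
  (mu_density : forall A : set 'rV[R]_n, measurable A -> A `<=` Omega ->
    mu A = (\int[lebesgue_rV n]_(x in A) (expR (- phi x))%:E)%E)
  (mu_compact : forall C, compact C -> C `<=` Omega -> (mu C < +oo)%E)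
  (P_ge0 : forall t : R, 0 <= t -> 0 <= P t) (Q_ge0 : forall t : R, 0 <= t -> 0 <= Q t)
  (P_nondecreasing : forall s t : R, 0 <= s -> s <= t -> P s <= P t)
  (Q_nondecreasing : forall s t : R, 0 <= s -> s <= t -> Q s <= Q t)
  (P_measurable : measurable_fun (`[0, +oo[%classic : set R) P)
  (Q_measurable : measurable_fun (`[0, +oo[%classic : set R) Q)
  (MPQ : forall u v w : R, 0 < u -> 0 < v -> 0 < w ->
    M u / u ^+ 2 * (v * w) <= M u + P v + Q w)
  (A_gt0 : 0 < A).

Let lam := lebesgue_rV n : {measure set 'rV[R]_n -> \bar R}.
Let mO : measurable Omega. Proof. exact: open_measurable_rV. Qed.
Let M_ge0 l : 0 <= l -> 0 <= M l. Proof. by case: M_N => + _ _ _ _; exact. Qed.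

Let B := interpolation_cst n c A.
Let B_gt0 : 0 < B. Proof. exact: interpolation_cst_gt0. Qed.

Section test.
Variables (u : 'rV[R]_n -> R) (theta : R).
Hypotheses (tu : test_function Omega u) (theta_gt0 : 0 < theta).

Let C2u : of_class_C 2 u. Proof. by case: tu. Qed.

Lemma measurable_enorm_hessian : measurable_fun Omega (fun x => enorm (hessian u x)).
Proof.
apply: measurable_enorm => i j; apply: measurable_funTS.
under eq_fun do rewrite mxE; apply: continuous_measurable_rV.
by case: C2u => _ /(_ j)[_ [_ /(_ i)[]]].
Qed.

Lemma measurable_enorm_grad : measurable_fun Omega (fun x => enorm (grad u x)).
Proof.
apply: measurable_enorm => i j; apply: measurable_funTS.
under eq_fun do rewrite mxE; apply: continuous_measurable_rV.
by case: C2u => _ /(_ j)[_ []].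
Qed.

Lemma measurable_P_hessian :
  measurable_fun Omega (fun x => P (theta * enorm (hessian u x))).
Proof.
apply: (measurable_comp_nonneg mO P_measurable).
  by apply: measurable_funM => //; exact: measurable_enorm_hessian.
by move=> x _; rewrite mulr_ge0 ?enorm_ge0 ?ltW.
Qed.

Lemma measurable_P_gphi (i : 'I_n) :
  measurable_fun Omega (fun x => P (enorm (gphi x) * `|theta / A * partial i u x|)).
Proof.
apply: (measurable_comp_nonneg mO P_measurable).
  apply: measurable_funM; last first.
    apply: measurable_funTS; apply: measurableT_comp => //.
    apply: measurable_funM => //; apply: continuous_measurable_rV.
    by case: C2u => _ /(_ i)[_ []].
  apply: measurable_enorm => k j; rewrite (ord1 k).
  by have [_ /(_ j)[]] := phi_W1oo.
by move=> x _; rewrite mulr_ge0 ?enorm_ge0.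
Qed.

Lemma measurable_Q_abs :
  measurable_fun Omega (fun x => Q (B / theta * `|u x|)).
Proof.
apply: (measurable_comp_nonneg mO Q_measurable).
  apply: measurable_funM => //; apply: measurable_funTS.
  apply: measurableT_comp => //; apply: continuous_measurable_rV.
  by case: C2u.
by move=> x _; rewrite mulr_ge0// divr_ge0 ?ltW.
Qed.

(** The bound of [drift_le] without its term in [M], which is to be absorbed. *)
Let Y x : R := 4^-1 * P (theta * enorm (hessian u x)) +
  \sum_(i < n) (4 * n%:R)^-1 * P (enorm (gphi x) * `|theta / A * partial i u x|) +
  2^-1 * Q (B / theta * `|u x|).

Let mY : measurable_fun Omega Y.
Proof.
apply: measurable_funD.
  apply: measurable_funD.
    by apply: measurable_funM => //; exact: measurable_P_hessian.
  apply: measurable_sum => i.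
  by apply: measurable_funM => //; exact: measurable_P_gphi.
by apply: measurable_funM => //; exact: measurable_Q_abs.
Qed.

Let Y_ge0 x : 0 <= Y x.
Proof.
rewrite /Y !addr_ge0//.
- by rewrite mulr_ge0// P_ge0// mulr_ge0 ?enorm_ge0 ?ltW.
- by apply: sumr_ge0 => i _; rewrite mulr_ge0 ?invr_ge0 ?mulr_ge0// P_ge0// mulr_ge0 ?enorm_ge0.
- by rewrite mulr_ge0// Q_ge0// mulr_ge0// divr_ge0 ?ltW.
Qed.

Let S := closure [set x | u x != 0].
Let cS : compact S. Proof. by case: tu. Qed.
Let SO : S `<=` Omega. Proof. by case: tu. Qed.
Let mS : measurable S. Proof. exact: compact_measurable_rV. Qed.
Let u_offS x : ~ S x -> u x = 0.
Proof.
move=> Sx; apply/eqP/negPn/negP => ux; apply: Sx; exact: subset_closure.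
Qed.
Let partial_offS (i : 'I_n) x : ~ S x -> partial i u x = 0.
Proof.
move=> Sx; apply/eqP/negPn/negP => ux; apply: Sx.
exact: (partial_supp_closure ux).
Qed.

Section regularized.
Variables (eps T : R).
Hypotheses (eps_gt0 : 0 < eps) (regT : forall x, S x -> reg u eps x <= T).

(** The cutoff is essential: off the support [reg] equals [eps], and the constant [M eps] may have
    infinite integral over [Omega]. *)
Let a x : R := M (reg u eps x) * \1_S x.

Let ma : measurable_fun Omega a.
Proof.
apply: measurable_funM; last exact: measurable_funTS.
by apply: measurable_funTS; apply: continuous_measurable_rV; exact: continuous_M_reg.
Qed.

Let a_ge0 x : 0 <= a x.
Proof.
by rewrite /a indicE mulr_ge0//; apply: M_ge0; rewrite ltW// reg_gt0.
Qed.

Let energy_density_ge0 x : 0 <= \sum_(i < n) reg_field M u eps i x * partial i u x.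
Proof.
rewrite reg_energy mulr_ge0 ?sqr_grad_ge0//.
by rewrite divr_ge0 ?sqr_ge0// M_ge0// ltW// reg_gt0.
Qed.

Let measurable_energy_density :
  measurable_fun Omega (fun x => \sum_(i < n) reg_field M u eps i x * partial i u x).
Proof.
apply: measurable_sum => i; apply: measurable_funTS; apply: continuous_measurable_rV.
apply: (@of_class_CM _ _ 0); first exact: continuous_reg_field.
by case: C2u => _ /(_ i)[_ []].
Qed.

Lemma energy_le :
  (\int[mu]_(x in Omega) (\sum_(i < n) reg_field M u eps i x * partial i u x)%:E <=
   \int[mu]_(x in Omega) (2^-1 * a x + Y x)%:E)%E.
Proof.
have mw : measurable_fun Omega (fun x => expR (- phi x)).
  have [[mphi _] _ _] := phi_W1oo.
  by apply: measurableT_comp => //; exact: measurableT_comp.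
have w0 x : 0 <= expR (- phi x) by exact: expR_ge0.
rewrite (ge0_integral_density mO mw w0 mu_density measurable_energy_density)//.
have mR : measurable_fun Omega (fun x => 2^-1 * a x + Y x).
  by apply: measurable_funD => //; exact: measurable_funM.
have R0 x : 0 <= 2^-1 * a x + Y x by rewrite addr_ge0// mulr_ge0.
rewrite (ge0_integral_density mO mw w0 mu_density mR)//.
have [I1 I2 E12] := energy_identity Omega_open M_C1 phi_W1oo tu eps_gt0.
under eq_integral do rewrite mulr_suml.
apply: (ge0_integral_le_of_Rintegral mO I1 I2 E12).
- exact: measurable_funM.
- by move=> x _; rewrite mulr_ge0.
move=> x Ox; rewrite -mulr_suml ler_wpM2r//.
have [Sx|Sx] := pselect (S x).
  rewrite /a indicE mem_set// mulr1 /Y !addrA.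
  exact: (drift_le u n_gt0 M_N M_C1 c_gt0 M_double P_ge0 Q_ge0 Q_nondecreasing MPQ eps_gt0 (gphi x) x A_gt0 theta_gt0).
rewrite big1 ?R0// => i _; by rewrite u_offS// !mul0r subrr.
Qed.

Lemma regularized_le :
  (\int[mu]_(x in Omega) (M (enorm (grad u x)))%:E <=
   2%:E * \int[mu]_(x in Omega) (Y x)%:E + 2%:E * ((M T / T * eps)%:E * mu S))%E.
Proof.
have muS : mu S \is a fin_num by rewrite ge0_fin_numE// mu_compact.
have k0 x : 0 <= M T / T * eps * \1_S x.
  rewrite indicE; have [Sx|_] := boolP (x \in S); last by rewrite mulr0.
  have T0 : 0 < T by rewrite (lt_le_trans _ (regT (set_mem Sx)))// reg_gt0.
  by rewrite mulr1 mulr_ge0 ?divr_ge0 ?M_ge0 ?ltW.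
have mk : measurable_fun Omega (fun x => M T / T * eps * \1_S x).
  by apply: measurable_funM => //; exact: measurable_funTS.
(* Finiteness is what allows the absorption: [a] is at most [M T] on [S], and [S] has finite
   measure. *)
have afin : (\int[mu]_(x in Omega) (a x)%:E)%E \is a fin_num.
  rewrite ge0_fin_numE; last by apply: integral_ge0 => x _; rewrite lee_fin.
  apply: (@le_lt_trans _ _ (\int[mu]_(x in Omega) ((M T)%:E * (\1_S x)%:E))%E).
    apply: ge0_le_integral => //.
    - by move=> x _; rewrite lee_fin.
    - exact/measurable_EFinP.
    - by apply/measurable_EFinP; apply: measurable_funM => //; exact: measurable_funTS.
    - move=> x _; rewrite -EFinM lee_fin /a indicE.
      have [Sx|_] := boolP (x \in S); last by rewrite !mulr0.
      rewrite !mulr1; apply: (N_function_nondecreasing M_N); last exact: regT (set_mem Sx).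
      by rewrite ltW// reg_gt0.
  (* If [S] is empty, [regT] says nothing about the sign of [T]. *)
  have [->|/set0P[x0 Sx0]] := eqVneq S set0.
    by under eq_integral do rewrite indic0 mule0; rewrite integral0.
  have T0 : 0 <= T by rewrite (le_trans _ (regT Sx0))// ltW// reg_gt0.
  rewrite ge0_integralZl_EFin ?M_ge0//.
  - rewrite integral_indic// setIidl// -[mu S]fineK// -EFinM ltry//.
  - by apply/measurable_EFinP; exact: measurable_funTS.
have kE : (\int[mu]_(x in Omega) (M T / T * eps * \1_S x)%:E =
    (M T / T * eps)%:E * mu S)%E.
  have [S0|/set0P[x0 Sx0]] := eqVneq S set0.
    rewrite S0 measure0 mule0; under eq_integral do rewrite indic0 mulr0.
    exact: integral0.
  under eq_integral do rewrite EFinM.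
  rewrite ge0_integralZl_EFin//.
  - by rewrite integral_indic// setIidl.
  - by apply/measurable_EFinP; exact: measurable_funTS.
  - by have := k0 x0; rewrite indicE mem_set// mulr1.
have le1 : (\int[mu]_(x in Omega) (M (enorm (grad u x)))%:E <=
    \int[mu]_(x in Omega) (a x)%:E)%E.
  apply: ge0_le_integral => //.
  - by move=> x _; rewrite lee_fin M_ge0// enorm_ge0.
  - apply/measurable_EFinP.
    apply: (measurable_comp_nonneg mO (N_function_measurable M_N)) => //.
      exact: measurable_enorm_grad.
    by move=> x _; exact: enorm_ge0.
  - exact/measurable_EFinP.
  - move=> x _; rewrite lee_fin /a indicE; case: (boolP (x \in S)) => Sx.
      rewrite mulr1; apply: (N_function_nondecreasing M_N); first exact: enorm_ge0.
      exact: enorm_grad_le_reg.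
    rewrite (_ : grad u x = 0) ?enorm0 ?(N_function0 M_N) ?mulr0//.
    apply/rowP => i; rewrite !mxE partial_offS// => /mem_set.
    by rewrite (negPf Sx).
have le2 : (\int[mu]_(x in Omega) (a x)%:E <=
    \int[mu]_(x in Omega) (2^-1 * a x + Y x)%:E + (M T / T * eps)%:E * mu S)%E.
  rewrite -kE (le_trans _ (leeD energy_le (lexx _)))//.
  rewrite -ge0_integralD//; last 4 first.
  - by move=> x _; rewrite lee_fin.
  - exact/measurable_EFinP.
  - by move=> x _; rewrite lee_fin.
  - exact/measurable_EFinP.
  apply: ge0_le_integral => //.
  - by move=> x _; rewrite lee_fin.
  - exact/measurable_EFinP.
  - by apply: emeasurable_funD; exact/measurable_EFinP.
  - move=> x _; rewrite -EFinD lee_fin /a indicE; case: (boolP (x \in S)) => Sx.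
      rewrite !mulr1; apply: reg_energy_ge => //; exact: regT (set_mem Sx).
    by rewrite !mulr0 addr0.
have E2 : (\int[mu]_(x in Omega) (2^-1 * a x + Y x)%:E =
    2^-1%:E * \int[mu]_(x in Omega) (a x)%:E + \int[mu]_(x in Omega) (Y x)%:E)%E.
  under eq_integral do rewrite EFinD EFinM.
  rewrite ge0_integralD//.
  - rewrite ge0_integralZl_EFin//; first by move=> x _; rewrite lee_fin.
    exact/measurable_EFinP.
  - by move=> x _; rewrite -EFinM lee_fin mulr_ge0.
  - by apply/measurable_EFinP; exact: measurable_funM.
  - by move=> x _; rewrite lee_fin.
  - exact/measurable_EFinP.
(* The inequality has the form [p <= p/2 + y + k * q] with [p] and [q] finite, so [p/2] moves to the
   left. Only [y] may be [+oo], and then the bound is trivial. *)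
apply: (le_trans le1); move: le2; rewrite E2.
have Yge : (0 <= \int[mu]_(x in Omega) (Y x)%:E)%E.
  by apply: integral_ge0 => x _; rewrite lee_fin.
move: afin muS Yge.
move: (\int[mu]_(x in Omega) (a x)%:E)%E (mu S) (\int[mu]_(x in Omega) (Y x)%:E)%E.
move=> [p||] [q||] [y||] // _ _ _.
  by rewrite -!EFinM -!EFinD !lee_fin; lra.
by rewrite mulry gtr0_sg// mul1e addye ?leey// -!EFinM.
Qed.

End regularized.

Lemma gradient_le : (\int[mu]_(x in Omega) (M (enorm (grad u x)))%:E <=
  2%:E * \int[mu]_(x in Omega) (Y x)%:E)%E.
Proof.
have [C hC] : exists C, forall x, S x -> sqr_grad u x <= C.
  have [C hC] := continuous_bounded_on_compact cS (@continuous_sqr_grad _ _ u C2u).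
  by exists C => x /hC; exact: le_trans (ler_norm _).
(* This [T] bounds [reg] on [S] for all [eps <= 1] at once, so the error term is linear in [eps]. *)
pose T := Num.sqrt (C + 1).
have muS : mu S \is a fin_num by rewrite ge0_fin_numE// mu_compact.
pose k := `|M T / T| * fine (mu S).
have k0 : 0 <= k by rewrite mulr_ge0// fine_ge0.
apply/lee_addgt0Pr => d d0.
(* Chosen so that [2 * k * eps <= d]; the [+ 1] covers [k = 0]. *)
pose eps := Num.min 1 (d / (2 * k + 1)).
have k1 : 0 < 2 * k + 1 by rewrite ltr_wpDl// mulr_ge0.
have eps0 : 0 < eps by rewrite lt_min ltr01 divr_gt0.
have regT x : S x -> reg u eps x <= T.
  move=> Sx; rewrite ler_wsqrtr// lerD ?hC//.
  by rewrite -[leRHS](expr1n R 2) ler_sqr ?nnegrE ?ler01 ?(ltW eps0)// ge_min lexx.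
apply: (le_trans (regularized_le eps0 regT)); rewrite leeD2l//.
rewrite -[mu S]fineK// -!EFinM lee_fin.
have h1 : M T / T * eps * fine (mu S) <= k * eps.
  rewrite /k mulrAC ler_wpM2r ?(ltW eps0)// ler_wpM2r ?fine_ge0//.
  exact: ler_norm.
have h2 : eps * (2 * k + 1) <= d.
  by rewrite -ler_pdivlMr// ge_min lexx orbT.
have := ltW eps0; lra.
Qed.

Section hardy.
Variable K : R.
Hypotheses (K_gt0 : 0 < K)
  (hardy : forall u, test_function Omega u ->
    (\int[mu]_(x in Omega) (P (enorm (gphi x) * `|u x|))%:E <=
     K%:E * \int[mu]_(x in Omega) (P (A * enorm (grad u x)))%:E)%E).

(** Hardy's inequality needs a test function, which [|grad u|] is not in general; hence it is
    applied to each partial derivative. The factor [theta / A] turns its constant [A] into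
    [theta]. *)
Let hardy_partial (i : 'I_n) :
  (\int[mu]_(x in Omega) (P (enorm (gphi x) * `|theta / A * partial i u x|))%:E <=
   K%:E * \int[mu]_(x in Omega) (P (theta * enorm (hessian u x)))%:E)%E.
Proof.
have tp := test_function_partial i tu.
apply: (le_trans (hardy (test_functionZ (theta / A) tp))).
rewrite lee_pmul2l ?lte_fin//.
have gradE x : A * enorm (grad (fun x => theta / A * partial i u x) x) =
    theta * enorm (grad (partial i u) x).
  rewrite (gradZ _ _ tp) enormZ ger0_norm ?divr_ge0 ?ltW//.
  by rewrite mulrA mulrCA divff ?gt_eqF// mulr1.
under eq_integral do rewrite gradE.
apply: ge0_le_integral => //.
- by move=> x _; rewrite lee_fin P_ge0// mulr_ge0 ?enorm_ge0 ?ltW.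
- apply/measurable_EFinP; apply: (measurable_comp_nonneg mO P_measurable).
    apply: measurable_funM => //; apply: measurable_enorm => k j.
    apply: measurable_funTS; under eq_fun do rewrite mxE.
    apply: continuous_measurable_rV.
    by case: C2u => _ /(_ i)[_ [_ /(_ j)[]]].
  by move=> x _; rewrite mulr_ge0 ?enorm_ge0 ?ltW.
- by apply/measurable_EFinP; exact: measurable_P_hessian.
- move=> x _; rewrite lee_fin P_nondecreasing//.
    by rewrite mulr_ge0 ?enorm_ge0 ?ltW.
  by rewrite ler_pM2l// enorm_grad_partial.
Qed.

Lemma modular_interpolation :
  (\int[mu]_(x in Omega) (M (enorm (grad u x)))%:E <=
   ((1 + K) / 2)%:E * \int[mu]_(x in Omega) (P (theta * enorm (hessian u x)))%:E +
   \int[mu]_(x in Omega) (Q (interpolation_cst n c A / theta * `|u x|))%:E)%E.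
Proof.
apply: (le_trans gradient_le).
have mP := measurable_P_hessian; have mPi := measurable_P_gphi; have mQ := measurable_Q_abs.
have P0 x : 0 <= P (theta * enorm (hessian u x)).
  by rewrite P_ge0// mulr_ge0 ?enorm_ge0 ?ltW.
have Pi0 i x : 0 <= P (enorm (gphi x) * `|theta / A * partial i u x|).
  by rewrite P_ge0// mulr_ge0 ?enorm_ge0.
have Q0 x : 0 <= Q (B / theta * `|u x|).
  by rewrite Q_ge0// mulr_ge0// divr_ge0 ?ltW.
have i0 : 0 <= (4 * n%:R)^-1 :> R by rewrite invr_ge0 mulr_ge0.
have EY : (\int[mu]_(x in Omega) (Y x)%:E =
    4^-1%:E * \int[mu]_(x in Omega) (P (theta * enorm (hessian u x)))%:E +
    \sum_(i < n) (4 * n%:R)^-1%:E *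
       \int[mu]_(x in Omega) (P (enorm (gphi x) * `|theta / A * partial i u x|))%:E +
    2^-1%:E * \int[mu]_(x in Omega) (Q (B / theta * `|u x|))%:E)%E.
  under eq_integral do rewrite !EFinD.
  rewrite ge0_integralD//; last 4 first.
  - by move=> x _; rewrite -EFinD lee_fin addr_ge0 ?mulr_ge0// sumr_ge0// => i _; rewrite mulr_ge0.
  - apply: emeasurable_funD; apply/measurable_EFinP; first exact: measurable_funM.
    by apply: measurable_sum => i; exact: measurable_funM.
  - by move=> x _; rewrite lee_fin mulr_ge0.
  - by apply/measurable_EFinP; exact: measurable_funM.
  rewrite ge0_integralD//; last 4 first.
  - by move=> x _; rewrite lee_fin mulr_ge0.
  - by apply/measurable_EFinP; exact: measurable_funM.
  - by move=> x _; rewrite lee_fin sumr_ge0// => i _; rewrite mulr_ge0.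
  - by apply/measurable_EFinP; apply: measurable_sum => i; exact: measurable_funM.
  congr (_ + _ + _)%E.
  - under eq_integral do rewrite EFinM.
    by rewrite ge0_integralZl_EFin//; [move=> x _; rewrite lee_fin|exact/measurable_EFinP].
  - under eq_integral do rewrite -sumEFin.
    rewrite ge0_integral_sum//.
    + apply: eq_bigr => i _; under eq_integral do rewrite EFinM.
      by rewrite ge0_integralZl_EFin//; [move=> x _; rewrite lee_fin|exact/measurable_EFinP].
    + by move=> i; apply/measurable_EFinP; exact: measurable_funM.
    + by move=> i x _; rewrite lee_fin mulr_ge0.
  - under eq_integral do rewrite EFinM.
    by rewrite ge0_integralZl_EFin//; [move=> x _; rewrite lee_fin|exact/measurable_EFinP].
rewrite EY; set p := (\int[mu]_(x in Omega) (P (theta * _))%:E)%E.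
set q := (\int[mu]_(x in Omega) (Q _)%:E)%E.
have p0 : (0 <= p)%E by apply: integral_ge0 => x _; rewrite lee_fin.
have q0 : (0 <= q)%E by apply: integral_ge0 => x _; rewrite lee_fin.
have sum_le : (\sum_(i < n) (4 * n%:R)^-1%:E *
       \int[mu]_(x in Omega) (P (enorm (gphi x) * `|theta / A * partial i u x|))%:E <=
    (K / 4)%:E * p)%E.
  apply: (@le_trans _ _ (\sum_(i < n) ((4 * n%:R)^-1%:E * (K%:E * p)))%E).
    by apply: lee_sum => i _; rewrite lee_wpmul2l ?lee_fin// hardy_partial.
  under eq_bigr do rewrite muleA -EFinM.
  rewrite -ge0_sume_distrl; last by move=> i _; rewrite lee_fin mulr_ge0// ltW.
  rewrite sumEFin sumr_const card_ord lee_wpmul2r// lee_fin -mulr_natl.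
  rewrite le_eqVlt; apply/orP; left; apply/eqP; field.
  by rewrite pnatr_eq0 -lt0n.
apply: (@le_trans _ _ (2%:E * (4^-1%:E * p + (K / 4)%:E * p + 2^-1%:E * q))%E).
  by rewrite lee_pmul2l// leeD// leeD.
have Kp : (((1 + K) / 2)%:E * +oo = +oo :> \bar R)%E.
  by rewrite mulry gtr0_sg ?mul1e// divr_gt0// addr_gt0.
move: p0 q0; clear EY sum_le; move: p q => [p||] [q||] // _ _.
- by rewrite -!EFinM -!EFinD lee_fin; lra.
- by rewrite [X in (_ <= _ + X)%E]/= addey ?leey// -EFinM.
- by rewrite Kp addye// leey.
- by rewrite Kp addye// leey.
Qed.

End hardy.
End test.
End interpolation.

(** * The multiplicative inequality *)

Section luxemburg.
Context d (T : measurableType d) (R : realType) (mu : {measure set T -> \bar R}).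
Implicit Types (D : set T) (F : R -> R) (f : T -> R).

Lemma luxemburg_ge0 D F f : (0 <= luxemburg mu D F f)%E.
Proof.
by apply: le_ereal_inf_tmp => _ [k [k0 _] <-]; rewrite lee_fin ltW.
Qed.

Lemma luxemburg_le D F f (k : R) : 0 < k ->
  (\int[mu]_(x in D) (F (`|f x| / k))%:E <= 1)%E -> (luxemburg mu D F f <= k%:E)%E.
Proof. by move=> k0 hk; apply: ereal_inf_lbound; exists k. Qed.

(** Admissible [k] are positive, so a zero norm is never attained; the slack [e] provides an
    admissible value in all cases. *)
Lemma luxemburg_near D F f (a e : R) : 0 < e -> luxemburg mu D F f = a%:E ->
  exists k, [/\ 0 < k, k < a + e & (\int[mu]_(x in D) (F (`|f x| / k))%:E <= 1)%E].
Proof.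
move=> e0 fa; have [] := @lb_ereal_inf_adherent R _ _ e0 (_ : luxemburg mu D F f \is a fin_num).
  by rewrite fa.
move=> _ [k [k0 hk] <-]; rewrite -/(luxemburg mu D F f) fa -EFinD lte_fin => ka.
by exists k.
Qed.

Lemma measurable_N_function_abs D F f (k : R) : measurable D -> N_function F ->
  0 < k -> measurable_fun D f -> measurable_fun D (fun x => F (`|f x| / k)).
Proof.
move=> mD NF k0 mf; apply: (measurable_comp_nonneg mD (N_function_measurable NF)).
  by apply: measurable_funM => //; exact: measurableT_comp.
by move=> x _; rewrite divr_ge0// ltW.
Qed.

Lemma N_function_le_div F (k t : R) : N_function F -> 1 <= k -> 0 <= t ->
  F (t / k) <= k^-1 * F t.
Proof.
move=> NF k1 t0; have k0 : 0 < k by exact: lt_le_trans k1.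
by rewrite mulrC; apply: N_function_star; rewrite // invr_ge0 (ltW k0) invf_le1.
Qed.

(** An [N]-function satisfies [F(t/c) <= F(t)/c] for [c >= 1], so dividing [f] by a further [c]
    brings the modular below 1. *)
Lemma luxemburg_le_scale D F f (k c : R) : measurable D -> N_function F ->
  measurable_fun D f -> 0 < k -> 1 <= c ->
  (\int[mu]_(x in D) (F (`|f x| / k))%:E <= c%:E)%E ->
  (luxemburg mu D F f <= (c * k)%:E)%E.
Proof.
move=> mD NF mf k0 c1 hk; have c0 : 0 < c by exact: lt_le_trans c1.
have F0 t : 0 <= t -> 0 <= F t by case: NF => + _ _ _ _; exact.
apply: luxemburg_le; first exact: mulr_gt0.
have mF := measurable_N_function_abs mD NF k0 mf.
apply: (@le_trans _ _ (\int[mu]_(x in D) (c^-1%:E * (F (`|f x| / k))%:E))%E).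
  apply: ge0_le_integral => //.
  - by move=> x _; rewrite lee_fin F0// divr_ge0// mulr_ge0// ltW.
  - by apply/measurable_EFinP; apply: measurable_N_function_abs => //; exact: mulr_gt0.
  - by apply/measurable_EFinP; exact: measurable_funM.
  - move=> x _; rewrite -EFinM lee_fin invfM mulrA -[X in F X]mulrA [X in F (_ * X)]mulrC mulrA.
    by apply: N_function_le_div => //; rewrite divr_ge0// ltW.
rewrite ge0_integralZl_EFin//; last 3 first.
- by move=> x _; rewrite lee_fin F0// divr_ge0// ltW.
- exact/measurable_EFinP.
- by rewrite invr_ge0 ltW.
by rewrite lee_pdivrMl// mule1.
Qed.

(** At [k = 1] the modular is at most [F |C|] times the measure of [S], and [luxemburg_le_scale]
    applies. *)
Lemma luxemburg_lty D F f (S : set T) (C : R) : measurable D -> measurable S ->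
  S `<=` D -> (mu S < +oo)%E -> N_function F -> measurable_fun D f ->
  (forall x, ~ S x -> f x = 0) -> (forall x, S x -> `|f x| <= C) ->
  (luxemburg mu D F f < +oo)%E.
Proof.
move=> mD mS SD muS NF mf f0 fC.
have F0 t : 0 <= t -> 0 <= F t by case: NF => + _ _ _ _; exact.
have muSf : mu S \is a fin_num by rewrite ge0_fin_numE.
pose c := Num.max 1 (F `|C| * fine (mu S)).
apply: (@le_lt_trans _ _ (c * 1)%:E); last exact: ltry.
apply: luxemburg_le_scale => //; first by rewrite le_max lexx.
apply: (@le_trans _ _ (\int[mu]_(x in D) ((F `|C|)%:E * (\1_S x)%:E))%E).
  apply: ge0_le_integral => //.
  - by move=> x _; rewrite lee_fin F0// divr_ge0.
  - by apply/measurable_EFinP; exact: measurable_N_function_abs.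
  - by apply/measurable_EFinP; apply: measurable_funM => //; exact: measurable_funTS.
  - move=> x _; rewrite -EFinM lee_fin divr1 indicE; case: (boolP (x \in S)) => Sx.
      rewrite mulr1; apply: N_function_nondecreasing => //.
      by rewrite (le_trans (fC x (set_mem Sx)))// ler_norm.
    rewrite f0 ?normr0 ?(N_function0 NF) ?mulr0// => /mem_set.
    by rewrite (negPf Sx).
rewrite ge0_integralZl_EFin ?F0//.
- rewrite integral_indic// setIidl// -[mu S]fineK// -EFinM lee_fin.
  by rewrite le_max lexx orbT.
- by apply/measurable_EFinP; exact: measurable_funTS.
Qed.

End luxemburg.

Section multiplicative.
Context {R : realType} {n : nat}.
Variables (Omega : set 'rV[R]_n) (M P Q : R -> R)
  (mu : {measure set 'rV[R]_n -> \bar R}) (L B : R).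
Hypotheses (Omega_open : open Omega) (M_N : N_function M)
  (mu_compact : forall C, compact C -> C `<=` Omega -> (mu C < +oo)%E)
  (P_N : N_function P) (Q_N : N_function Q) (L_gt0 : 0 < L) (B_gt0 : 0 < B).
Hypothesis modular : forall (theta : R) (u : 'rV[R]_n -> R),
  0 < theta -> test_function Omega u ->
  (\int[mu]_(x in Omega) (M (enorm (grad u x)))%:E <=
   L%:E * \int[mu]_(x in Omega) (P (theta * enorm (hessian u x)))%:E +
   \int[mu]_(x in Omega) (Q (B / theta * `|u x|))%:E)%E.
Variable u : 'rV[R]_n -> R.
Hypothesis tu : test_function Omega u.

Let mO : measurable Omega. Proof. exact: open_measurable_rV. Qed.

(* The inequality for [u / s] with [s = sqrt (B a b)] and [theta = s / a]. *)
Lemma luxemburg_admissible_le (a b : R) : 0 < a -> 0 < b ->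
  (\int[mu]_(x in Omega) (P (`|enorm (hessian u x)| / a))%:E <= 1)%E ->
  (\int[mu]_(x in Omega) (Q (`|u x| / b))%:E <= 1)%E ->
  (luxemburg mu Omega M (fun x => enorm (grad u x)) <=
   ((L + 1) * Num.sqrt (B * (a * b)))%:E)%E.
Proof.
move=> a0 b0 Pa Qb; set s := Num.sqrt (B * (a * b)).
have s0 : 0 < s by rewrite sqrtr_gt0 !mulr_gt0.
have s2 : s * s = B * (a * b) by rewrite -expr2 sqr_sqrtr// ltW// !mulr_gt0.
apply: luxemburg_le_scale => //; first exact: measurable_enorm_grad tu.
  by rewrite lerDr ltW.
have := modular (divr_gt0 s0 a0) (test_functionZ s^-1 tu).
have -> : (\int[mu]_(x in Omega) (M (enorm (grad (fun y => s^-1 * u y) x)))%:E =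
    \int[mu]_(x in Omega) (M (`|enorm (grad u x)| / s))%:E)%E.
  apply: eq_integral => x _.
  by rewrite (gradZ _ _ tu) enormZ !ger0_norm ?enorm_ge0 ?invr_ge0 ?(ltW s0)// mulrC.
have -> : (\int[mu]_(x in Omega) (P (s / a * enorm (hessian (fun y => (s^-1 * u y)%R) x)))%:E =
    \int[mu]_(x in Omega) (P (`|enorm (hessian u x)| / a))%:E)%E.
  apply: eq_integral => x _.
  rewrite (hessianZ _ _ tu) enormZ !ger0_norm ?enorm_ge0 ?invr_ge0 ?(ltW s0)//.
  by congr (P _)%:E; field; rewrite !gt_eqF.
have -> : (\int[mu]_(x in Omega) (Q (B / (s / a) * `|s^-1 * u x|))%:E =
    \int[mu]_(x in Omega) (Q (`|u x| / b))%:E)%E.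
  apply: eq_integral => x _.
  rewrite normrM [`|s^-1|]ger0_norm ?invr_ge0 ?(ltW s0)//.
  rewrite (_ : B / (s / a) * (s^-1 * `|u x|) = B * a / (s * s) * `|u x|); last first.
    by field; rewrite !gt_eqF.
  by rewrite s2; congr (Q _)%:E; field; rewrite !gt_eqF.
(* Both modulars on the right are at most 1, which leaves [L + 1]. *)
move=> /le_trans; apply; rewrite EFinD leeD//.
by rewrite -[leRHS]mule1 lee_pmul2l.
Qed.

Lemma luxemburg_interpolation :
  (luxemburg mu Omega M (fun x => enorm (grad u x)) <=
   (2 * (L + 2) * Num.sqrt B)%:E *
   sqrte (luxemburg mu Omega P (fun x => enorm (hessian u x)) *
          luxemburg mu Omega Q u))%E.
Proof.
have [Cu cS SO] := tu; set S := closure _ in cS SO.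
have mS : measurable S by exact: compact_measurable_rV.
have offS (v : 'rV[R]_n -> R) : (forall x, v x != 0 -> S x) -> forall x, ~ S x -> v x = 0.
  by move=> vS x Sx; apply/eqP/negPn/negP => /vS.
have uS x : u x != 0 -> S x by move=> ux; apply: subset_closure.
have hS i j x : partial i (partial j u) x != 0 -> S x.
  move=> h; have := partial_supp_closure h; rewrite [S](closure_id _).1; last exact: closed_closure.
  apply: closureS => y; exact: partial_supp_closure.
have cu : continuous u by have [] := Cu 1%N.
(* Both norms on the right are finite, as those of bounded functions with compact support, so the
   product under [sqrte] is an ordinary product of reals. *)
have [b bE] : exists b, luxemburg mu Omega Q u = b%:E.
  have [C hC] := continuous_bounded_on_compact cS cu.
  have := luxemburg_lty mO mS SO (mu_compact cS SO) Q_N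
    (measurable_funTS (continuous_measurable_rV cu)) (offS _ uS) hC.
  have := luxemburg_ge0 mu Omega Q u; case: (luxemburg _ _ _ _) => // r _ _.
  by exists r.
have ch i j : continuous (partial i (partial j u)).
  by have [_ /(_ j)[_ [_ /(_ i)[]]]] := Cu 2%N.
pose hsq x := \sum_(i < n) \sum_(j < n) hessian u x i j ^+ 2.
have [a aE] : exists a, luxemburg mu Omega P (fun x => enorm (hessian u x)) = a%:E.
  have ce : continuous (fun x => enorm (hessian u x)).
    move=> x; apply: (@continuous_comp _ _ _ hsq Num.sqrt); last exact: sqrt_continuous.
    apply: (@continuous_sum_rV R n) => i; apply: continuous_sum_rV => j.
    have -> : (fun x => hessian u x i j ^+ 2) =
        (fun x => partial i (partial j u) x * partial i (partial j u) x).
      by apply/funext => y; rewrite mxE expr2.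
    exact: (@of_class_CM _ _ 0).
  have [C hC] := continuous_bounded_on_compact cS ce.
  have eS x : enorm (hessian u x) != 0 -> S x.
    move=> h; apply/not_notP => Sx; move/eqP: h; apply.
    rewrite (_ : hessian u x = 0) ?enorm0//; apply/matrixP => i j; rewrite !mxE.
    by rewrite (offS _ (@hS i j)).
  have := luxemburg_lty mO mS SO (mu_compact cS SO) P_N
    (measurable_funTS (continuous_measurable_rV ce)) (offS _ eS) hC.
  have := luxemburg_ge0 mu Omega P (fun x => enorm (hessian u x)).
  case: (luxemburg _ _ _ _) => // r _ _; by exists r.
have a0 : 0 <= a by rewrite -lee_fin -aE luxemburg_ge0.
have b0 : 0 <= b by rewrite -lee_fin -bE luxemburg_ge0.
rewrite aE bE -[leRHS]/((2 * (L + 2) * Num.sqrt B * Num.sqrt (a * b))%:E).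
set C := (L + 1) * Num.sqrt B.
have C0 : 0 < C by rewrite mulr_gt0 ?addr_gt0// sqrtr_gt0.
(* The modular inequality yields the factor [L + 1], which [2 * (L + 2)] dominates. *)
apply: (@le_trans _ _ (C * Num.sqrt (a * b))%:E); last first.
  rewrite lee_fin ler_wpM2r ?sqrtr_ge0// /C ler_wpM2r ?sqrtr_ge0//.
  by have := ltW L_gt0; lra.
apply/lee_addgt0Pr => d d0; rewrite -EFinD.
(* Since [e <= 1], [(a + e)(b + e) <= a b + e (a + b + 1) <= a b + (d / C)^2], which is at most
   [(sqrt(a b) + d / C)^2]. *)
pose e := Num.min 1 ((d / C) ^+ 2 / (a + b + 1)).
have ab1 : 0 < a + b + 1 by rewrite ltr_wpDl// addr_ge0.
have e0 : 0 < e by rewrite lt_min ltr01 divr_gt0// exprn_gt0// divr_gt0.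
have e1 : e <= 1 by rewrite ge_min lexx.
have e2 : e * (a + b + 1) <= (d / C) ^+ 2.
  by rewrite -ler_pdivlMr// ge_min lexx orbT.
have [a' [a'0 a'a Pa]] := luxemburg_near e0 aE.
have [b' [b'0 b'b Qb]] := luxemburg_near e0 bE.
apply: (le_trans (luxemburg_admissible_le a'0 b'0 Pa Qb)).
rewrite lee_fin sqrtrM ?(ltW B_gt0)// mulrA -/C.
rewrite -[X in _ + X](mulfVK (lt0r_neq0 C0)) [X in _ + X]mulrC -mulrDr ler_pM2l//.
have dC : 0 <= d / C by rewrite divr_ge0 ?ltW.
rewrite -[leRHS]ger0_norm ?addr_ge0 ?sqrtr_ge0// -sqrtr_sqr ler_wsqrtr//.
have ab0 : 0 <= a * b by exact: mulr_ge0.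
have sq : Num.sqrt (a * b) ^+ 2 = a * b by rewrite sqr_sqrtr.
have cross : 0 <= Num.sqrt (a * b) * (d / C) by rewrite mulr_ge0 ?sqrtr_ge0.
rewrite sqrrD sq.
apply: (@le_trans _ _ ((a + e) * (b + e))); first by rewrite ler_pM ?ltW.
have ee : e * e <= e by rewrite ler_piMl// ltW.
rewrite (_ : (a + e) * (b + e) = a * b + (e * (a + b) + e * e)); last by ring.
rewrite -[leRHS]addrA lerD2l (@le_trans _ _ (e * (a + b + 1)))//.
  by rewrite [leRHS]mulrDr mulr1 lerD2l.
by rewrite (le_trans e2)// lerDr mulrn_wge0.
Qed.

End multiplicative.

Theorem theorem3p1 (R : realType) (n : nat) (n_gt0 : (0 < n)%N)
  (Omega : set 'rV[R]_n) (Omega_domain : open_domain Omega)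
  (M : R -> R) (M_N : N_function M) (M_C1 : C1_pos M) (M_Delta2 : Delta2 M)
  (M_near0 : exists C : R, \forall l \near 0^'+, `|derive1 M l / l| <= C)
  (phi : 'rV[R]_n -> R) (grad_phi : 'rV[R]_n -> 'rV[R]_n)
  (phi_W1oo : W1oo_loc Omega phi grad_phi)
  (mu : {measure set 'rV[R]_n -> \bar R})
  (mu_density : forall A : set 'rV[R]_n, measurable A -> A `<=` Omega ->
    mu A = (\int[lebesgue_rV n]_(x in A) (expR (- phi x))%:E)%E)
  (mu_radon : radon_on Omega mu)
  (P Q : R -> R)
  (P_ge0 : forall t : R, 0 <= t -> 0 <= P t) (Q_ge0 : forall t : R, 0 <= t -> 0 <= Q t)
  (P_nondecreasing : forall s t : R, 0 <= s -> s <= t -> P s <= P t)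
  (Q_nondecreasing : forall s t : R, 0 <= s -> s <= t -> Q s <= Q t)
  (P_measurable : measurable_fun (`[0, +oo[%classic : set R) P)
  (Q_measurable : measurable_fun (`[0, +oo[%classic : set R) Q)
  (P0 : P 0 = 0) (Q0 : Q 0 = 0)
  (MPQ : forall u v w : R, 0 < u -> 0 < v -> 0 < w ->
    M u / u ^+ 2 * (v * w) <= M u + P v + Q w)
  (K A : R) (K_gt0 : 0 < K) (A_gt0 : 0 < A)
  (hardy : forall u, test_function Omega u ->
    (\int[mu]_(x in Omega) (P (enorm (grad_phi x) * `|u x|))%:E <=
     K%:E * \int[mu]_(x in Omega) (P (A * enorm (grad u x)))%:E)%E) :
  exists L B : R, [/\ 0 < L, 0 < B,
    (forall (theta : R) (u : 'rV[R]_n -> R),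
      0 < theta -> test_function Omega u ->
      (\int[mu]_(x in Omega) (M (enorm (grad u x)))%:E <=
       L%:E * \int[mu]_(x in Omega) (P (theta * enorm (hessian u x)))%:E +
       \int[mu]_(x in Omega) (Q (B / theta * `|u x|))%:E)%E) &
    N_function P -> N_function Q ->
    forall u : 'rV[R]_n -> R, test_function Omega u ->
      (luxemburg mu Omega M (fun x => enorm (grad u x)) <=
       (2 * (L + 2) * Num.sqrt B)%:E *
       sqrte (luxemburg mu Omega P (fun x => enorm (hessian u x)) *
              luxemburg mu Omega Q u))%E].
Proof.
have [oO _ _] := Omega_domain; have [c c0 M2] := M_Delta2; have [muK _] := mu_radon.
have L0 : 0 < (1 + K) / 2 by rewrite divr_gt0// addr_gt0.
have B0 := interpolation_cst_gt0 n_gt0 c0 A_gt0.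
have main theta u : 0 < theta -> test_function Omega u -> _ :=
  fun theta0 tu => modular_interpolation n_gt0 oO M_N M_C1 c0 M2 phi_W1oo mu_density
    muK P_ge0 Q_ge0 P_nondecreasing Q_nondecreasing P_measurable Q_measurable MPQ
    A_gt0 tu theta0 K_gt0 hardy.
exists ((1 + K) / 2), (interpolation_cst n c A); split=> // PN QN u tu.
by apply: (luxemburg_interpolation oO M_N muK PN QN L0 B0 main tu).
Qed.
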